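(* Let $(x_*(\cdot),u_*(\cdot))\in\mathscr A^{\mathcal Z}_{\rm adm}\cap\mathscr A^{\mathcal Z}_{\rm Lip}$. If $(x_*(\cdot),u_*(\cdot))$ is a strong local minimum of the time-delayed problem $$J(x(\cdot),u(\cdot))=\int_{t_0}^{t_1}f(t,x(t),x(t-\Delta),u(t),u(t-\Delta))\,dt+S(x(t_1))\to\inf,$$ $$\dot x(t)=\varphi(t,x(t),x(t-\Delta),u(t),u(t-\Delta)),\qquad x(t)=x_0\ \text{for } t\in[t_0-\Delta,t_0],$$ $$u(t)\in U,\qquad u(t)=u_0\in U\ \text{for } t\in[t_0-\Delta,t_0),$$ then there exists a vector function $p(\cdot)\in PC_1([t_0,t_1],\mathbb R^n)$ such that (a) almost everywhere in $[t_0,t_1]$ the adjoint equation $$\dot p(t)=-H^{\mathcal Z}_x[t]-\chi_{[t_0,t_1-\Delta]}(t)\cdot H^{\mathcal Z}_y[t+\Delta]$$ holds; (b) at $t=t_1$ the transversality condition $p(t_1)=-S'(x_*(t_1))$ holds; (c) at almost all points $t\in[t_0,t_1]$ the maximum condition $$H^{\mathcal Z}[t,u_*(t),u_*(t-\Delta)]+\chi_{[t_0,t_1-\Delta]}(t)\cdot H^{\mathcal Z}[t+\Delta,u_*(t+\Delta),u_*(t)]$$ $$=\max_{u\in U}\Big\{H^{\mathcal Z}[t,u,u_*(t-\Delta)]+\chi_{[t_0,t_1-\Delta]}(t)\cdot H^{\mathcal Z}[t+\Delta,u_*(t+\Delta),u]\Big\}$$ holds.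
   Context: Function spaces. A function on $[a,b]$ is piecewise continuous if it is continuous except at finitely many points $a<s_1<\dots<s_N<b$, where both one-sided limits exist and are finite, and its values at the $s_i$ are chosen so that it is right-continuous. It is piecewise continuously differentiable if it is continuous on $[a,b]$, continuously differentiable on $(a,s_1),(s_1,s_2),\dots,(s_N,b)$ for finitely many such points, and its derivative is a piecewise continuous function on $[a,b]$, right-continuous at the $s_i$; $\dot x$ denotes this derivative. $PC([a,b],\mathbb R^n)$ and $PC_1([a,b],\mathbb R^n)$ are the corresponding spaces (componentwise); $PC([a,b],U)$ is the set of piecewise continuous functions with values in $U$. Data: an interval $[t_0,t_1]$, a delay $\Delta>0$, $x_0\in\mathbb R^n$, $\emptyset\ne U\subseteq\mathbb R^m$, $u_0\in U$, $f=f(t,x,y,u,v):\mathbb R\times\mathbb R^n\times\mathbb R^n\times\mathbb R^m\times\mathbb R^m\to\mathbb R$, $\varphi=\varphi(t,x,y,u,v):\mathbb R\times\mathbb R^n\times\mathbb R^n\times\mathbb R^m\times\mathbb R^m\to\mathbb R^n$, where $y$ and $v$ stand for the delayed state and delayed control, and $S:\mathbb R^n\to\mathbb R$ continuously differentiable. Pairs $(x(\cdot),u(\cdot))\in PC_1([t_0,t_1],\mathbb R^n)\times PC([t_0,t_1],U)$ are considered, extended to the left of $t_0$ by $x(t)=x_0$ on $[t_0-\Delta,t_0]$ and $u(t)=u_0$ on $[t_0-\Delta,t_0)$. $\mathscr A^{\mathcal Z}_{\rm Lip}$ is the set of all pairs $(x(\cdot),u(\cdot))$ for which there is $\gamma>0$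 such that $f(t,x,y,u,v)$, $\varphi(t,x,y,u,v)$ are, on the set of all $(t,x,y,u,v)$ with $t\in[t_0,t_1]$, $\|x-x(t)\|<\gamma$, $\|y-x(t-\Delta)\|<\gamma$, $u,v\in\mathbb R^m$, jointly continuous in all variables and continuously differentiable with respect to $x$ and $y$. $\mathscr A^{\mathcal Z}_{\rm adm}$ is the set of all $(x(\cdot),u(\cdot))\in PC_1([t_0,t_1],\mathbb R^n)\times PC([t_0,t_1],U)$ satisfying the delayed dynamics $\dot x(t)=\varphi(t,x(t),x(t-\Delta),u(t),u(t-\Delta))$ on $[t_0,t_1]$ with the initial data $x(t)=x_0$ for $t\in[t_0-\Delta,t_0]$ and $u(t)=u_0$ for $t\in[t_0-\Delta,t_0)$. An admissible $(x_*(\cdot),u_*(\cdot))$ is a strong local minimum if there is $\varepsilon>0$ such that $J(x(\cdot),u(\cdot))\ge J(x_*(\cdot),u_*(\cdot))$ for all $(x(\cdot),u(\cdot))\in\mathscr A^{\mathcal Z}_{\rm adm}$ with $\|x(\cdot)-x_*(\cdot)\|_\infty<\varepsilon$. Pontryagin function: $H^{\mathcal Z}(t,x,y,u,v,p)=\langle p,\varphi(t,x,y,u,v)\rangle-f(t,x,y,u,v)$. Abbreviations: $H^{\mathcal Z}[t]=H^{\mathcal Z}(t,x_*(t),x_*(t-\Delta),u_*(t),u_*(t-\Delta),p(t))$, $H^{\mathcal Z}[t,u,v]=H^{\mathcal Z}(t,x_*(t),x_*(t-\Delta),u,v,p(t))$, and analogously for the partial derivatives $H^{\mathcal Z}_x[t]$,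 $H^{\mathcal Z}_y[t]$. $\chi_M$ is the characteristic function of $M$; terms multiplied by $\chi_{[t_0,t_1-\Delta]}(t)$ are read as $0$ for $t\notin[t_0,t_1-\Delta]$. *)

(* Defs.v *)
From HB Require Import structures.
From mathcomp Require Import all_boot all_order all_algebra.
From mathcomp Require Import all_classical all_reals all_analysis.

Set Implicit Arguments.
Unset Strict Implicit.
Unset Printing Implicit Defensive.

Import Order.TTheory GRing.Theory Num.Theory.
Import numFieldNormedType.Exports.

Local Open Scope classical_set_scope.
Local Open Scope ring_scope.

(* R^k is 'rV[R]_k with the library norm, which is the maximum norm. Norms
   only occur below in "there is a radius such that ...", so the choice of an
   equivalent norm is immaterial. *)

Section PiecewiseFunctions.
Context {R : realType} {V : normedModType R}.
Implicit Types (a b t : R) (s : seq R).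

(* s lists the exceptional points, all interior to [a, b]. At the end points
   a and b the function is one-sidedly continuous. *)
Definition pc_off s a b (g : R -> V) : Prop :=
  [/\ forall t, t \in s -> t \in `]a, b[,
      forall t, t \in `[a, b] -> t \notin s ->
        g r @[r --> within `[a, b] (nbhs t)] --> g t
    & forall t, t \in s -> cvg (g r @[r --> t^'-]) /\ g r @[r --> t^'+] --> g t].

Definition piecewise_continuous a b (g : R -> V) : Prop :=
  exists s, pc_off s a b g.

(* g belongs to PC_1([a, b], V) and dg is its derivative. The values of dg on
   the whole of [a, b] are determined by g: at the exceptional points by
   right-continuity, at a and b by one-sided continuity. *)
Definition piecewise_C1 a b (g dg : R -> V) : Prop :=
  {within `[a, b], continuous g} /\
  exists s, pc_off s a b dg /\
    forall t, t \in `]a, b[ -> t \notin s -> is_derive t 1 g (dg t).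

Definition sup_norm a b (g : R -> V) : R := sup [set `|g t| | t in `[a, b]].

End PiecewiseFunctions.

Section Calculus.
Context {R : realType}.

Definition dotp {k : nat} (p q : 'rV[R]_k) : R := \sum_(i < k) p 0 i * q 0 i.

Definition gradient {k : nat} (g : 'rV[R]_k -> R) (x : 'rV[R]_k) : 'rV[R]_k :=
  \row_i 'D_(delta_mx 0 i) g x.

(* The domain being finite dimensional, continuity of all directional
   derivatives is continuity of the differential. *)
Definition continuously_differentiable {k : nat} (g : 'rV[R]_k -> R) : Prop :=
  (forall x, differentiable g x) /\ (forall h, continuous (fun x => 'D_h g x)).

Definition is_max_over {T : Type} (A : set T) (g : T -> R) (M : R) : Prop :=
  (exists2 a, A a & g a = M) /\ (forall a, A a -> g a <= M).

End Calculus.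

(* Functions of (t, x, y, u, v); y and v stand for the delayed state and the
   delayed control. *)
Definition delay_fun (R : realType) (n m : nat) (V : Type) : Type :=
  R -> 'rV[R]_n -> 'rV[R]_n -> 'rV[R]_m -> 'rV[R]_m -> V.

Section DelayedProblem.
Context {R : realType} {n m : nat}.
Context (t0 t1 delta : R).

Definition tube (gamma : R) (x : R -> 'rV[R]_n) :
    set (R * 'rV[R]_n * 'rV[R]_n * 'rV[R]_m * 'rV[R]_m) :=
  [set z | let: (t, xi, eta, _, _) := z in
    [/\ t \in `[t0, t1], `|xi - x t| < gamma & `|eta - x (t - delta)| < gamma]].

(* The derivatives in x and in y are required to be jointly continuous in
   (t, x, y, u, v), like the function itself. *)
Definition C1_on_tube {V : normedModType R} (gamma : R) (x : R -> 'rV[R]_n)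
    (g : delay_fun R n m V) : Prop :=
  [/\ {within tube gamma x, continuous (fun '(t, xi, eta, u, v) =>
         g t xi eta u v)},
      forall t xi eta u v, tube gamma x (t, xi, eta, u, v) ->
        differentiable (fun z => g t z eta u v) xi /\
        differentiable (fun z => g t xi z u v) eta,
      forall h, {within tube gamma x, continuous (fun '(t, xi, eta, u, v) =>
         'D_h (fun z => g t z eta u v) xi)}
    & forall h, {within tube gamma x, continuous (fun '(t, xi, eta, u, v) =>
         'D_h (fun z => g t xi z u v) eta)}].

(* The set A_Lip. *)
Definition lip_pair (f : delay_fun R n m R) (phi : delay_fun R n m 'rV[R]_n)
    (x : R -> 'rV[R]_n) (u : R -> 'rV[R]_m) : Prop :=
  exists gamma, [/\ 0 < gamma, C1_on_tube gamma x f & C1_on_tube gamma x phi].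

(* The set A_adm. A pair is given by functions on R of which only the values
   on [t0 - delta, t1] matter. Both sides of the dynamics are right-continuous
   on [t0, t1), so the equation there is the equation for piecewise continuous
   functions on [t0, t1]; its instance at t1 is the limit from the left.
   Evaluating u (t - delta) pointwise at t = t1 instead would wrongly exclude
   controls that jump at t1 - delta, since dx is left-continuous at t1. *)
Definition admissible (x0 : 'rV[R]_n) (U : set 'rV[R]_m) (u0 : 'rV[R]_m)
    (phi : delay_fun R n m 'rV[R]_n)
    (x : R -> 'rV[R]_n) (u : R -> 'rV[R]_m) : Prop :=
  [/\ exists dx, piecewise_C1 t0 t1 x dx /\
        (forall t, t \in `[t0, t1[ ->
           dx t = phi t (x t) (x (t - delta)) (u t) (u (t - delta))),
      piecewise_continuous t0 t1 u,
      forall t, t \in `[t0, t1] -> U (u t),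
      forall t, t \in `[t0 - delta, t0] -> x t = x0
    & forall t, t \in `[t0 - delta, t0[ -> u t = u0].

(* Where the integrand is not integrable the value of the integral is junk.
   This is harmless: for x uniformly close to an x' such that (x', u') is a
   lip_pair, the integrand is piecewise continuous. *)
Definition cost (f : delay_fun R n m R) (S : 'rV[R]_n -> R)
    (x : R -> 'rV[R]_n) (u : R -> 'rV[R]_m) : R :=
  (\int[lebesgue_measure]_(t in `[t0, t1])
     f t (x t) (x (t - delta)) (u t) (u (t - delta)))%R + S (x t1).

Definition strong_local_min (x0 : 'rV[R]_n) (U : set 'rV[R]_m) (u0 : 'rV[R]_m)
    (f : delay_fun R n m R) (phi : delay_fun R n m 'rV[R]_n)
    (S : 'rV[R]_n -> R) (xs : R -> 'rV[R]_n) (us : R -> 'rV[R]_m) : Prop :=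
  admissible x0 U u0 phi xs us /\
  exists2 eps, 0 < eps & forall x u, admissible x0 U u0 phi x u ->
    sup_norm t0 t1 (x \- xs) < eps -> cost f S xs us <= cost f S x u.

End DelayedProblem.

Section PontryaginFunction.
Context {R : realType} {n m : nat}.
Context (delta : R) (f : delay_fun R n m R) (phi : delay_fun R n m 'rV[R]_n).

Definition pontryagin (t : R) (x y : 'rV[R]_n) (u v : 'rV[R]_m)
    (p : 'rV[R]_n) : R :=
  dotp p (phi t x y u v) - f t x y u v.

Context (xs : R -> 'rV[R]_n) (us : R -> 'rV[R]_m) (p : R -> 'rV[R]_n).

(* H[t, u, v] *)
Definition H_along (t : R) (u v : 'rV[R]_m) : R :=
  pontryagin t (xs t) (xs (t - delta)) u v (p t).

(* H_x[t] and H_y[t] *)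
Definition Hx_along (t : R) : 'rV[R]_n :=
  gradient (fun x =>
    pontryagin t x (xs (t - delta)) (us t) (us (t - delta)) (p t)) (xs t).

Definition Hy_along (t : R) : 'rV[R]_n :=
  gradient (fun y =>
    pontryagin t (xs t) y (us t) (us (t - delta)) (p t)) (xs (t - delta)).

End PontryaginFunction.

(* chi_[a,b](t) times a term, the term being read as 0 for t outside [a, b] *)
Definition chi_mul {R : realType} {V : zmodType} (a b t : R) (w : V) : V :=
  if t \in `[a, b] then w else 0.

(* Main.v *)
(* The necessary conditions come from single needle variations: the control is
   replaced by v on [tau, tau + lam[, where tau is a point of continuity of all
   the controls involved. The perturbed trajectory stays within C * lam of xs, by
   a contraction argument in an exponentially weighted norm applied to the
   dynamics truncated to the tube. The same fixed point theorem, run in reversed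
   time, solves the adjoint equation, whose advanced term then becomes a delay.
   Because the end point is free, no variational equation is needed. Integrating
   the derivative of <p, xi>, corrected by the integral of <H_y[s], xi(s - delta)>
   over the window [t, t + delta], turns the increment of the cost into minus the
   integral of the increment of H, up to a remainder which is o(lam) by dominated
   convergence. Dividing by lam gives the maximum condition at tau. *)

Require Import Defs.
From HB Require Import structures.
From mathcomp Require Import all_boot all_order all_algebra.
From mathcomp Require Import all_classical all_reals all_analysis.
From mathcomp Require Import measurable_realfun.
From mathcomp Require Import ring lra.

Set Implicit Arguments.
Unset Strict Implicit.
Unset Printing Implicit Defensive.

Import Order.TTheory GRing.Theory Num.Theory.
Import numFieldNormedType.Exports.

Local Open Scope classical_set_scope.
Local Open Scope ring_scope.

(** * Regulated functions *)


(** The regularity assumptions hold only in a tube around the reference trajectory, and the given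
    pair is meaningful only on [[t0 - delta, t1]]. Everything is therefore moved to total functions
    on the line: arguments are clamped, integrands are cut off by [chi_mul], and [regulated] leaves
    the values at finitely many points free, so that sums, shifts, time reversal and gluing stay in
    the class. Derivatives are asserted off a finite list only, and integrals are handled through
    their continuous primitives. The linear terms in the expansion of H are taken along the
    reference control, although the perturbed pair uses the needle. On the needle and on its echo
    one delay later the remainder is thus only O(lam), but these intervals shrink to the points
    [tau] and [tau + delta]. At any other fixed time the control is eventually unchanged, and
    differentiability in the state gives o(lam). Hence pointwise expansions and one common bound
    O(lam) suffice, with no expansion uniform in time. *)

Section Regulated.
Context {R : realType}.
Implicit Types (t c d : R) (s : seq R) (b : bool).

(** The boolean ([true] for the right) lets statements about both one-sided filters be proved at
    once, and time reversal becomes negation of [b]. *)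
Definition side b t : set_system R := if b then t^'+ else t^'-.

#[global] Instance side_proper b t : ProperFilter (side b t).
Proof. by case: b; rewrite /side; typeclasses eauto. Qed.

Lemma side_nbhs b t : side b t --> nbhs t.
Proof. by case: b; exact: cvg_within. Qed.

Lemma near_side b t (P : set R) : (\forall r \near t, P r) -> \forall r \near side b t, P r.
Proof. exact: side_nbhs. Qed.

(* The values at the exceptional points are unconstrained, as needed for
   [u (t - delta)], which may jump at [t1]. *)
Definition regulated {T : topologicalType} (g : R -> T) : Prop :=
  exists s, (forall t, t \notin s -> {for t, continuous g}) /\
    forall b t, exists l : T, g r @[r --> side b t] --> l.

Lemma regulated_continuous {T : topologicalType} (g : R -> T) :
  continuous g -> regulated g.
Proof.
move=> gc; exists [::]; split=> [t _|b t]; first exact: gc.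
by exists (g t); apply: cvg_trans (gc t); apply: cvg_app; exact: side_nbhs.
Qed.

Lemma regulated_cst {T : topologicalType} (x : T) : regulated (fun _ => x).
Proof. by apply: regulated_continuous => t; exact: cvg_cst. Qed.

Lemma regulated_comp {T T' : topologicalType} (f : T -> T') (g : R -> T) :
  continuous f -> regulated g -> regulated (fun t => f (g t)).
Proof.
move=> fc [s [gs gl]]; exists s; split=> [t ts|b t].
  by apply: (@continuous_comp _ _ _ g f); [exact: gs|exact: fc].
have [l gtl] := gl b t; exists (f l).
exact: (cvg_comp _ _ gtl (fc l)).
Qed.

Lemma regulated_pair {T T' : topologicalType} (f : R -> T) (g : R -> T') :
  regulated f -> regulated g -> regulated (fun t => (f t, g t)).
Proof.
move=> [s [fs fl]] [s' [gs gl]]; exists (s ++ s'); split=> [t|b t].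
  rewrite mem_cat negb_or => /andP[ts ts'].
  by apply: cvg_pair; [exact: fs|exact: gs].
have [l fl'] := fl b t; have [l' gl'] := gl b t; exists (l, l').
exact: cvg_pair.
Qed.

Lemma near_ltE c t : t != c -> \forall r \near t, (r < c) = (t < c).
Proof.
rewrite neq_lt => /orP[tc|ct]; near=> r.
  by rewrite tc; near: r; exact: lt_nbhsl.
rewrite [RHS]ltNge (ltW ct)/= ltNge; apply/negbTE; rewrite negbK ltW//.
by near: r; exact: lt_nbhsr.
Unshelve. all: by end_near. Qed.

Lemma near_neq c t : t != c -> \forall r \near t, r != c.
Proof.
rewrite neq_lt => /orP[tc|ct]; near=> r.
  have rc : r < c by near: r; exact: lt_nbhsl.
  by rewrite lt_eqF.
have rc : c < r by near: r; exact: lt_nbhsr.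
by rewrite gt_eqF.
Unshelve. all: by end_near. Qed.

Lemma side_neq b c t : \forall r \near side b t, r != c.
Proof.
have [->|tc] := eqVneq t c; last exact/near_side/near_neq.
case: b; rewrite /side.
  by near=> r; rewrite gt_eqF//; near: r; exact: nbhs_right_gt.
by near=> r; rewrite lt_eqF//; near: r; exact: nbhs_left_lt.
Unshelve. all: by end_near. Qed.

Lemma side_ltE b c t : \forall r \near side b t, (r < c) = if t == c then ~~ b else (t < c).
Proof.
case: eqVneq => [->|tc]; last exact/near_side/near_ltE.
case: b; rewrite /side.
  by near=> r; apply/negbTE; rewrite -leNgt ltW//; near: r; exact: nbhs_right_gt.
by near=> r; near: r; exact: nbhs_left_lt.
Unshelve. all: by end_near. Qed.

(** Same value as for the strict inequality, since the one-sided filters exclude [c] itself. *)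
Lemma side_leE b c t : \forall r \near side b t, (r <= c) = if t == c then ~~ b else (t < c).
Proof.
near=> r; have rc : r != c by near: r; exact: side_neq.
by rewrite le_eqVlt (negbTE rc)/=; near: r; exact: side_ltE.
Unshelve. all: by end_near. Qed.

(** The condition is locally constant away from [c] and eventually constant on each side of every
    point, so gluing creates no exceptional point besides [c]. *)
Lemma regulated_ite {T : topologicalType} (P : pred R) c (f g : R -> T) :
  (forall t, t != c -> \forall r \near t, P r = P t) ->
  (forall b t, exists v, \forall r \near side b t, P r = v) ->
  regulated f -> regulated g -> regulated (fun t => if P t then f t else g t).
Proof.
move=> Pt Pb [s [fs fl]] [s' [gs gl]]; exists (c :: s ++ s'); split=> [t|b t].
  rewrite inE mem_cat !negb_or => /and3P[tc ts ts'].
  rewrite /prop_for /continuous_at; have [Ptt|nPtt] := boolP (P t).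
    apply: cvg_trans (fs _ ts); apply: near_eq_cvg.
    by near=> r; rewrite (near (Pt _ tc) r)// Ptt.
  apply: cvg_trans (gs _ ts'); apply: near_eq_cvg.
  by near=> r; rewrite (near (Pt _ tc) r)// (negbTE nPtt).
have [[] vP] := Pb b t.
  have [l fl'] := fl b t; exists l; apply: cvg_trans fl'; apply: near_eq_cvg.
  by near=> r; rewrite (near vP r).
have [l fl'] := gl b t; exists l; apply: cvg_trans fl'; apply: near_eq_cvg.
by near=> r; rewrite (near vP r).
Unshelve. all: by end_near. Qed.

Lemma regulated_ite_lt {T : topologicalType} c (f g : R -> T) :
  regulated f -> regulated g -> regulated (fun t => if t < c then f t else g t).
Proof.
apply: (@regulated_ite _ (fun t => t < c) c); first exact: near_ltE.
by move=> b t; exists (if t == c then ~~ b else (t < c)); exact: side_ltE.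
Qed.

Lemma regulated_ite_le {T : topologicalType} c (f g : R -> T) :
  regulated f -> regulated g -> regulated (fun t => if t <= c then f t else g t).
Proof.
apply: (@regulated_ite _ (fun t => t <= c) c).
  move=> t tc; near=> r; have rc : r != c by near: r; exact: near_neq.
  by rewrite !le_eqVlt (negbTE rc) (negbTE tc)/=; near: r; exact: near_ltE.
by move=> b t; exists (if t == c then ~~ b else (t < c)); exact: side_leE.
Unshelve. all: by end_near. Qed.

(** Membership in an interval is a conjunction of two half-line conditions, so two successive cuts
    treat all kinds of end points. *)
Lemma regulated_ite_itv {T : topologicalType} (i : interval R) (f g : R -> T) :
  regulated f -> regulated g ->
  regulated (fun t => if t \in i then f t else g t).
Proof.
move=> fr gr; case: i => [l u].
have rl : regulated (fun t => if (l <= BLeft t)%O then f t else g t).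
  case: l => [[] a|[]]//=; rewrite /<=%O/=.
  - rewrite (_ : (fun t => _) = fun t => if t < a then g t else f t).
      exact: regulated_ite_lt.
    by apply/funext => t; case: (ltP t a).
  - rewrite (_ : (fun t => _) = fun t => if t <= a then g t else f t).
      exact: regulated_ite_le.
    by apply/funext => t; case: (ltP a t).
have : regulated (fun t => if (BRight t <= u)%O then if (l <= BLeft t)%O then f t else g t else g t).
  case: u => [[] a|[]]//=; rewrite /<=%O/=.
  - exact: regulated_ite_lt.
  - exact: regulated_ite_le.
congr regulated; apply/funext => t; rewrite itv_boundlr.
by case: (l <= _)%O; case: (_ <= u)%O.
Qed.

Lemma near_sideE b t (P : set R) :
  (\forall r \near side b t, P r) <-> (\forall r \near t, (if b then t < r else r < t) -> P r).
Proof. by case: b; rewrite /side /at_right /at_left near_withinE. Qed.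

Lemma cvg_side_shift b t d : (fun r => r + d) @ side b t --> side b (t + d).
Proof.
move=> A /= /near_sideE h; rewrite /nbhs/= -/(nbhs _ _); apply/near_sideE.
have : (fun r => r + d) r @[r --> t] --> t + d by apply: cvgD; [exact: cvg_id|exact: cvg_cst].
move=> /(_ _ h) /= h'.
have {h'} : \forall r \near t, (if b then t + d < r + d else r + d < t + d) -> A (r + d) := h'.
by apply: filterS => r; rewrite !ltrD2r.
Qed.

Lemma cvg_side_opp b t : -%R @ side b t --> side (~~ b) (- t).
Proof.
move=> A /= /near_sideE h; rewrite /nbhs/= -/(nbhs _ _); apply/near_sideE.
have : - r @[r --> t] --> - t by apply: cvgN; exact: cvg_id.
move=> /(_ _ h) /= h'.
have {h'} : \forall r \near t, (if ~~ b then - t < - r else - r < - t) -> A (- r) := h'.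
by apply: filterS => r; rewrite !ltrN2; case: b {h}.
Qed.

Lemma regulated_shift {T : topologicalType} (g : R -> T) d :
  regulated g -> regulated (fun t => g (t + d)).
Proof.
move=> [s [gs gl]]; exists [seq t - d | t <- s]; split=> [t ts|b t].
  apply: (@continuous_comp _ _ _ (fun t => t + d) g).
    by apply: cvgD; [exact: cvg_id|exact: cvg_cst].
  apply: gs; apply: contra ts => ts; apply/mapP; exists (t + d) => //.
  by rewrite addrK.
have [l gtl] := gl b (t + d); exists l.
exact: (cvg_comp _ _ (@cvg_side_shift b t d) gtl).
Qed.

Lemma regulated_reverse {T : topologicalType} (g : R -> T) :
  regulated g -> regulated (fun t => g (- t)).
Proof.
move=> [s [gs gl]]; exists [seq - t | t <- s]; split=> [t ts|b t].
  apply: (@continuous_comp _ _ _ -%R g).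
    by apply: cvgN; exact: cvg_id.
  apply: gs; apply: contra ts => ts; apply/mapP; exists (- t) => //.
  by rewrite opprK.
have [l gtl] := gl (~~ b) (- t); exists l.
exact: (cvg_comp _ _ (@cvg_side_opp b t) gtl).
Qed.

End Regulated.

(** * Primitives and the mean value inequality *)


Section RowVectors.
Context {R : realType} {n : nat}.
Implicit Types v : 'rV[R]_n.

Lemma norm_coord_le v i : `|v 0 i| <= `|v|.
Proof.
by rewrite [leRHS]/Num.Def.normr/= mx_normrE; exact: (le_bigmax _ (fun j => `|v j.1 j.2|) (0, i)).
Qed.

Lemma norm_row_le v (c : R) : 0 <= c -> (forall i, `|v 0 i| <= c) -> `|v| <= c.
Proof.
move=> c0 vc; rewrite /Num.Def.normr/= mx_normrE (bigmax_le _ c0)//= => -[i j] _ /=.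
by rewrite ord1.
Qed.

Lemma cvg_rowP (T : Type) (F : set_system T) (FF : Filter F) (g : T -> 'rV[R]_n) v :
  (g r @[r --> F] --> v) <-> (forall i, g r 0 i @[r --> F] --> v 0 i).
Proof.
split=> [gv i|gv].
  exact: (cvg_comp _ _ gv (@coord_continuous _ _ _ 0 i v)).
apply/cvgrPdist_le => e e0; near=> r.
apply: norm_row_le; first exact: ltW.
move=> i; rewrite !mxE; move: i; near: r; apply: filter_forall => i.
exact: ((cvgrPdist_le _ _).1 (gv i)).
Unshelve. all: by end_near. Qed.

Lemma is_derive_rowP (G : R -> 'rV[R]_n) (dG : 'rV[R]_n) (t : R) :
  is_derive t 1 G dG <-> (forall i, is_derive t 1 (fun r => G r 0 i) (dG 0 i)).
Proof.
split=> [[Gd <-] i|Gi].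
  have /derivable_mxP Gd' := Gd; rewrite derive_mx// mxE; exact/derivableP.
have Gd : derivable G t 1.
  by apply/derivable_mxP => i j; rewrite ord1; have [] := Gi j.
apply: DeriveDef => //; rewrite derive_mx//; apply/rowP => i; rewrite mxE.
by have [] := Gi i.
Qed.

End RowVectors.

Section RegulatedAlgebra.
Context {R : realType}.

Lemma regulatedD {V : normedModType R} (f g : R -> V) :
  regulated f -> regulated g -> regulated (fun t => f t + g t).
Proof.
move=> fr gr; apply: (@regulated_comp _ _ _ (fun z : V * V => z.1 + z.2) (fun t => (f t, g t))).
  by move=> z; apply: cvgD; [exact: cvg_fst|exact: cvg_snd].
exact: regulated_pair.
Qed.

Lemma regulatedN {V : normedModType R} (f : R -> V) :
  regulated f -> regulated (fun t => - f t).
Proof. by apply: regulated_comp; exact: opp_continuous. Qed.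

Lemma regulatedB {V : normedModType R} (f g : R -> V) :
  regulated f -> regulated g -> regulated (fun t => f t - g t).
Proof. by move=> fr gr; apply: regulatedD => //; exact: regulatedN. Qed.

Lemma regulatedM (f g : R -> R) :
  regulated f -> regulated g -> regulated (fun t => f t * g t).
Proof.
move=> fr gr; apply: (@regulated_comp _ _ _ (fun z : R * R => z.1 * z.2) (fun t => (f t, g t))).
  by move=> z; apply: cvgM; [exact: cvg_fst|exact: cvg_snd].
exact: regulated_pair.
Qed.

Lemma regulated_sum {I : finType} (F : I -> R -> R) :
  (forall i, regulated (F i)) -> regulated (fun t => \sum_i F i t).
Proof.
move=> Fr; rewrite (_ : (fun t => _) = \sum_i F i); last by apply/funext => t; rewrite fct_sumE.
apply: (big_ind (fun f => regulated f)) => //.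
- exact: regulated_cst.
- by move=> f g; exact: regulatedD.
Qed.

Lemma regulated_row {n : nat} (g : R -> 'rV[R]_n) :
  (forall i, regulated (fun t => g t 0 i)) -> regulated g.
Proof.
move=> gr; have [s sP] := choice gr.
exists (flatten [seq s i | i <- enum 'I_n]); split=> [t ts|b t].
  apply/cvg_rowP => i; apply: (sP i).1; apply: contra ts => ts.
  by apply/flattenP; exists (s i) => //; apply: map_f; rewrite mem_enum.
have /choice[l lP] : forall i, exists l : R, g r 0 i @[r --> side b t] --> l.
  by move=> i; exact: (sP i).2.
by exists (\row_i l i); apply/cvg_rowP => i; rewrite mxE.
Qed.

Lemma regulated_coord {n : nat} (g : R -> 'rV[R]_n) i :
  regulated g -> regulated (fun t => g t 0 i).
Proof. by apply: (regulated_comp (f := fun v : 'rV[R]_n => v 0 i)); exact: coord_continuous. Qed.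

Lemma near_sides (t : R) (P : set R) : P t -> (forall b, \forall r \near side b t, P r) ->
  \forall r \near t, P r.
Proof.
move=> Pt Pb; have /near_sideE h1 := Pb true; have /near_sideE h2 := Pb false.
near=> r; have [rt|tr|->//] := ltgtP r t.
  by apply: (near h2 r) => //.
by apply: (near h1 r) => //.
Unshelve. all: by end_near. Qed.

Lemma continuous_side {T : topologicalType} (g : R -> T) t :
  (forall b, g r @[r --> side b t] --> g t) -> {for t, continuous g}.
Proof.
move=> gb A At; apply: near_sides => /=; first exact: nbhs_singleton.
by move=> b; exact: gb.
Qed.

(** Near each point the function is controlled by its value there and its two one-sided limits;
    compactness of the segment, in its near-covering form with the bound tending to infinity, makes
    the bound uniform. *)
Lemma regulated_bounded {V : normedModType R} (g : R -> V) (a b : R) : regulated g ->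
  exists M, forall t, a <= t <= b -> `|g t| <= M.
Proof.
move=> [s [_ gl]].
have /compact_near_coveringP/(_ R (+oo)) := @segment_compact R a b.
move=> /(_ (fun M t => `|g t| <= M) _)[].
  move=> t _.
  have [M Mt] : exists M, \forall r \near t, `|g r| <= M.
    have [l gtl] := gl true t; have [l' gtl'] := gl false t.
    exists (`|g t| + (`|l| + 1) + (`|l'| + 1)); apply: near_sides.
      by rewrite -addrA lerDl addr_ge0// addr_ge0.
    have aux (k : V) bb : g r @[r --> side bb t] --> k -> \forall r \near side bb t, `|g r| <= `|k| + 1.
      move=> gk; have /cvgrPdist_lt/(_ 1 ltr01) gk1 := gk.
      near=> r; rewrite -[g r](subrK k) addrC (le_trans (ler_normD _ _))// lerD2l.
      by rewrite distrC ltW//; near: r.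
    case.
      have := aux _ _ gtl; apply: filterS => r /le_trans; apply.
      by rewrite -addrA [leRHS]addrCA lerDl addr_ge0// addr_ge0.
    have := aux _ _ gtl'; apply: filterS => r /le_trans; apply.
    by rewrite lerDr addr_ge0// addr_ge0.
  near=> r M0 => /=; apply: (@le_trans _ _ M).
    by near: r.
  by near: M0; apply: nbhs_pinfty_ge; exact: num_real.
move=> M [_ hM]; exists (M + 1) => t abt.
by apply: (hM (M + 1)); [rewrite ltrDl|rewrite /= in_itv].
Unshelve. all: by end_near. Qed.

(** The complement of the exceptional points is open and the function is continuous on it; on the
    exceptional points all preimages are finite. *)
Lemma regulated_measurable (g : R -> R) : regulated g -> measurable_fun setT g.
Proof.
move=> [s [gs _]].
have sm : measurable [set` s].
  by apply: countable_measurable; [exact: measurable_set1|exact/finite_set_countable/finite_seq].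
rewrite -(setvU [set` s]); apply/measurable_funU => //; first exact: measurableC.
split.
  apply: open_continuous_measurable_fun.
    rewrite openC; move: (finite_seq s).
    apply: (accessible_finite_set_closed (T := R)).1.
    exact/hausdorff_accessible/Rhausdorff.
  by move=> t; rewrite inE /= => /negP ts; exact: gs.
move=> _ Y mY; apply: countable_measurable; first exact: measurable_set1.
by apply: finite_set_countable; apply: finite_setIl; exact: finite_seq.
Qed.

Lemma regulated_integrable (g : R -> R) a b : regulated g ->
  lebesgue_measure.-integrable `[a, b] (EFin \o g).
Proof.
move=> gr; apply: measurable_bounded_integrable => //.
- change (lebesgue_measure (`[a, b] : set R) < +oo)%E.
  by rewrite lebesgue_measure_itv/=; case: ifPn => _; rewrite ?ltry// -EFinB ltry.
- by apply: measurable_funTS; exact: regulated_measurable.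
- have [M MP] := regulated_bounded a b gr; exists M; split; first exact: num_real.
  move=> x Mx t; rewrite /= in_itv/= => abt.
  by rewrite (le_trans (MP _ abt))// ltW.
Qed.

End RegulatedAlgebra.

Section MeanValue.
Context {R : realType}.
Implicit Types (a b t : R) (s : seq R).

Lemma ndecr_off s (f df : R -> R) a b : continuous f -> a <= b ->
  (forall t, a < t < b -> t \notin s -> is_derive t 1 f (df t)) ->
  (forall t, a < t < b -> t \notin s -> 0 <= df t) -> f a <= f b.
Proof.
move=> fc; elim: s a b => [|c s IH] a b ab fd df0.
  apply: (@ger0_derive1_ndecr _ f a b) => //.
  - by move=> t; rewrite in_itv/= => abt; have [] := fd t abt isT.
  - move=> t; rewrite in_itv/= => abt; rewrite derive1E.
    by have [_ ->] := fd t abt isT; exact: df0.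
  - exact: continuous_subspaceT.
have [/andP[ac cb]|nacb] := boolP (a < c < b).
  apply: (@le_trans _ _ (f c)).
    apply: IH => [|t /andP[at' tc] ts|t /andP[at' tc] ts]; first exact: ltW.
      by apply: fd; rewrite ?at' ?(lt_trans tc)// inE negb_or ts lt_eqF.
    by apply: df0; rewrite ?at' ?(lt_trans tc)// inE negb_or ts lt_eqF.
  apply: IH => [|t /andP[ct tb] ts|t /andP[ct tb] ts]; first exact: ltW.
    by apply: fd; rewrite ?tb ?(lt_trans _ ct)// inE negb_or ts gt_eqF.
  by apply: df0; rewrite ?tb ?(lt_trans _ ct)// inE negb_or ts gt_eqF.
apply: IH => // t abt ts.
  apply: fd => //; rewrite inE negb_or ts andbT; apply: contraNneq nacb => <-.
  exact: abt.
apply: df0 => //; rewrite inE negb_or ts andbT; apply: contraNneq nacb => <-.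
exact: abt.
Qed.

(** Both [h + f] and [h - f] have a nonnegative derivative off [s], hence are nondecreasing. With a
    suitable majorant [h] this replaces every estimate of an integral by a comparison of
    derivatives. *)
Lemma mean_value_le s (f df h dh : R -> R) a b : continuous f -> continuous h -> a <= b ->
  (forall t, a < t < b -> t \notin s -> is_derive t 1 f (df t)) ->
  (forall t, a < t < b -> t \notin s -> is_derive t 1 h (dh t)) ->
  (forall t, a < t < b -> t \notin s -> `|df t| <= dh t) ->
  `|f b - f a| <= h b - h a.
Proof.
move=> fc hc ab fd hd le.
rewrite ler_norml; apply/andP; split.
  have : (h + f) a <= (h + f) b.
    apply: (@ndecr_off s _ (fun t => dh t + df t)) => //.
    - by move=> t; apply: continuousD; [exact: hc|exact: fc].
    - by move=> t abt ts; have := hd _ abt ts; have := fd _ abt ts => ? ?; exact: is_deriveD.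
    - by move=> t abt ts; have := le _ abt ts; rewrite ler_norml => /andP[+ _]; lra.
  by rewrite !fctE; lra.
have : (h - f) a <= (h - f) b.
  apply: (@ndecr_off s _ (fun t => dh t - df t)) => //.
  - by move=> t; apply: continuousB; [exact: hc|exact: fc].
  - by move=> t abt ts; have := hd _ abt ts; have := fd _ abt ts => ? ?; exact: is_deriveB.
  - by move=> t abt ts; have := le _ abt ts; rewrite ler_norml => /andP[_]; lra.
by rewrite !fctE; lra.
Qed.

Lemma derive0_off_cst s (f : R -> R) a b : continuous f -> a <= b ->
  (forall t, a < t < b -> t \notin s -> is_derive t 1 f 0) -> f b = f a.
Proof.
move=> fc ab fd; apply/eqP; rewrite -subr_eq0 -normr_le0.
have := @mean_value_le s f (fun=> 0) (fun=> 0) (fun=> 0) a b fc _ ab fd _ _.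
rewrite subrr; apply.
- by move=> t; exact: cvg_cst.
- by move=> t _ _; rewrite normr0.
Qed.

Notation mu := (@lebesgue_measure R).

Definition primitive a (g : R -> R) t : R := parameterized_integral mu a t g.

(** The interval of integration is empty or a point. Adding an initial value to a primitive
    therefore produces the constant history to the left of [a] by itself. *)
Lemma primitive_le0 a (g : R -> R) t : t <= a -> primitive a g t = 0.
Proof.
rewrite /primitive /parameterized_integral le_eqVlt => /orP[/eqP->|ta].
  by rewrite set_itv1 Rintegral_set1.
by rewrite set_itv_ge ?Rintegral_set0// bnd_simp -ltNge.
Qed.

Lemma primitive_continuous a (g : R -> R) : regulated g -> continuous (primitive a g).
Proof.
move=> gr t.
have w (b : R) : a < b -> {within `[a, b], continuous (primitive a g)}.
  move=> ab; apply: parameterized_integral_continuous; first exact: ltW.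
  exact: regulated_integrable.
have [ta|at'|ta] := ltgtP t a.
- apply: cvg_near_cst; rewrite (primitive_le0 _ (ltW ta)).
  by near=> r; apply: primitive_le0; apply: ltW; near: r; exact: lt_nbhsl.
- have atp : a < t + 1 by rewrite (lt_trans at')// ltrDl.
  have /(continuous_within_itvP _ atp)[+ _ _] := w _ atp; apply.
  by rewrite in_itv/= at' ltrDl ltr01.
- rewrite ta; apply: continuous_side => -[].
    have ap : a < a + 1 by rewrite ltrDl.
    by have /(continuous_within_itvP _ ap)[_ + _] := w _ ap; apply.
  apply: cvg_near_cst; rewrite (primitive_le0 _ (lexx a)).
  by near=> r; apply: primitive_le0; apply: ltW; near: r; exact: nbhs_left_lt.
Unshelve. all: by end_near. Qed.

Lemma primitive_derive a (g : R -> R) t : regulated g -> a < t -> {for t, continuous g} ->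
  is_derive t 1 (primitive a g) (g t).
Proof.
move=> gr at' gt.
have tt1 : t < t + 1 by rewrite ltrDl.
have ig := regulated_integrable a (t + 1) gr.
have [h1 h2] := @continuous_FTC1_closed R g a t (t + 1) tt1 ig at' gt.
by apply: DeriveDef; [exact: h1|rewrite -derive1E; exact: h2].
Qed.

(** [F] minus the primitive of [g] is continuous with zero derivative off a finite list, hence
    constant. *)
Lemma Rintegral_regulated s (g F : R -> R) a b : regulated g -> continuous F -> a <= b ->
  (forall t, a < t < b -> t \notin s -> is_derive t 1 F (g t)) ->
  Rintegral mu `[a, b] g = F b - F a.
Proof.
move=> gr Fc ab Fd.
have [s' [gs _]] := gr.
have : (F - primitive a g) b = (F - primitive a g) a.
  apply: (@derive0_off_cst (s ++ s')) => //.
    by move=> t; apply: continuousB; [exact: Fc|exact: primitive_continuous].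
  move=> t abt; rewrite mem_cat negb_or => /andP[ts ts'].
  rewrite -(subrr (g t)); have ? := Fd _ abt ts; apply: is_deriveB.
  by apply: primitive_derive => //; [case/andP: abt|exact: gs].
rewrite !fctE (primitive_le0 _ (lexx a)) subr0 => <-.
by rewrite opprB addrC subrK.
Qed.

Lemma ae_off s (P : R -> Prop) : (forall t, t \notin s -> P t) -> {ae mu, forall t, P t}.
Proof.
move=> Ps; exists [set` s]; split.
- by apply: countable_measurable; [exact: measurable_set1|exact/finite_set_countable/finite_seq].
- by apply: countable_lebesgue_measure0; exact/finite_set_countable/finite_seq.
- by move=> t /= nP; apply/negPn/negP => /Ps.
Qed.

(** Dominated convergence with a constant majorant. The points of [s] are those where a shrinking
    needle prevents pointwise convergence. *)
Lemma Rintegral_cvg0 s (g : nat -> R -> R) a b (M : R) : (forall k, regulated (g k)) ->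
  (forall k t, a <= t <= b -> `|g k t| <= M) ->
  (forall t, a <= t <= b -> t \notin s -> g k t @[k --> \oo] --> 0) ->
  Rintegral mu `[a, b] (g k) @[k --> \oo] --> 0.
Proof.
move=> gr gM g0.
have mab : measurable (`[a, b] : set R) by exact: measurable_itv.
have mf k : measurable_fun (`[a, b] : set R) (fun t => (g k t)%:E).
  by apply/measurable_EFinP; apply: measurable_funTS; exact: regulated_measurable.
have f0 : {ae mu, forall t, `[a, b]%classic t -> (g k t)%:E @[k --> \oo] --> cst 0%E t}.
  apply: (@ae_off s) => t ts; rewrite /= in_itv/= => abt.
  by apply: cvg_EFin; [exact: nearW|exact: g0].
have iM : mu.-integrable `[a, b] (cst M%:E).
  by apply: (@regulated_integrable _ (cst M)); exact: regulated_cst.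
have fM : {ae mu, forall t k, `[a, b]%classic t -> (`|(g k t)%:E| <= cst M%:E t)%E}.
  by apply: nearW => t k; rewrite /= in_itv/= => abt; rewrite lee_fin gM.
have m0 : measurable_fun (`[a, b] : set R) (cst (0 : \bar R)%E) by exact: measurable_cst.
have [_ _] := @dominated_convergence _ _ _ mu _ mab (fun k t => (g k t)%:E) (cst 0%E) (cst M%:E) mf m0 f0 iM fM.
by rewrite integral0 => /fine_cvg.
Qed.

End MeanValue.

(** * Delay differential equations *)


Section FixedPoint.
Context {R : realType}.

Lemma halving_small (c e : R) : 0 < e -> exists k, c * 2^-1 ^+ k < e.
Proof.
move=> e0.
have : (fun k => c * 2^-1 ^+ k) k @[k --> \oo] --> (0 : R).
  rewrite -[X in _ --> X](mulr0 c); apply: cvgM; first exact: cvg_cst.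
  by apply: cvg_expr; rewrite ger0_norm ?invr_ge0// invf_lt1// ltr1n.
move=> /cvgrPdist_lt/(_ _ e0)[k _ /(_ k (leqnn k))]; rewrite sub0r normrN => h.
by exists k; rewrite (le_lt_trans (ler_norm _)).
Qed.

(** Banach iteration in which the distance of [x] and [y] is the least [C] with [|x - y| <= C * w].
    Phrasing it by inequalities admits functions that are unbounded on a noncompact domain; local
    boundedness of [w] is what makes the limit continuous. *)
Lemma weighted_contraction_fixed_point {T : topologicalType} {n : nat} 
    (A : (T -> 'rV[R]_n) -> (T -> 'rV[R]_n)) (w : T -> R) (D : R) (x0 : T -> 'rV[R]_n) :
  (forall t, 0 < w t) -> continuous w -> 0 <= D -> continuous x0 ->
  (forall x : T -> 'rV[R]_n, continuous x -> continuous (A x)) ->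
  (forall (x y : T -> 'rV[R]_n) (C : R), continuous x -> continuous y -> 0 <= C ->
     (forall t, `|x t - y t| <= C * w t) -> forall t, `|A x t - A y t| <= C / 2 * w t) ->
  (forall t, `|A x0 t - x0 t| <= D * w t) ->
  exists x, [/\ continuous x, A x =1 x & forall t, `|x t - x0 t| <= 2 * D * w t].
Proof.
move=> w0 wc D0 x0c Ac Ak x0A.
pose u k := iter k A x0.
have uc k : continuous (u k) by elim: k => [|k IH]//; exact: Ac.
have pk k : 0 <= (2^-1 : R) ^+ k by rewrite exprn_ge0// invr_ge0.
have u1 k t : `|u k.+1 t - u k t| <= D * 2^-1 ^+ k * w t.
  elim: k t => [t|k IH t]; first by rewrite expr0 mulr1; exact: x0A.
  rewrite exprSr mulrA; apply: (Ak (u k.+1) (u k)) => //; exact: mulr_ge0.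
(* Tail of the geometric series: the increments from index [k] on add up to at most [2 * D / 2^k],
   in units of [w t]. *)
have uj j k t : `|u (j + k)%N t - u k t| <= 2 * D * 2^-1 ^+ k * w t.
  elim: j k => [k|j IH k]; first by rewrite subrr normr0 !mulr_ge0// ltW.
  rewrite addSnnS -[X in X - _](subrK (u k.+1 t)) -addrA (le_trans (ler_normD _ _))//.
  rewrite (le_trans (lerD (IH k.+1) (u1 k t)))//.
  by rewrite exprSr -mulrDl le_eqVlt; apply/orP; left; apply/eqP; congr (_ * _); field.
have /choice[x xP] : forall t, exists l : 'rV[R]_n, u k t @[k --> \oo] --> l.
  move=> t; apply/cvg_ex; apply: cauchy_cvg; apply: cauchy_exP => e e0.
  have [k ke] := halving_small (2 * D * w t) e0.
  exists (u k t); exists k => // j /= kj; rewrite -ball_normE /= distrC.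
  rewrite -(subnK kj) (le_lt_trans (uj _ _ _))//.
  by rewrite mulrAC.
have xu k t : `|x t - u k t| <= 2 * D * 2^-1 ^+ k * w t.
  apply/ler_addgt0Pr => e e0.
  have /cvgrPdist_le/(_ _ e0)[N _ NP] := xP t.
  have := NP (N + k)%N (leq_addr _ _) => xe.
  rewrite -[X in X - _](subrK (u (N + k)%N t)) -addrA (le_trans (ler_normD _ _))//.
  by rewrite [leRHS]addrC lerD.
(* An e/3 argument; near [t] the weight stays below [w t + 1], so one index [k] serves the whole
   neighbourhood. *)
have xc : continuous x.
  move=> t; apply/cvgrPdist_lt => e e0.
  have e30 : 0 < e / 3 by rewrite divr_gt0.
  have [k ke] := halving_small (2 * D * (w t + 1)) e30.
  near=> r.
  have wr : w r <= w t + 1.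
    rewrite -[w r](subrK (w t)) addrC lerD2l (le_trans (ler_norm _))// distrC ltW//.
    by near: r; have /cvgrPdist_lt/(_ 1 ltr01) := wc t; apply.
  have ur : `|u k t - u k r| < e / 3.
    by near: r; have /cvgrPdist_lt/(_ _ e30) := uc k t; apply.
  have h1 : `|x t - u k t| < e / 3.
    rewrite (le_lt_trans (xu _ _))// (le_lt_trans _ ke)// mulrAC ler_wpM2r//.
    by rewrite ler_wpM2l ?mulr_ge0// lerDl.
  have h2 : `|x r - u k r| < e / 3.
    rewrite (le_lt_trans (xu _ _))// (le_lt_trans _ ke)// mulrAC ler_wpM2r//.
    by rewrite ler_wpM2l ?mulr_ge0.
  rewrite (_ : x t - x r = (x t - u k t) + (u k t - u k r) + (u k r - x r)); last first.
    by rewrite !addrA subrK subrK.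
  rewrite (le_lt_trans (ler_normD _ _))// (_ : e = e / 3 + e / 3 + e / 3); last by field.
  rewrite ltr_leD//; last by rewrite distrC ltW.
  by rewrite (le_lt_trans (ler_normD _ _))// ltrD.
exists x; split=> //.
- move=> t; apply/eqP; rewrite -subr_eq0 -normr_le0; apply/ler_addgt0Pr => e e0; rewrite add0r.
  have [k ke] := halving_small (2 * D * w t) e0.
  rewrite -[A x t](subrK (u k.+1 t)) -addrA (le_trans (ler_normD _ _))//.
  apply: (@le_trans _ _ (2 * D * 2^-1 ^+ k / 2 * w t + 2 * D * 2^-1 ^+ k.+1 * w t)).
    rewrite lerD//; last by rewrite distrC.
    by apply: Ak => //; rewrite !mulr_ge0.
  rewrite (le_trans _ (ltW ke))// exprSr -mulrDl [leRHS]mulrAC ler_wpM2r//; first exact: ltW.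
  by rewrite le_eqVlt; apply/orP; left; apply/eqP; field.
- by move=> t; have := xu 0%N t; rewrite expr0 mulr1.
Unshelve. all: by end_near. Qed.

(** The weight is exponential on the whole line, so one contraction yields the global solution
    without steps of length [d]. Here [D] bounds the first iterate minus the constant [c], and the
    final estimate is linear in [D]; for a needle [D] is proportional to its length. *)
Lemma delay_ode_solution {n : nat} (g : R -> 'rV[R]_n -> 'rV[R]_n -> 'rV[R]_n)
    (a d L D : R) (c : 'rV[R]_n) :
  0 <= d -> 0 <= L -> 0 <= D ->
  (forall x y : R -> 'rV[R]_n, continuous x -> continuous y -> regulated (fun t => g t (x t) (y t))) ->
  (forall t x y x' y', `|g t x y - g t x' y'| <= L * (`|x - x'| + `|y - y'|)) ->
  (forall t i, `|primitive a (fun r => g r c c 0 i) t| <= D) ->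
  exists x : R -> 'rV[R]_n, [/\ continuous x, forall t, t <= a -> x t = c,
    exists s : seq R, forall t, a < t -> t \notin s -> is_derive t 1 x (g t (x t) (x (t - d)))
  & forall t, a <= t -> `|x t - c| <= 2 * D * expR (4 * (L + 1) * (t - a))].
Proof.
move=> d0 L0 D0 gr gL gD.
pose G (x : R -> 'rV[R]_n) i t := g t (x t) (x (t - d)) 0 i.
pose A (x : R -> 'rV[R]_n) t := c + \row_i primitive a (G x i) t.
(* If [|x - y| <= C * w], the right-hand sides differ by at most [2 * L * C * w], which is below the
   derivative [2 * (L + 1) * C * w] of [C / 2 * w]. This is the contraction factor 1/2. *)
pose w t := expR (4 * (L + 1) * (t - a)).
have shc (x : R -> 'rV[R]_n) : continuous x -> continuous (fun t => x (t - d)).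
  move=> xc t; apply: (@continuous_comp _ _ _ (fun t => t - d) x); last exact: xc.
  by apply: cvgB; [exact: cvg_id|exact: cvg_cst].
have Gr x i : continuous x -> regulated (G x i).
  by move=> xc; apply: regulated_coord; apply: gr => //; exact: shc.
have Aa x t : t <= a -> A x t = c.
  by move=> ta; apply/rowP => i; rewrite !mxE primitive_le0// addr0.
have wd (t : R) : is_derive t 1 w (4 * (L + 1) * w t).
  have kd : is_derive t 1 (fun r : R => 4 * (L + 1) * (r - a)) (4 * (L + 1)).
    rewrite (_ : (fun r => _) = (4 * (L + 1)) \*: (id - cst a)); last first.
      by apply/funext => r; rewrite !fctE.
    have h : is_derive t 1 (id - cst a : R -> R) (1 - 0) by apply: is_deriveB.
    by apply: is_derive_eq; rewrite subr0 [LHS]mulr1.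
  rewrite mulrC; exact: is_derive1_comp.
have wc : continuous w.
  by move=> t; apply/differentiable_continuous/derivable1_diffP; have [] := wd t.
have wmono t t' : t <= t' -> w t <= w t'.
  by move=> tt'; rewrite ler_expR ler_wpM2l ?lerD2r// mulr_ge0// addr_ge0.
have Ac x : continuous x -> continuous (A x).
  move=> xc t; apply: cvgD; first exact: cvg_cst.
  apply/cvg_rowP => i; rewrite mxE; under eq_fun do rewrite mxE.
  by apply: primitive_continuous; exact: Gr.
have [|||||||x [xc Ax xD]] := @weighted_contraction_fixed_point _ n A w D (fun=> c).
- by move=> t; exact: expR_gt0.
- exact: wc.
- exact: D0.
- by move=> t; exact: cvg_cst.
- exact: Ac.
- move=> x y C xc yc C0 xyC t.
  have [ta|ta] := leP t a.
    by rewrite !Aa// subrr normr0 mulr_ge0 ?divr_ge0// expR_ge0.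
  apply: norm_row_le; first by rewrite mulr_ge0 ?divr_ge0// expR_ge0.
  move=> i; rewrite !mxE opprD addrACA subrr add0r.
  have [s [xs _]] := Gr x i xc; have [s' [ys _]] := Gr y i yc.
  have := @mean_value_le _ (s ++ s') (primitive a (G x i) - primitive a (G y i))
    (fun t => G x i t - G y i t) (fun t => C / 2 * w t)
    (fun t => C / 2 * (4 * (L + 1) * w t)) a t _ _ (ltW ta).
  rewrite !fctE !(primitive_le0 _ (lexx a)) subrr subr0 => h.
  have {h} : `|primitive a (G x i) t - primitive a (G y i) t| <= C / 2 * w t - C / 2 * w a.
    apply: h.
    + by move=> r; apply: continuousB; apply: primitive_continuous; exact: Gr.
    + by move=> r; apply: cvgM; [exact: cvg_cst|exact: wc].
    + move=> r /andP[ar _]; rewrite mem_cat negb_or => /andP[rs rs'].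
      by apply: is_deriveB; apply: primitive_derive => //; [exact: Gr|exact: xs|exact: Gr|exact: ys].
    + move=> r _ _; rewrite /G.
      apply: (@le_trans _ _ (`|g r (x r) (x (r - d)) - g r (y r) (y (r - d))|)).
        by have := norm_coord_le (g r (x r) (x (r - d)) - g r (y r) (y (r - d))) i; rewrite !mxE.
      rewrite (le_trans (gL _ _ _ _ _))//.
      have h1 := xyC r; have h2 := xyC (r - d).
      (* The weight is nondecreasing, so the delayed difference obeys the same bound as the present
         one. *)
      have h3 : C * w (r - d) <= C * w r.
        by rewrite ler_wpM2l// wmono// gerBl.
      have h4 : 0 <= C * w r by rewrite mulr_ge0// expR_ge0.
      have h5 : L * (`|x r - y r| + `|x (r - d) - y (r - d)|) <= L * (2 * (C * w r)).
        by rewrite ler_wpM2l//; lra.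
      have h6 : 0 <= L * (C * w r) by rewrite mulr_ge0.
      by rewrite (le_trans h5)//; nra.
  by move=> /le_trans; apply; rewrite gerBl mulr_ge0 ?divr_ge0// expR_ge0.
- move=> t; have [ta|ta] := leP t a.
    by rewrite Aa// subrr normr0 mulr_ge0// expR_ge0.
  apply: norm_row_le; first by rewrite mulr_ge0// expR_ge0.
  move=> i; rewrite !mxE addrC addKr (le_trans (gD t i))//.
  by rewrite ler_peMr// -expR0 ler_expR mulr_ge0 ?subr_ge0 ?(ltW ta)// mulr_ge0// addr_ge0.
exists x; split=> //.
- by move=> t ta; rewrite -Ax Aa.
- have /choice[s sP] : forall i, exists s : seq R, forall t, t \notin s -> {for t, continuous (G x i)}.
    by move=> i; have [s [sP _]] := Gr x i xc; exists s.
  exists (flatten [seq s i | i <- enum 'I_n]) => t ta ts.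
  have <- : A x = x by apply/funext => r; exact: Ax.
  apply/is_derive_rowP => i.
  rewrite (_ : (fun r => _) = cst (c 0 i) + primitive a (G x i)); last first.
    by apply/funext => r; rewrite !mxE.
  rewrite -[X in is_derive _ _ _ X]add0r; apply: is_deriveD.
  rewrite (_ : A x t = x t)// (_ : A x (t - d) = x (t - d))//.
  apply: primitive_derive => //; first exact: Gr.
  by apply: sP; apply: contra ts => ts; apply/flattenP; exists (s i) => //; apply: map_f; rewrite mem_enum.
Qed.

End FixedPoint.

(** * Functions on the tube *)


Section DirectionalDerivatives.
Context {R : realType} {n : nat}.
Implicit Types (g : 'rV[R]_n -> R) (p q w z : 'rV[R]_n).

Lemma derive_gradient g z w : differentiable g z -> 'D_w g z = dotp w (gradient g z).
Proof.
move=> gz; rewrite deriveE// {1}[w]row_sum_delta linear_sum /dotp; apply: eq_bigr => i _.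
by rewrite linearZ mxE deriveE.
Qed.

Lemma norm_dotp_le p q : `|dotp p q| <= n%:R * (`|p| * `|q|).
Proof.
rewrite /dotp (le_trans (ler_norm_sum _ _ _))//.
have -> : n%:R * (`|p| * `|q|) = \sum_(i < n) `|p| * `|q|.
  by rewrite sumr_const card_ord mulr_natl.
by apply: ler_sum => i _; rewrite normrM ler_pM// norm_coord_le.
Qed.

Lemma dotpC p q : dotp p q = dotp q p.
Proof. by apply: eq_bigr => i _; rewrite mulrC. Qed.

Lemma dotpBr p q w : dotp p (q - w) = dotp p q - dotp p w.
Proof. by rewrite /dotp -sumrB; apply: eq_bigr => i _; rewrite !mxE mulrBr. Qed.

(** An equality, hence for scalar [g]; the vector valued dynamics is treated through its coordinates
    [coord_fun phi j]. *)
Lemma segment_mean_value g p q :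
  (forall c, 0 <= c <= 1 -> differentiable g (p + c *: (q - p))) ->
  exists2 c, 0 < c < 1 & g q - g p = dotp (q - p) (gradient g (p + c *: (q - p))).
Proof.
move=> gd.
pose l (c : R) := p + c *: (q - p).
have ld (c : R) : is_derive c 1 l (q - p).
  apply/is_derive_rowP => i.
  rewrite (_ : (fun r => _) = cst (p 0 i) + (q - p) 0 i \*: id); last first.
    by apply/funext => r; rewrite !fctE !mxE mulrC.
  by apply: is_derive_eq; rewrite add0r [LHS]mulr1.
have hd (c : R) : 0 <= c <= 1 -> is_derive c 1 (g \o l) (dotp (q - p) (gradient g (l c))).
  move=> c01; have [lD lE] := ld c.
  have ldiff : differentiable l c by exact/derivable1_diffP.
  have gl : differentiable g (l c) by exact: gd.
  have gldiff : differentiable (g \o l) c by exact: differentiable_comp.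
  apply: DeriveDef; first exact/derivable1_diffP.
  rewrite deriveE// diff_comp//= -(deriveE _ ldiff) lE -derive_gradient// deriveE//.
have [||c c01] := @MVT R (g \o l) (fun c => dotp (q - p) (gradient g (l c))) 0 1 ltr01.
- by move=> c; rewrite in_itv/= => /andP[c0 c1]; apply: hd; rewrite !ltW.
- apply: continuous_in_subspaceT => c; rewrite inE/= in_itv/= => c01.
  by apply/differentiable_continuous/derivable1_diffP; have [] := hd _ c01.
rewrite /= (_ : l 1 = q) 1?(_ : l 0 = p) ?subr0 ?mulr1 => [->||]; first last.
- by rewrite /l scale1r addrC subrK.
- by rewrite /l scale0r addr0.
by exists c => //; move: c01; rewrite in_itv.
Qed.

End DirectionalDerivatives.

Lemma cvg_fst_comp {T : Type} {U V : topologicalType} (F : set_system T) (FF : Filter F)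
  (f : T -> U * V) (z : U * V) : f @ F --> z -> (fun w => (f w).1) @ F --> z.1.
Proof. by move=> fz; exact: (cvg_comp _ _ fz cvg_fst). Qed.

Lemma cvg_snd_comp {T : Type} {U V : topologicalType} (F : set_system T) (FF : Filter F)
  (f : T -> U * V) (z : U * V) : f @ F --> z -> (fun w => (f w).2) @ F --> z.2.
Proof. by move=> fz; exact: (cvg_comp _ _ fz cvg_snd). Qed.

Lemma cvg_tuple5 {T : Type} {U1 U2 U3 U4 U5 : topologicalType} (F : set_system T)
    (FF : Filter F) (f1 : T -> U1) (f2 : T -> U2) (f3 : T -> U3) (f4 : T -> U4)
    (f5 : T -> U5) (l1 : U1) (l2 : U2) (l3 : U3) (l4 : U4) (l5 : U5) :
  f1 @ F --> l1 -> f2 @ F --> l2 -> f3 @ F --> l3 -> f4 @ F --> l4 -> f5 @ F --> l5 ->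
  (fun r => (f1 r, f2 r, f3 r, f4 r, f5 r)) @ F --> (l1, l2, l3, l4, l5).
Proof.
move=> h1 h2 h3 h4 h5.
exact: (cvg_pair (cvg_pair (cvg_pair (cvg_pair h1 h2) h3) h4) h5).
Qed.

(** The tolerance [e / (k + 1)] absorbs the dimension factor of [norm_dotp_le], and remains
    meaningful in dimension zero. *)
Lemma weighted_remainder_le {R : realFieldType} (k : nat) (e x y p q : R) : 0 < e ->
  p <= e / (k%:R + 1) -> q <= e / (k%:R + 1) -> 0 <= x -> 0 <= y ->
  k%:R * (x * p + y * q) <= e * (x + y).
Proof.
move=> e0; set c := e / _ => pc qc x0 y0.
have k0 : (0 : R) <= k%:R by [].
have c0 : 0 < c by rewrite divr_gt0// ltr_wpDl.
have -> : e = k%:R * c + c by rewrite /c; field; rewrite gt_eqF// ltr_wpDl.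
have h1 : x * p <= x * c by rewrite ler_wpM2l.
have h2 : y * q <= y * c by rewrite ler_wpM2l.
have h3 : k%:R * (x * p + y * q) <= k%:R * (x * c + y * c) by rewrite ler_wpM2l// lerD.
have h4 : 0 <= c * (x + y) by rewrite mulr_ge0 ?addr_ge0// ltW.
by rewrite (le_trans h3)// mulrDl; lra.
Qed.

Section Tube.
Context {R : realType} {n m : nat} (t0 t1 delta gamma : R) (X : R -> 'rV[R]_n).
Context (t01 : t0 <= t1).
Context (Xc : continuous X).
Implicit Types (g : delay_fun R n m R).

Let A := @tube R n m t0 t1 delta gamma X.

Definition clamp_itv (t : R) := Num.max t0 (Num.min t1 t).

Lemma clamp_itv_in t : t0 <= clamp_itv t <= t1.
Proof. by rewrite /clamp_itv le_max lexx/= ge_max t01 ge_min lexx. Qed.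

Lemma clamp_itv_id t : t0 <= t <= t1 -> clamp_itv t = t.
Proof. by move=> /andP[a b]; rewrite /clamp_itv (min_idPr b) (max_idPr a). Qed.

Lemma clamp_itv_continuous : continuous clamp_itv.
Proof.
by move=> t; apply: continuous_max; [exact: cvg_cst|apply: continuous_min; [exact: cvg_cst|exact: cvg_id]].
Qed.

Definition uncurry5 {V : Type} (F : delay_fun R n m V) :=
  (fun '(t, xi, eta, u, v) => F t xi eta u v) : R * 'rV[R]_n * 'rV[R]_n * 'rV[R]_m * 'rV[R]_m -> V.

Section Composition.
Context {V : normedModType R} (F : delay_fun R n m V).
Context (Fc : {within A, continuous (uncurry5 F)}).
Context (x y : R -> 'rV[R]_n).
Context (xc : continuous x).
Context (yc : continuous y).
Context (xX : forall t, t0 <= t <= t1 -> `|x t - X t| < gamma).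
Context (yX : forall t, t0 <= t <= t1 -> `|y t - X (t - delta)| < gamma).

(* Clamping the time to [t0, t1] keeps the argument in the tube for all real times,
   so that the end points need no separate treatment. *)
Lemma tube_cvg (G : set_system R) (FG : Filter G) t (u v : R -> 'rV[R]_m) lu lv :
  G --> t -> u r @[r --> G] --> lu -> v r @[r --> G] --> lv ->
  F (clamp_itv r) (x (clamp_itv r)) (y (clamp_itv r)) (u r) (v r) @[r --> G]
    --> F (clamp_itv t) (x (clamp_itv t)) (y (clamp_itv t)) lu lv.
Proof.
move=> Gt ul vl.
have cG : clamp_itv r @[r --> G] --> clamp_itv t.
  exact: (cvg_comp _ _ Gt (@clamp_itv_continuous t)).
pose Z r := (clamp_itv r, x (clamp_itv r), y (clamp_itv r), u r, v r).
pose z := (clamp_itv t, x (clamp_itv t), y (clamp_itv t), lu, lv).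
have AZ (c : R) (a b : 'rV[R]_m) : A (clamp_itv c, x (clamp_itv c), y (clamp_itv c), a, b).
  by split; [rewrite in_itv/=; exact: clamp_itv_in|exact/xX/clamp_itv_in|exact/yX/clamp_itv_in].
have Zz : Z r @[r --> G] --> z.
  apply: cvg_tuple5 => //.
  - exact: (continuous_cvg _ (@xc _) cG).
  - exact: (continuous_cvg _ (@yc _) cG).
have /subspace_continuousP/(_ z (AZ _ _ _)) Fz := Fc.
(* Because of the clamping, [Z r] lies in the tube for every [r], so its convergence is convergence
   within the tube. *)
have Zw : Z r @[r --> G] --> within A (nbhs z).
  move=> B /= AB; have := Zz _ AB; rewrite /fmap /nbhs /=.
  by apply: filterS => r; apply; exact: AZ.
exact: (cvg_comp _ _ Zw Fz).
Qed.

Lemma tube_regulated u v : regulated u -> regulated v ->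
  regulated (fun t => F (clamp_itv t) (x (clamp_itv t)) (y (clamp_itv t)) (u t) (v t)).
Proof.
move=> [s [us ul]] [s' [vs vl]]; exists (s ++ s'); split=> [t|b t].
  rewrite mem_cat negb_or => /andP[ts ts'].
  by apply: tube_cvg; [exact: cvg_id|exact: us|exact: vs].
have [lu utl] := ul b t; have [lv vtl] := vl b t.
exists (F (clamp_itv t) (x (clamp_itv t)) (y (clamp_itv t)) lu lv).
by apply: tube_cvg => //; exact: side_nbhs.
Qed.

End Composition.

Lemma closed_ball_compact (k : nat) (r : R) : compact [set a : 'rV[R]_k | `|a| <= r].
Proof.
apply: bounded_closed_compact.
  by exists r; split; [exact: num_real|move=> M rM a /= /le_trans; apply; exact: ltW].
rewrite (_ : mkset _ = (fun a : 'rV[R]_k => `|a|) @^-1` [set c | c <= r])//.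
by apply: closed_comp; [move=> a _; exact: norm_continuous|exact: closed_le].
Qed.

(** In offsets from [X] the region is a product of compact sets; the map [Th] carries it
    continuously into the tube, where [F] is continuous. The strict inequality [rho < gamma] fits
    the closed balls into the open tube, and [r] makes the range of the controls compact. *)
Lemma tube_bounded {V : normedModType R} (F : delay_fun R n m V) (rho r : R) :
  {within A, continuous (uncurry5 F)} -> rho < gamma ->
  exists2 M, 0 <= M & forall (t : R) (a b : 'rV[R]_n) (u v : 'rV[R]_m), t0 <= t <= t1 -> `|a| <= rho -> `|b| <= rho ->
    `|u| <= r -> `|v| <= r -> `|F t (X t + a) (X (t - delta) + b) u v| <= M.
Proof.
move=> Fc rg.
pose C := `[t0, t1]%classic `*` [set a : 'rV[R]_n | `|a| <= rho]
  `*` [set a : 'rV[R]_n | `|a| <= rho] `*` [set a : 'rV[R]_m | `|a| <= r]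
  `*` [set a : 'rV[R]_m | `|a| <= r].
pose Th (z : R * 'rV[R]_n * 'rV[R]_n * 'rV[R]_m * 'rV[R]_m) :=
  (z.1.1.1.1, X z.1.1.1.1 + z.1.1.1.2, X (z.1.1.1.1 - delta) + z.1.1.2, z.1.2, z.2).
have Cc : compact C.
  do 4?apply: compact_setX; try exact: closed_ball_compact.
  exact: segment_compact.
have Thc : continuous Th.
  move=> z.
  have zz : id w @[w --> z] --> z by exact: cvg_id.
  have z1 : w.1.1.1.1 @[w --> z] --> z.1.1.1.1 by do 4!apply: cvg_fst_comp.
  have z1d : w.1.1.1.1 - delta @[w --> z] --> z.1.1.1.1 - delta.
    by apply: cvgB => //; exact: cvg_cst.
  rewrite /continuous_at; apply: cvg_tuple5 => //.
  - apply: cvgD; first exact: (continuous_cvg _ (@Xc _) z1).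
    by apply: cvg_snd_comp; do 3!apply: cvg_fst_comp.
  - apply: cvgD; first exact: (continuous_cvg _ (@Xc _) z1d).
    by apply: cvg_snd_comp; do 2!apply: cvg_fst_comp.
  - by apply: cvg_snd_comp; apply: cvg_fst_comp.
  - exact: cvg_snd_comp.
have KA : Th @` C `<=` A.
  move=> _ [[[[[t a] b] u] v] [[[[/= tt ar] br] ur] vr] <-]; split => //=.
  + by rewrite addrC addKr (le_lt_trans ar).
  + by rewrite addrC addKr (le_lt_trans br).
have Kc : compact (Th @` C) by apply: continuous_compact => //; exact: continuous_subspaceT.
have FK : compact (uncurry5 F @` (Th @` C)).
  by apply: continuous_compact => //; exact: continuous_subspaceW Fc.
have [M [_ MP]] := compact_bounded FK.
exists `|M + 1|; first by [].
move=> t a b u v tt ar br ur vr; rewrite (le_trans _ (ler_norm _))//.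
apply: (MP (M + 1)); first by rewrite ltrDl.
exists (Th (t, a, b, u, v)) => //; exists (t, a, b, u, v) => //.
Qed.

Definition gradx g : delay_fun R n m 'rV[R]_n :=
  fun t xi eta u v => gradient (fun z => g t z eta u v) xi.

Definition grady g : delay_fun R n m 'rV[R]_n :=
  fun t xi eta u v => gradient (fun z => g t xi z u v) eta.

Section Scalar.
Context (g : delay_fun R n m R) (gC : C1_on_tube t0 t1 delta gamma X g).

Lemma gradx_within : {within A, continuous (uncurry5 (gradx g))}.
Proof.
have [_ _ gx _] := gC; apply/subspace_continuousP => -[[[[t xi] eta] u] v] Az.
apply/cvg_rowP => i.
have /subspace_continuousP/(_ _ Az) := gx (delta_mx 0 i).
rewrite /= mxE; apply: cvg_trans; apply: near_eq_cvg.
by apply: nearW => -[[[[? ?] ?] ?] ?] /=; rewrite mxE.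
Qed.

Lemma grady_within : {within A, continuous (uncurry5 (grady g))}.
Proof.
have [_ _ _ gy] := gC; apply/subspace_continuousP => -[[[[t xi] eta] u] v] Az.
apply/cvg_rowP => i.
have /subspace_continuousP/(_ _ Az) := gy (delta_mx 0 i).
rewrite /= mxE; apply: cvg_trans; apply: near_eq_cvg.
by apply: nearW => -[[[[? ?] ?] ?] ?] /=; rewrite mxE.
Qed.

(** The path changes [y] from [b'] to [b] at [a'], then [x] from [a'] to [a] at [b], as only the
    partial differentials in [x] and in [y] are given. The bounds by maxima show, for [a' = b' = 0],
    that the intermediate points are as small as the increments. *)
Lemma mean_value_xy (t : R) (u v : 'rV[R]_m) (a a' b b' : 'rV[R]_n) (rho : R) : rho < gamma -> t0 <= t <= t1 ->
  `|a| <= rho -> `|a'| <= rho -> `|b| <= rho -> `|b'| <= rho ->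
  exists a2 b2, [/\ `|a2| <= rho, `|b2| <= rho,
     (`|a2| <= Num.max `|a| `|a'|), (`|b2| <= Num.max `|b| `|b'|) &
   g t (X t + a) (X (t - delta) + b) u v - g t (X t + a') (X (t - delta) + b') u v =
   dotp (a - a') (gradx g t (X t + a2) (X (t - delta) + b) u v) +
   dotp (b - b') (grady g t (X t + a') (X (t - delta) + b2) u v)].
Proof.
move=> rg tt ar ar' br br'; have [_ gd _ _] := gC.
have cvx (c : R) (p q : 'rV[R]_n) : 0 <= c <= 1 -> `|p + c *: (q - p)| <= Num.max `|q| `|p|.
  move=> /andP[c0 c1].
  rewrite (_ : p + _ = (1 - c) *: p + c *: q); last first.
    by rewrite scalerBr scalerBl scale1r addrAC addrA.
  rewrite (le_trans (ler_normD _ _))// !normrZ ger0_norm ?subr_ge0// ger0_norm//.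
  set M := Num.max _ _.
  have h1 : `|q| <= M by rewrite le_max lexx.
  have h2 : `|p| <= M by rewrite le_max lexx orbT.
  by have := normr_ge0 p; have := normr_ge0 q; nra.
have cvx' (c : R) (p q : 'rV[R]_n) : 0 <= c <= 1 -> `|p| <= rho -> `|q| <= rho -> `|p + c *: (q - p)| <= rho.
  by move=> c01 pr qr; rewrite (le_trans (cvx _ _ _ c01))// ge_max pr qr.
have inA (p q : 'rV[R]_n) : `|p| <= rho -> `|q| <= rho -> A (t, X t + p, X (t - delta) + q, u, v).
  move=> pr qr; split; first by rewrite in_itv.
    by rewrite addrC addKr (le_lt_trans pr).
  by rewrite addrC addKr (le_lt_trans qr).
have sh (Y p q : 'rV[R]_n) (c : R) : Y + p + c *: (Y + q - (Y + p)) = Y + (p + c *: (q - p)).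
  by rewrite -addrA; congr (_ + (_ + _ *: _)); rewrite opprD addrACA subrr add0r.
have [|c1 c101 E1] := @segment_mean_value R n (fun z => g t z (X (t - delta) + b) u v) (X t + a') (X t + a).
  by move=> c c01; rewrite sh; apply: (gd _ _ _ _ _ (inA _ _ _ _)).1 => //; exact: cvx'.
have [|c2 c201 E2] := @segment_mean_value R n (fun z => g t (X t + a') z u v) (X (t - delta) + b') (X (t - delta) + b).
  by move=> c c01; rewrite sh; apply: (gd _ _ _ _ _ (inA _ _ _ _)).2 => //; exact: cvx'.
have le01 (c : R) : 0 < c < 1 -> 0 <= c <= 1 by move=> /andP[h1 h2]; rewrite !ltW.
exists (a' + c1 *: (a - a')), (b' + c2 *: (b - b')); split.
- by apply: cvx' => //; exact: le01.
- by apply: cvx' => //; exact: le01.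
- by apply: cvx; exact: le01.
- by apply: cvx; exact: le01.
have shB (Y p q : 'rV[R]_n) : Y + q - (Y + p) = q - p by rewrite opprD addrACA subrr add0r.
move: E1 E2; rewrite !sh !shB => E1 E2.
by rewrite /gradx /grady -E1 -E2 addrA subrK.
Qed.

Lemma tube_lipschitz (rho r : R) : rho < gamma ->
  exists2 L, 0 <= L & forall (t : R) (a a' b b' : 'rV[R]_n) (u v : 'rV[R]_m), t0 <= t <= t1 ->
    `|a| <= rho -> `|a'| <= rho -> `|b| <= rho -> `|b'| <= rho -> `|u| <= r -> `|v| <= r ->
    `|g t (X t + a) (X (t - delta) + b) u v - g t (X t + a') (X (t - delta) + b') u v|
      <= L * (`|a - a'| + `|b - b'|).
Proof.
move=> rg.
have [M1 M10 M1P] := tube_bounded r gradx_within rg.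
have [M2 M20 M2P] := tube_bounded r grady_within rg.
exists (n%:R * (M1 + M2)); first by rewrite mulr_ge0// addr_ge0.
move=> t a a' b b' u v tt ar ar' br br' ur vr.
have [a2 [b2 [a2r b2r _ _ ->]]] := mean_value_xy u v rg tt ar ar' br br'.
rewrite (le_trans (ler_normD _ _))// (le_trans (lerD (norm_dotp_le _ _) (norm_dotp_le _ _)))//.
rewrite -mulrDr -mulrA ler_wpM2l//.
have h1 := M1P t a2 b u v tt a2r br ur vr.
have h2 := M2P t a' b2 u v tt ar' b2r ur vr.
have := normr_ge0 (a - a'); have := normr_ge0 (b - b').
by rewrite -/(gradx _ _ _ _ _ _) -/(grady _ _ _ _ _ _); nra.
Qed.

(** Continuity of the two partial gradients at one point of the tube turns the mean value formula
    into a first order expansion. The radius depends on [t], [u] and [v], which is enough for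
    pointwise convergence. *)
Lemma tube_remainder t (u v : 'rV[R]_m) (e : R) : 0 < gamma -> t0 <= t <= t1 -> 0 < e ->
  exists2 d, 0 < d & forall a b : 'rV[R]_n, `|a| <= d -> `|b| <= d ->
   `|g t (X t + a) (X (t - delta) + b) u v - g t (X t) (X (t - delta)) u v
     - dotp a (gradx g t (X t) (X (t - delta)) u v)
     - dotp b (grady g t (X t) (X (t - delta)) u v)| <= e * (`|a| + `|b|).
Proof.
move=> g0 tt e0.
pose z := (t, X t, X (t - delta), u, v).
have Az : A z by split; rewrite ?in_itv//= subrr normr0.
have en0 : 0 < e / (n%:R + 1) by rewrite divr_gt0// ltr_wpDl.
have cont (G : delay_fun R n m 'rV[R]_n) : {within A, continuous (uncurry5 G)} ->
    exists2 d, 0 < d & forall a b : 'rV[R]_n, `|a| <= d -> `|b| <= d ->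
      `|G t (X t + a) (X (t - delta) + b) u v - G t (X t) (X (t - delta)) u v| <= e / (n%:R + 1).
  move=> /subspace_continuousP/(_ z Az)/cvgrPdist_le/(_ _ en0)/=.
  rewrite near_withinE => Gz.
  pose Z (w : 'rV[R]_n * 'rV[R]_n) := (t, X t + w.1, X (t - delta) + w.2, u, v).
  have : Z w @[w --> (0 : 'rV[R]_n, 0 : 'rV[R]_n)] --> z.
    apply: cvg_tuple5; try exact: cvg_cst.
      rewrite -[X in _ --> X]addr0; apply: cvgD; [exact: cvg_cst|exact: cvg_fst].
    rewrite -[X in _ --> X]addr0; apply: cvgD; [exact: cvg_cst|exact: cvg_snd].
  move=> /(_ _ Gz)/nbhs_ballP[d /= d0 dP].
  (* Halves, since the balls of radius [d] and [gamma] are open while the bounds on [a] and [b] are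
     not strict. *)
  exists (Num.min (d / 2) (gamma / 2)); first by rewrite lt_min !divr_gt0.
  move=> a b; rewrite !le_min => /andP[ad ag] /andP[bd bg].
  have hd : d / 2 < d by rewrite ltr_pdivrMr// ltr_pMr// ltr1n.
  have hg : gamma / 2 < gamma by rewrite ltr_pdivrMr// ltr_pMr// ltr1n.
  rewrite distrC; apply: (dP (a, b)).
    by split => /=; rewrite -ball_normE /= sub0r normrN; [exact: le_lt_trans ad _|exact: le_lt_trans bd _].
  split; first by rewrite in_itv.
    by rewrite /= addrC addKr (le_lt_trans ag).
  by rewrite /= addrC addKr (le_lt_trans bg).
have [d1 d10 h1] := cont _ gradx_within.
have [d2 d20 h2] := cont _ grady_within.
exists (Num.min (Num.min d1 d2) (gamma / 2)); first by rewrite !lt_min d10 d20 divr_gt0.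
move=> a b; rewrite !le_min => /andP[/andP[a1 a2] ag] /andP[/andP[b1 b2] bg].
have hg : gamma / 2 < gamma by rewrite ltr_pdivrMr// ltr_pMr// ltr1n.
have zg : `|0 : 'rV[R]_n| <= gamma / 2 by rewrite normr0 divr_ge0// ltW.
have [c [c' [_ _ ca cb]]] := mean_value_xy u v hg tt ag zg bg zg.
rewrite !addr0 !subr0 => ->.
have cad : `|c| <= d1 by rewrite (le_trans ca)// normr0 ge_max a1 ltW.
have cbd : `|c'| <= d2 by rewrite (le_trans cb)// normr0 ge_max b2 ltW.
have z2 : `|0 : 'rV[R]_n| <= d2 by rewrite normr0 ltW.
have := h1 c b cad b1; have := h2 0 c' z2 cbd; rewrite addr0 => k2 k1.
set G1 := gradx g t (X t + c) _ u v in k1 *; set G2 := gradx g _ _ _ _ _ in k1 *.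
set G3 := grady g t _ _ u v in k2 *; set G4 := grady g _ _ _ _ _ in k2 *.
rewrite (_ : _ - _ - _ = dotp a (G1 - G2) + dotp b (G3 - G4)); last first.
  by rewrite !dotpBr; ring.
rewrite (le_trans (ler_normD _ _))// (le_trans (lerD (norm_dotp_le _ _) (norm_dotp_le _ _)))//.
rewrite -mulrDr; move: k1 k2 (normr_ge0 a) (normr_ge0 b).
by move: (`|a|) (`|b|) (`|G1 - G2|) (`|G3 - G4|) => *; apply: weighted_remainder_le.
Qed.

End Scalar.

End Tube.

(** * Piecewise continuity and needles *)


Section OneSided.
Context {R : realType}.
Implicit Types (a b t : R) (s : seq R).

Definition right_continuous {T : topologicalType} (g : R -> T) :=
  forall t, g r @[r --> side true t] --> g t.

Lemma side_notin s (b : bool) t : \forall r \near side b t, r \notin s.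
Proof.
elim: s => [|c s IH]; first exact: nearW.
near=> r; rewrite inE negb_or; apply/andP; split; near: r => //.
exact: side_neq.
Unshelve. all: by end_near. Qed.

Lemma right_lt c t : \forall r \near side true t, (r < c) = (t < c).
Proof.
near=> r; rewrite (near (side_ltE true c t) r)//.
by case: eqVneq => // ->; rewrite ltxx.
Unshelve. all: by end_near. Qed.

Lemma right_mem_co c d t :
  \forall r \near side true t, (r \in `[c, d[) = (t \in `[c, d[).
Proof.
near=> r; rewrite !in_itv/= !(leNgt c).
by rewrite (near (right_lt c t) r)// (near (right_lt d t) r).
Unshelve. all: by end_near. Qed.

(** To the right of any point, membership in [[c, d[] does not change for a while. This is why
    needles are closed on the left and open on the right. *)
Lemma right_continuous_ite_co {T : topologicalType} c d (f g : R -> T) :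
  right_continuous f -> right_continuous g ->
  right_continuous (fun t => if t \in `[c, d[ then f t else g t).
Proof.
move=> fr gr t; case: ifPn => ti.
  apply: cvg_trans (fr t); apply: near_eq_cvg.
  by near=> r; rewrite (near (right_mem_co c d t) r)// ti.
apply: cvg_trans (gr t); apply: near_eq_cvg.
by near=> r; rewrite (near (right_mem_co c d t) r)// (negbTE ti).
Unshelve. all: by end_near. Qed.

Lemma right_continuous_cst {T : topologicalType} (x : T) : right_continuous (fun _ => x).
Proof. by move=> t; exact: cvg_cst. Qed.

Lemma right_continuous_shift {T : topologicalType} (g : R -> T) d :
  right_continuous g -> right_continuous (fun t => g (t + d)).
Proof. by move=> gr t; exact: (cvg_comp _ _ (@cvg_side_shift _ true t d) (gr _)). Qed.

Context {V : normedModType R}.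
Implicit Types g h : R -> V.

(** With [pc_offP], the passage between one-sided limits and convergence within [[a, b]]; at an end
    point the outward side is vacuous. *)
Lemma pc_off_sides s a b g : a < b -> (forall t, t \in s -> t \in `]a, b[) ->
  (forall t, a <= t < b -> g r @[r --> side true t] --> g t) ->
  (forall t, a < t <= b -> exists l : V, g r @[r --> side false t] --> l) ->
  (forall t, a < t <= b -> t \notin s -> g r @[r --> side false t] --> g t) ->
  pc_off s a b g.
Proof.
move=> ab sab gR gL gLs; split => //.
- move=> t; rewrite in_itv/= => /andP[at' tb] ts B Bt.
  suff h : \forall r \near t, `[a, b]%classic r -> B (g r) by exact: h.
  apply: near_sides => /=.
    by move=> _; exact: nbhs_singleton.
  case.
    have [tb'|bt] := ltP t b.
      have := gR t; rewrite at' tb' => /(_ isT) /(_ _ Bt) h1.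
      have {h1} : \forall r \near side true t, B (g r) := h1.
      by apply: filterS => r Br _.
    near=> r => rab; suff : r <= b < r by move=> /andP[]; lra.
    move: rab; rewrite in_itv/= => /andP[_ ->]/=.
    rewrite (le_lt_trans bt)//; near: r; exact: nbhs_right_gt.
  have [at''|ta] := ltP a t.
    have := gLs t; rewrite at'' tb => /(_ isT ts) /(_ _ Bt) h1.
    have {h1} : \forall r \near side false t, B (g r) := h1.
    by apply: filterS => r Br _.
  near=> r => rab; suff : r < a <= r by move=> /andP[]; lra.
  move: rab; rewrite in_itv/= => /andP[-> _]; rewrite andbT.
  rewrite (lt_le_trans _ ta)//; near: r; exact: nbhs_left_lt.
- move=> t /sab; rewrite in_itv/= => /andP[at' tb]; split.
    have [|l gl] := gL t; first by rewrite at' ltW.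
    by apply/cvg_ex; exists l.
  by apply: gR; rewrite tb ltW.
Unshelve. all: by end_near. Qed.

Lemma pc_offP s a b g : a < b -> pc_off s a b g ->
  [/\ forall t, a <= t < b -> g r @[r --> side true t] --> g t,
      forall t, a < t <= b -> exists l : V, g r @[r --> side false t] --> l,
      forall t, a < t < b -> t \notin s -> {for t, continuous g}
    & g r @[r --> side false b] --> g b].
Proof.
move=> ab [sab gs gj].
have gR t : a <= t < b -> t \notin s -> g r @[r --> side true t] --> g t.
  move=> /andP[at' tb] ts B Bt; have := gs t; rewrite in_itv/= at' ltW// => /(_ isT ts _ Bt).
  rewrite /= !near_simpl near_withinE => h.
  near=> r; apply: (near (near_side true h) r) => //.
  rewrite /= in_itv/=; apply/andP; split.
    by rewrite (le_trans at')// ltW//; near: r; exact: nbhs_right_gt.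
  by near: r; apply: nbhs_right_le.
have gL t : a < t <= b -> t \notin s -> g r @[r --> side false t] --> g t.
  move=> /andP[at' tb] ts B Bt; have := gs t; rewrite in_itv/= tb ltW// => /(_ isT ts _ Bt).
  rewrite /= !near_simpl near_withinE => h.
  near=> r; apply: (near (near_side false h) r) => //.
  rewrite /= in_itv/=; apply/andP; split.
    by near: r; apply: nbhs_left_ge.
  by rewrite (le_trans _ tb)// ltW//; near: r; exact: nbhs_left_lt.
split.
- move=> t tab; have [ts|ts] := boolP (t \in s); last exact: gR.
  by have [] := gj t ts.
- move=> t tab; have [ts|ts] := boolP (t \in s); last by exists (g t); exact: gL.
  by have [/cvg_ex] := gj t ts.
- move=> t /andP[at' tb] ts; apply: continuous_side => -[].
    by apply: gR => //; rewrite tb ltW.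
  by apply: gL => //; rewrite at' ltW.
- apply: gL; first by rewrite ab lexx.
  by apply/negP => /sab; rewrite in_itv/= ltxx andbF.
Unshelve. all: by end_near. Qed.

(** Right limits before [b] and the left limit at [b] are exactly the values that [pc_off]
    prescribes. Thus a right-hand side known up to its values at jumps becomes an admissible
    derivative. *)
Lemma regulated_repair s a b h : a < b ->
  (forall t, t \notin s -> {for t, continuous h}) ->
  (forall c t, exists l : V, h r @[r --> side c t] --> l) ->
  exists g, [/\ exists s', (forall t, (t \in s') = (a < t < b) && (t \in s)) /\ pc_off s' a b g,
    (forall t, a <= t < b -> h r @[r --> side true t] --> h t -> g t = h t) &
    (forall t, a <= t < b -> t \notin s -> g t = h t)].
Proof.
move=> ab hs hl.
have /choice[lr lrP] : forall t, exists l : V, h r @[r --> side true t] --> l by move=> t; exact: hl.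
have /choice[ll llP] : forall t, exists l : V, h r @[r --> side false t] --> l by move=> t; exact: hl.
pose g t := if t < b then lr t else ll b.
have uniq (c : bool) t (l l' : V) : h r @[r --> side c t] --> l -> h r @[r --> side c t] --> l' -> l = l'.
  by move=> h1 h2; exact: (cvg_unique _ h1 h2).
have hc t c : t \notin s -> h r @[r --> side c t] --> h t.
  by move=> ts; apply: cvg_trans (hs t ts); apply: cvg_app; exact: side_nbhs.
have gh t : t < b -> t \notin s -> g t = h t.
  by move=> tb ts; rewrite /g tb; apply: uniq (lrP t) _; exact: hc.
have gR t : t < b -> g r @[r --> side true t] --> lr t.
  move=> tb; apply: cvg_trans (lrP t); apply: near_eq_cvg.
  near=> r; have rb : r < b by rewrite (near (right_lt b t) r).
  have rs : r \notin s by near: r; exact: side_notin.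
  by rewrite gh.
have gL t : t <= b -> g r @[r --> side false t] --> ll t.
  move=> tb; apply: cvg_trans (llP t); apply: near_eq_cvg.
  near=> r; rewrite gh//; last by near: r; exact: side_notin.
  by rewrite (lt_le_trans _ tb)//; near: r; exact: nbhs_left_lt.
exists g; split.
- exists [seq t <- s | a < t < b]; split; first by move=> t; rewrite mem_filter.
  apply: pc_off_sides => //.
  + by move=> t; rewrite mem_filter in_itv/= => /andP[].
  + by move=> t /andP[_ tb]; rewrite {2}/g tb; exact: gR.
  + by move=> t /andP[_ tb]; exists (ll t); exact: gL.
  + move=> t /andP[at' tb]; rewrite mem_filter negb_and => nts.
    have [tb'|bt] := ltP t b; last first.
      have -> : t = b by apply/eqP; rewrite eq_le tb bt.
      by rewrite {2}/g ltxx; exact: gL.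
    move: nts; rewrite at' tb'/= => ts.
    by rewrite gh// -(uniq false t (ll t) (h t))//; [exact: gL|exact: hc].
- by move=> t /andP[_ tb] ht; rewrite /g tb; exact: uniq (lrP t) _.
- by move=> t /andP[_ tb] ts; exact: gh.
Unshelve. all: by end_near. Qed.

(** Outside [[a, b]] the values of [g] are arbitrary. They are replaced by [c] on the left, where
    [c] will be the prescribed history [u0], and by [g b] on the right, which creates no jump at
    [b]. *)
Lemma pc_extend a b g (c : V) : a < b -> piecewise_continuous a b g ->
  exists h, [/\ regulated h, right_continuous h, h r @[r --> side false b] --> h b,
    (forall t, a <= t <= b -> h t = g t) & (forall t, t < a -> h t = c)].
Proof.
move=> ab [s /(pc_offP ab)[gR gL gc gb]].
pose h t := if t < a then c else if t < b then g t else g b.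
have hg t : a <= t <= b -> h t = g t.
  move=> /andP[at' tb]; rewrite /h ltNge at'/=; case: ltP => // bt.
  by congr g; apply/eqP; rewrite eq_le tb bt.
have hr : right_continuous h.
  move=> t; have [ta|at'] := ltP t a.
    apply: cvg_near_cst; near=> r.
    by rewrite /h (near (right_lt a t) r)// ta.
  have [tb|bt] := ltP t b.
    rewrite hg ?at' ?(ltW tb)//; apply: (@cvg_trans _ (g r @[r --> side true t])); last by apply: gR; rewrite at'.
    apply: near_eq_cvg; near=> r.
    by rewrite /h (near (right_lt a t) r)// (near (right_lt b t) r)// tb ltNge at'.
  apply: cvg_near_cst; near=> r.
  by rewrite /h (near (right_lt a t) r)// (near (right_lt b t) r)// ltNge at'/= ltNge bt.
have hL t : exists l : V, h r @[r --> side false t] --> l.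
  have [ta|at'] := leP t a.
    exists c; apply: cvg_near_cst; near=> r.
    rewrite /h (_ : r < a)// (lt_le_trans _ ta)//; near: r; exact: nbhs_left_lt.
  have [tb|bt] := leP t b.
    have [|l gl] := gL t; first by rewrite at'.
    exists l; apply: cvg_trans gl; apply: near_eq_cvg; near=> r.
    rewrite hg//; apply/andP; split; first by near: r; exact: nbhs_left_ge.
    by rewrite (le_trans _ tb)// ltW//; near: r; exact: nbhs_left_lt.
  exists (g b); apply: cvg_near_cst; near=> r.
  have br : b < r by near: r; exact: nbhs_left_gt.
  by rewrite /h ltNge (ltW (lt_trans ab br))/= ltNge ltW.
exists h; split => //.
- exists (a :: b :: s); split; last by move=> [] t; [exists (h t); exact: hr|exact: hL].
  move=> t; rewrite !inE !negb_or => /and3P[ta tb ts].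
  have [tlta|alet] := ltP t a.
    rewrite /prop_for /continuous_at; apply: cvg_near_cst; near=> r.
    by rewrite /h (near (near_ltE ta) r)// tlta.
  have alt : a < t by rewrite lt_neqAle eq_sym ta.
  have [tltb|blet] := ltP t b.
    rewrite /prop_for /continuous_at hg ?alet ?ltW//.
    apply: (@cvg_trans _ (g r @[r --> t])); last by apply: gc; rewrite ?alt.
    apply: near_eq_cvg; near=> r.
    by rewrite /h (near (near_ltE ta) r)// (near (near_ltE tb) r)// tltb ltNge alet.
  rewrite /prop_for /continuous_at; apply: cvg_near_cst; near=> r.
  by rewrite /h (near (near_ltE ta) r)// (near (near_ltE tb) r)// ltNge alet/= ltNge blet.
- rewrite hg ?lexx ?(ltW ab)//; apply: (@cvg_trans _ (g r @[r --> side false b])); last exact: gb.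
  apply: near_eq_cvg; near=> r.
  rewrite hg//; apply/andP; split; first by near: r; exact: nbhs_left_ge.
  by rewrite ltW//; near: r; exact: nbhs_left_lt.
- by move=> t ta; rewrite /h ta.
Unshelve. all: by end_near. Qed.

End OneSided.

Section Needle.
Context {R : realType}.
Implicit Types (a b t : R) (s : seq R) (g : R -> R).

Definition needle (c d : R) g t := if t \in `[c, d[ then g t else 0.

Lemma regulated_needle c d g : regulated g -> regulated (needle c d g).
Proof. by move=> gr; apply: regulated_ite_itv => //; exact: regulated_cst. Qed.

Lemma primitive_eq_on a s g (f : R -> R) c d : regulated g -> continuous f -> a <= c -> c <= d ->
  (forall t, c < t < d -> t \notin s -> is_derive t 1 f (g t)) ->
  primitive a g d - primitive a g c = f d - f c.
Proof.
move=> gr fc ac cd fd; have [s' [gs _]] := gr.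
have : (f - primitive a g) d = (f - primitive a g) c.
  apply: (@derive0_off_cst _ (s ++ s')) => //.
    by move=> t; apply: continuousB; [exact: fc|exact: primitive_continuous].
  move=> t /andP[ct td]; rewrite mem_cat negb_or => /andP[ts ts'].
  rewrite -(subrr (g t)); have ? := fd _ _ ts; apply: is_deriveB.
    by apply: fd => //; rewrite ct td.
  by apply: primitive_derive => //; [exact: le_lt_trans ac ct|exact: gs].
by rewrite !fctE; lra.
Qed.

Lemma primitive_needle a c d T g : regulated g -> a <= c -> c <= d -> d <= T ->
  primitive a (needle c d g) T = primitive a g d - primitive a g c.
Proof.
move=> gr ac cd dT; have nr := regulated_needle c d gr.
have [s [gs _]] := gr.
have z : continuous (fun _ : R => 0 : R) by move=> t; exact: cvg_cst.
have h1 := @primitive_eq_on a [::] _ (fun=> 0) a c nr z (lexx a) ac.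
have h2 := @primitive_eq_on a s _ (primitive a g) c d nr (@primitive_continuous _ a _ gr) ac cd.
have h3 := @primitive_eq_on a [::] _ (fun=> 0) d T nr z (le_trans ac cd) dT.
rewrite (primitive_le0 _ (lexx a)) in h1.
have {}h1 : primitive a (needle c d g) c - 0 = 0 - 0.
  apply: h1 => t /andP[at' tc] _; rewrite /needle in_itv/= leNgt tc/=.
  exact: is_derive_cst.
have {}h2 : primitive a (needle c d g) d - primitive a (needle c d g) c = primitive a g d - primitive a g c.
  apply: h2 => t /andP[ct td] ts; rewrite /needle in_itv/= (ltW ct) td/=.
  by apply: primitive_derive => //; [exact: le_lt_trans ct|exact: gs].
have {}h3 : primitive a (needle c d g) T - primitive a (needle c d g) d = 0 - 0.
  apply: h3 => t /andP[dt tT] _; rewrite /needle in_itv/= [t < d]ltNge (ltW dt) andbF.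
  exact: is_derive_cst.
by lra.
Qed.

Lemma primitive_le a (g h : R -> R) t : regulated g -> regulated h ->
  (forall r, `|g r| <= h r) -> `|primitive a g t| <= primitive a h t.
Proof.
move=> gr hr gh; have [ta|/ltW at'] := leP t a; first by rewrite !primitive_le0// normr0.
have [s [gs _]] := gr; have [s' [hs _]] := hr.
have := @mean_value_le _ (s ++ s') (primitive a g) g (primitive a h) h a t
  (@primitive_continuous _ a _ gr) (@primitive_continuous _ a _ hr) at'.
rewrite !(primitive_le0 _ (lexx a)) !subr0; apply.
- move=> r /andP[ar _]; rewrite mem_cat negb_or => /andP[rs _].
  by apply: primitive_derive => //; exact: gs.
- move=> r /andP[ar _]; rewrite mem_cat negb_or => /andP[_ rs].
  by apply: primitive_derive => //; exact: hs.
- by move=> r _ _; exact: gh.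
Qed.

Lemma primitiveD a (g h : R -> R) t : regulated g -> regulated h ->
  primitive a (fun r => g r + h r) t = primitive a g t + primitive a h t.
Proof.
move=> gr hr; have [ta|/ltW at'] := leP t a; first by rewrite !primitive_le0// addr0.
have [s [gs _]] := gr; have [s' [hs _]] := hr.
have := @primitive_eq_on a (s ++ s') _ (primitive a g + primitive a h) a t (regulatedD gr hr) _ (lexx a) at' _.
rewrite !fctE !(primitive_le0 _ (lexx a)) addr0 !subr0; apply.
  by move=> r; apply: continuousD; exact: primitive_continuous.
move=> r /andP[ar _]; rewrite mem_cat negb_or => /andP[rs rs'].
by apply: is_deriveD; apply: primitive_derive => //; [exact: gs|exact: hs].
Qed.

(** The primitive is nondecreasing and has collected the whole mass [M * (d - c)] at
    [Num.max t d]. *)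
Lemma primitive_needle_cst a c d (M : R) t : a <= c -> c <= d -> 0 <= M ->
  primitive a (needle c d (fun=> M)) t <= M * (d - c).
Proof.
move=> ac cd M0; have mr : regulated (fun _ : R => M) by exact: regulated_cst.
have nr := regulated_needle c d mr.
have T : primitive a (needle c d (fun=> M)) (Num.max t d) = M * (d - c).
  rewrite primitive_needle ?le_max ?lexx ?orbT//.
  have hd : forall t, c < t < d -> t \notin [::] -> is_derive t 1 (M \*: id : R -> R) M.
    by move=> r _ _; apply: is_derive_eq; rewrite [LHS]mulr1.
  rewrite (@primitive_eq_on a [::] _ (M \*: id : R -> R) c d)//.
    by rewrite /= -scalerBr.
  have c0 : continuous (fun r : R => M * r).
    by move=> r; apply: cvgM; [exact: cvg_cst|exact: cvg_id].
  exact: c0.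
rewrite -T; have [ta|/ltW at'] := leP t a.
  rewrite primitive_le0// T mulr_ge0// subr_ge0//.
have [s [ns _]] := nr.
apply: (@ndecr_off _ s _ (needle c d (fun=> M))) => //.
- exact: primitive_continuous.
- by rewrite le_max lexx.
- by move=> r /andP[tr _] rs; apply: primitive_derive => //; [exact: le_lt_trans at' tr|exact: ns].
- by move=> r _ _; rewrite /needle; case: ifP.
Qed.

(** Beyond [Num.max a b] the primitive is constant. This supplies the bound [D] that
    [delay_ode_solution] requires on the whole line. *)
Lemma primitive_bounded a b g : regulated g -> (forall t, b < t -> g t = 0) ->
  exists2 D, 0 <= D & forall t, `|primitive a g t| <= D.
Proof.
move=> gr gb.
have pc := @primitive_continuous _ a _ gr.
have [D DP] := regulated_bounded a (Num.max a b) (regulated_continuous pc).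
exists `|D|; first by [].
move=> t; have [ta|at'] := leP t a; first by rewrite primitive_le0// normr0.
have [tb|bt] := leP t (Num.max a b).
  by rewrite (le_trans (DP _ _)) ?ler_norm// (ltW at') tb.
have -> : primitive a g t = primitive a g (Num.max a b).
  apply/eqP; rewrite -subr_eq0; apply/eqP.
  have aM : a <= Num.max a b by rewrite le_max lexx.
  have z : continuous (fun _ : R => 0 : R) by move=> ?; exact: cvg_cst.
  have := @primitive_eq_on a [::] _ (fun=> 0) _ _ gr z aM (ltW bt).
  rewrite subrr; apply => r /andP[br _] _; rewrite gb; first exact: is_derive_cst.
  by rewrite (le_lt_trans _ br)// le_max lexx orbT.
by rewrite (le_trans (DP _ _)) ?ler_norm// le_max lexx/=.
Qed.

End Needle.



(** * Truncation in space, cut-off in time, and transfer between trajectories and tubes *)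

Section ClampVector.
Context {R : realType} {n : nat}.
Implicit Types (a b : 'rV[R]_n).

(** Balls of the maximum norm are cubes, so truncating each coordinate is, for [rho >= 0], a
    retraction onto the ball with Lipschitz constant 1. *)
Definition clamp_vec (rho : R) a : 'rV[R]_n :=
  \row_i Num.max (- rho) (Num.min rho (a 0 i)).

Lemma norm_clamp_vec rho a : 0 <= rho -> `|clamp_vec rho a| <= rho.
Proof.
move=> r0; apply: norm_row_le => // i; rewrite mxE ler_norml le_max lexx/=.
by rewrite ge_max ge_min lexx/= andbT; lra.
Qed.

Lemma clamp_vec_lipschitz rho a b : `|clamp_vec rho a - clamp_vec rho b| <= `|a - b|.
Proof.
apply: norm_row_le => // i; apply: le_trans (norm_coord_le (a - b) i); rewrite !mxE.
move: (a 0 i) (b 0 i) => x y; rewrite /Order.max /Order.min.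
have := ler_norm (x - y); have := ler_norm (y - x); rewrite distrC ler_norml => h1 h2.
have [?|?] := ltP rho x; have [?|?] := ltP rho y; do 2![case: ltP => ?];
  apply/andP; split; lra.
Qed.

Lemma clamp_vec_id rho a : `|a| <= rho -> clamp_vec rho a = a.
Proof.
move=> ar; apply/rowP => i; rewrite mxE; have := norm_coord_le a i.
move=> /le_trans/(_ ar); rewrite ler_norml => /andP[h1 h2].
by rewrite (min_idPr h2) (max_idPr h1).
Qed.

Lemma clamp_vec_continuous rho : continuous (clamp_vec rho).
Proof.
move=> a; have Fa : Filter (nbhs a) by exact: nbhs_filter.
apply/cvgrPdist_lt => e e0.
have /cvgrPdist_lt/(_ _ e0) := @cvg_id _ (nbhs a).
by apply: filterS => b; apply: le_lt_trans; exact: clamp_vec_lipschitz.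
Qed.

End ClampVector.

Section ChiMul.
Context {R : realType}.
Implicit Types (a b t : R).

Lemma chi_mul_in {V : zmodType} a b t (x : V) : a <= t <= b -> chi_mul a b t x = x.
Proof. by move=> tab; rewrite /chi_mul in_itv/= tab. Qed.

Lemma chi_mul_out {V : zmodType} a b t (x : V) : ~~ (a <= t <= b) -> chi_mul a b t x = 0.
Proof. by move=> tab; rewrite /chi_mul in_itv/= (negbTE tab). Qed.

Lemma chi_mul_coord {n : nat} a b t (x : 'rV[R]_n) i :
  (chi_mul a b t x) 0 i = chi_mul a b t (x 0 i).
Proof. by rewrite /chi_mul; case: ifP => // _; rewrite mxE. Qed.

Lemma norm_chi_mul_le {V : normedModType R} a b t (x : V) (M : R) : 0 <= M ->
  (a <= t <= b -> `|x| <= M) -> `|chi_mul a b t x| <= M.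
Proof. by rewrite /chi_mul in_itv/=; case: ifP => [_ _|_ M0 _]; [exact|rewrite normr0]. Qed.

Lemma regulated_chi_mul {V : normedModType R} a b (g : R -> V) :
  regulated g -> regulated (fun t => chi_mul a b t (g t)).
Proof. by move=> gr; apply: regulated_ite_itv => //; exact: regulated_cst. Qed.

(** Converts the cut-off at [t1], read one delay later, into the factor on [[t0, t1 - delta]] of the
    adjoint equation and the maximum condition. *)
Lemma chi_mul_shift {V : zmodType} a b d t (x : V) : a <= t -> 0 <= d ->
  chi_mul a b (t + d) x = chi_mul a (b - d) t x.
Proof.
move=> at' d0; have [le|lt] := leP t (b - d).
  by rewrite !chi_mul_in//; [rewrite at'|lra].
rewrite !chi_mul_out//; first by rewrite negb_and -!ltNge lt orbT.
by rewrite negb_and -!ltNge; apply/orP; right; lra.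
Qed.

End ChiMul.

Section TubeMore.
Context {R : realType} {n m : nat} (t0 t1 delta gamma : R) (X : R -> 'rV[R]_n).

(** The tube reads the trajectory on [[t0 - delta, t1]] only, so [xs] may be exchanged for an
    extension continuous on the line. *)
Lemma tube_eq (Y : R -> 'rV[R]_n) : 0 <= delta ->
  (forall t, t0 - delta <= t <= t1 -> Y t = X t) ->
  @tube R n m t0 t1 delta gamma Y = tube t0 t1 delta gamma X.
Proof.
move=> d0 YX; apply/seteqP; split => -[[[[t xi] eta] u] v] /= [tt];
  move: (tt); rewrite in_itv/= => /andP[h1 h2].
  by rewrite !YX; [split|lra|lra].
by rewrite -!YX; [split|lra|lra].
Qed.

Lemma C1_on_tube_eq {V : normedModType R} (g : delay_fun R n m V) (Y : R -> 'rV[R]_n) :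
  0 <= delta -> (forall t, t0 - delta <= t <= t1 -> Y t = X t) ->
  C1_on_tube t0 t1 delta gamma Y g -> C1_on_tube t0 t1 delta gamma X g.
Proof. by move=> d0 YX; rewrite /C1_on_tube (tube_eq d0 YX). Qed.

Definition coord_fun (phi : delay_fun R n m 'rV[R]_n) (i : 'I_n) : delay_fun R n m R :=
  fun t x y u v => phi t x y u v 0 i.

Lemma C1_on_tube_coord (phi : delay_fun R n m 'rV[R]_n) i :
  C1_on_tube t0 t1 delta gamma X phi -> C1_on_tube t0 t1 delta gamma X (coord_fun phi i).
Proof.
move=> [pc pd px py].
have dc (h : 'rV[R]_n -> 'rV[R]_n) z : differentiable h z -> differentiable (fun z => h z 0 i) z.
  by move=> hz; apply: (@differentiable_comp _ _ _ _ h (fun v : 'rV[R]_n => v 0 i)) => //; exact: differentiable_coord.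
have Dc (h : 'rV[R]_n -> 'rV[R]_n) z d : differentiable h z -> 'D_d (fun z => h z 0 i) z = 'D_d h z 0 i.
  by move=> hz; rewrite derive_mx ?mxE//; exact: diff_derivable.
have cc (T : topologicalType) (A : set T) (h : T -> 'rV[R]_n) (g : T -> R) :
    (forall z, A z -> g z = h z 0 i) -> {within A, continuous h} -> {within A, continuous g}.
  move=> gh /subspace_continuousP hA; apply/subspace_continuousP => z Az.
  have hz : h w @[w --> within A (nbhs z)] --> h z := hA z Az.
  suff : g w @[w --> within A (nbhs z)] --> g z by [].
  rewrite gh//; apply: cvg_trans (cvg_comp _ _ hz (@coord_continuous _ _ _ 0 i _)).
  apply: near_eq_cvg.
  by rewrite near_withinE; apply: nearW => z' Az' /=; rewrite gh.
split.
- by apply: cc pc => -[[[[t x] y] u] v].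
- by move=> t x y u v Az; have [h1 h2] := pd _ _ _ _ _ Az; split; exact: dc.
- move=> d; apply: cc (px d) => -[[[[t x] y] u] v] Az.
  by have [h1 h2] := pd _ _ _ _ _ Az; rewrite /coord_fun Dc.
- move=> d; apply: cc (py d) => -[[[[t x] y] u] v] Az.
  by have [h1 h2] := pd _ _ _ _ _ Az; rewrite /coord_fun Dc.
Qed.

(** On [[t0, t1]] clamping changes nothing, and outside the cut-off hides the value; hence the
    regularity of the clamped composition carries over. *)
Lemma cut_regulated {V : normedModType R} (F : delay_fun R n m V) (x y : R -> 'rV[R]_n)
    (u v : R -> 'rV[R]_m) : t0 <= t1 ->
  {within tube t0 t1 delta gamma X, continuous (uncurry5 F)} ->
  continuous x -> continuous y ->
  (forall t, t0 <= t <= t1 -> `|x t - X t| < gamma) ->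
  (forall t, t0 <= t <= t1 -> `|y t - X (t - delta)| < gamma) ->
  regulated u -> regulated v ->
  regulated (fun t => chi_mul t0 t1 t (F t (x t) (y t) (u t) (v t))).
Proof.
move=> t01 Fc xc yc xX yX ur vr.
have := regulated_chi_mul t0 t1 (tube_regulated t01 Fc xc yc xX yX ur vr).
congr regulated; apply/funext => t; rewrite /chi_mul in_itv/=.
by case: ifP => // tt; rewrite clamp_itv_id.
Qed.

(** Identifies [adjoint_row], built from gradients of the coordinates of [phi], with the gradients
    of the Pontryagin function. *)
Lemma gradient_dotp_sub {k : nat} (p : 'rV[R]_k) (h : 'rV[R]_n -> 'rV[R]_k) (g : 'rV[R]_n -> R) z :
  differentiable h z -> differentiable g z ->
  gradient (fun x => dotp p (h x) - g x) z =
  \row_i (\sum_j p 0 j * (gradient (fun x => h x 0 j) z) 0 i - gradient g z 0 i).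
Proof.
move=> hz gz; apply/rowP => i; rewrite !mxE.
have dc j : differentiable (fun x => h x 0 j) z.
  by apply: (@differentiable_comp _ _ _ _ h (fun v : 'rV[R]_k => v 0 j)) => //; exact: differentiable_coord.
rewrite (_ : (fun x => _) = (\sum_(j < k) (p 0 j \*: (fun x => h x 0 j))) - g); last first.
  by apply/funext => x; rewrite !fctE fct_sumE.
rewrite deriveB; last first.
- exact: diff_derivable.
- by apply: derivable_sum => j; apply: derivableZ; exact: diff_derivable.
rewrite derive_sum; last by move=> j; apply: derivableZ; exact: diff_derivable.
congr (_ - _); apply: eq_bigr => j _; rewrite deriveZ; last exact: diff_derivable.
by rewrite mxE.
Qed.

End TubeMore.

(** * The adjoint equation *)



Section Trajectory.
Context {R : realType} {n m : nat} (t0 t1 delta gamma : R).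
Context (f : delay_fun R n m R) (phi : delay_fun R n m 'rV[R]_n).
Context (X : R -> 'rV[R]_n) (w : R -> 'rV[R]_m).
Context (t01 : t0 < t1) (delta_gt0 : 0 < delta) (gamma_gt0 : 0 < gamma).
Context (Xc : continuous X) (wr : regulated w).
Context (fC : C1_on_tube t0 t1 delta gamma X f).
Context (phiC : C1_on_tube t0 t1 delta gamma X phi).

Definition along {V : Type} (g : delay_fun R n m V) (t : R) : V :=
  g t (X t) (X (t - delta)) (w t) (w (t - delta)).

(* [H_x[t]] for [D = gradx] and [H_y[t]] for [D = grady], the value of the adjoint
   variable being [a]. *)
Definition adjoint_row (D : delay_fun R n m R -> delay_fun R n m 'rV[R]_n) (t : R)
    (a : 'rV[R]_n) : 'rV[R]_n :=
  \row_i (\sum_j a 0 j * along (D (coord_fun phi j)) t 0 i - along (D f) t 0 i).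

Lemma Xdelay_continuous : continuous (fun t => X (t - delta)).
Proof.
move=> t; apply: (@continuous_comp _ _ _ (fun t => t - delta) X); last exact: Xc.
by apply: cvgB; [exact: cvg_id|exact: cvg_cst].
Qed.

Lemma norm_subrr_lt (x : 'rV[R]_n) : `|x - x| < gamma.
Proof. by rewrite subrr normr0. Qed.

Lemma along_regulated {V : normedModType R} (g : delay_fun R n m V) :
  {within tube t0 t1 delta gamma X, continuous (uncurry5 g)} ->
  regulated (fun t => chi_mul t0 t1 t (along g t)).
Proof.
move=> gc; apply: (cut_regulated (ltW t01) gc) => //.
- exact: Xdelay_continuous.
- by move=> t _; exact: norm_subrr_lt.
- by move=> t _; exact: norm_subrr_lt.
- exact: regulated_shift.
Qed.

Lemma w_bounded (a b : R) : exists2 r, 0 <= r & forall t, a <= t <= b -> `|w t| <= r.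
Proof.
have [r rP] := regulated_bounded a b wr; exists `|r|; first by [].
by move=> t /rP /le_trans; apply; exact: ler_norm.
Qed.

Lemma along_bounded {V : normedModType R} (g : delay_fun R n m V) :
  {within tube t0 t1 delta gamma X, continuous (uncurry5 g)} ->
  exists2 M, 0 <= M & forall t, t0 <= t <= t1 -> `|along g t| <= M.
Proof.
move=> gc; have [r r0 wR] := w_bounded (t0 - delta) t1.
have [M M0 MP] := tube_bounded Xc r gc gamma_gt0.
exists M => // t tt; have z0 : `|0 : 'rV[R]_n| <= 0 by rewrite normr0.
move: (tt) => /andP[h1 h2]; have d0 := delta_gt0.
have := MP t 0 0 (w t) (w (t - delta)) tt z0 z0; rewrite !addr0; apply; apply: wR; lra.
Qed.

(** With [q r = p (- r)] the advanced value [p (t + delta)] is [q (r - delta)]. The equation is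
    affine in [p]; cutting off its coefficients makes them bounded on the line, which gives a global
    Lipschitz constant. *)
Lemma adjoint_solution (c : 'rV[R]_n) : exists p : R -> 'rV[R]_n,
  [/\ continuous p, p t1 = c & exists s : seq R, forall t, t0 < t < t1 -> t \notin s ->
    is_derive t 1 p (- adjoint_row gradx t (p t)
      - chi_mul t0 (t1 - delta) t (adjoint_row grady (t + delta) (p (t + delta))))].
Proof.
have d0 := delta_gt0.
pose Ax j t := chi_mul t0 t1 t (along (gradx (coord_fun phi j)) t).
pose Fx t := chi_mul t0 t1 t (along (gradx f) t).
pose Ay j t := chi_mul t0 t1 t (along (grady (coord_fun phi j)) t).
pose Fy t := chi_mul t0 t1 t (along (grady f) t).
have pC j := C1_on_tube_coord j phiC.
have Axr j : regulated (Ax j) by apply: along_regulated; exact: gradx_within.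
have Fxr : regulated Fx by apply: along_regulated; exact: gradx_within.
have Ayr j : regulated (Ay j) by apply: along_regulated; exact: grady_within.
have Fyr : regulated Fy by apply: along_regulated; exact: grady_within.
have [Mx Mx0 MxP] : exists2 M, 0 <= M & forall j t, `|Ax j t| <= M.
  have /choice[M MP] : forall j, exists M, 0 <= M /\ forall t, `|Ax j t| <= M.
    move=> j; have [M M0 MP] := along_bounded (gradx_within (pC j)).
    by exists M; split => // t; apply: norm_chi_mul_le => //; exact: MP.
  exists (\sum_j M j); first by apply: sumr_ge0 => j _; exact: (MP j).1.
  move=> j t; rewrite (le_trans ((MP j).2 t))// (bigD1 j)//= lerDl.
  by apply: sumr_ge0 => k _; exact: (MP k).1.
have [My My0 MyP] : exists2 M, 0 <= M & forall j t, `|Ay j t| <= M.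
  have /choice[M MP] : forall j, exists M, 0 <= M /\ forall t, `|Ay j t| <= M.
    move=> j; have [M M0 MP] := along_bounded (grady_within (pC j)).
    by exists M; split => // t; apply: norm_chi_mul_le => //; exact: MP.
  exists (\sum_j M j); first by apply: sumr_ge0 => j _; exact: (MP j).1.
  move=> j t; rewrite (le_trans ((MP j).2 t))// (bigD1 j)//= lerDl.
  by apply: sumr_ge0 => k _; exact: (MP k).1.
pose gx (r : R) (a : 'rV[R]_n) i := \sum_j a 0 j * Ax j (- r) 0 i - Fx (- r) 0 i.
pose gy (r : R) (b : 'rV[R]_n) i := \sum_j b 0 j * Ay j (- r + delta) 0 i - Fy (- r + delta) 0 i.
(* The outer cut-off removes times [- r] below [t0]; the one inside [Ay] and [Fy] removes those
   above [t1 - delta]. *)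
pose G (r : R) (a b : 'rV[R]_n) : 'rV[R]_n := \row_i (gx r a i + chi_mul t0 t1 (- r) (gy r b i)).
have Gr (x y : R -> 'rV[R]_n) : continuous x -> continuous y -> regulated (fun t => G t (x t) (y t)).
  move=> xc yc; apply: regulated_row => i; rewrite (_ : (fun t => _) =
    (fun t => gx t (x t) i + chi_mul t0 t1 (- t) (gy t (y t) i))); last by apply/funext => t; rewrite mxE.
  apply: regulatedD.
    apply: regulatedB.
      apply: regulated_sum => j; apply: regulatedM.
        by apply: regulated_coord; exact: regulated_continuous.
      by apply: regulated_coord; exact: (regulated_reverse (Axr j)).
    by apply: regulated_coord; exact: (regulated_reverse Fxr).
  have hy : regulated (fun t => gy (- t) (y (- t)) i).
    apply: regulatedB.
      apply: regulated_sum => j; apply: regulatedM.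
        by apply: regulated_coord; apply: (regulated_reverse (regulated_continuous yc)).
      have := regulated_coord i (regulated_shift delta (Ayr j)).
      by congr regulated; apply/funext => t; rewrite opprK.
    have := regulated_coord i (regulated_shift delta Fyr).
    by congr regulated; apply/funext => t; rewrite opprK.
  have := regulated_reverse (regulated_chi_mul t0 t1 hy).
  by congr regulated; apply/funext => t; rewrite opprK.
have sumB (B : 'I_n -> 'rV[R]_n) M i (x x' : 'rV[R]_n) : 0 <= M -> (forall j, `|B j| <= M) ->
    `|\sum_j x 0 j * B j 0 i - \sum_j x' 0 j * B j 0 i| <= n%:R * M * `|x - x'|.
  move=> M0 BM; rewrite -sumrB (le_trans (ler_norm_sum _ _ _))//.
  have -> : n%:R * M * `|x - x'| = \sum_(j < n) M * `|x - x'|.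
    by rewrite sumr_const card_ord -mulrA mulr_natl.
  apply: ler_sum => j _; rewrite -mulrBl mulrC normrM ler_pM//.
    by rewrite (le_trans (norm_coord_le _ _)).
  by have := norm_coord_le (x - x') j; rewrite !mxE.
have GL r x y x' y' : `|G r x y - G r x' y'| <= n%:R * (Mx + My) * (`|x - x'| + `|y - y'|).
  have nMx : 0 <= n%:R * Mx by rewrite mulr_ge0.
  have nMy : 0 <= n%:R * My by rewrite mulr_ge0.
  apply: norm_row_le; first by rewrite !mulr_ge0// addr_ge0.
  move=> i; rewrite !mxE opprD addrACA (le_trans (ler_normD _ _))//.
  have h1 : `|gx r x i - gx r x' i| <= n%:R * Mx * `|x - x'|.
    rewrite /gx opprB addrA subrK; exact: sumB.
  have h2 : `|chi_mul t0 t1 (- r) (gy r y i) - chi_mul t0 t1 (- r) (gy r y' i)| <= n%:R * My * `|y - y'|.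
    rewrite /chi_mul; case: ifP => _; last by rewrite subrr normr0 mulr_ge0.
    by rewrite /gy opprB addrA subrK; exact: sumB.
  rewrite (le_trans (lerD h1 h2))// !mulrDr !mulrDl.
  have := normr_ge0 (x - x'); have := normr_ge0 (y - y'); nra.
have cc : continuous (fun _ : R => c) by move=> ?; exact: cvg_cst.
(* In reversed time the right-hand side vanishes after [- t0], so its primitives are bounded. *)
have [D D0 DP] : exists2 D, 0 <= D & forall t i, `|primitive (- t1) (fun r => G r c c 0 i) t| <= D.
  have /choice[D DP] : forall i, exists D, 0 <= D /\ forall t, `|primitive (- t1) (fun r => G r c c 0 i) t| <= D.
    move=> i; have Gi := regulated_coord i (Gr _ _ cc cc).
    have G0 t : - t0 < t -> G t c c 0 i = 0.
      move=> tt; have tn : ~~ (t0 <= - t <= t1) by rewrite negb_and -!ltNge; apply/orP; left; lra.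
      rewrite mxE chi_mul_out// addr0 /gx /Fx chi_mul_out// mxE subr0 big1// => j _.
      by rewrite /Ax chi_mul_out// mxE mulr0.
    by have [D D0 DP] := primitive_bounded (- t1) Gi G0; exists D.
  exists (\sum_i D i); first by apply: sumr_ge0 => j _; exact: (DP j).1.
  move=> t i; rewrite (le_trans ((DP i).2 t))// (bigD1 i)//= lerDl.
  by apply: sumr_ge0 => k _; exact: (DP k).1.
have [q [qc qt1 [s qd] _]] := delay_ode_solution (ltW delta_gt0)
  (mulr_ge0 (ler0n R n) (addr_ge0 Mx0 My0)) D0 Gr GL DP.
exists (fun t => q (- t)); split.
- move=> t; apply: (@continuous_comp _ _ _ -%R q); last exact: qc.
  exact: opp_continuous.
- exact: qt1.
exists [seq - t | t <- s] => t /andP[t0t tt1] ts.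
have qdt : is_derive (- t) 1 q (G (- t) (q (- t)) (q (- t - delta))).
  apply: qd; first by lra.
  by apply: contra ts => ts; apply/mapP; exists (- t) => //; rewrite opprK.
apply/is_derive_rowP => i.
have /is_derive_rowP/(_ i) qdi := qdt.
have oppd : is_derive t 1 (-%R : R -> R) (- 1) by exact: is_deriveN.
have := is_derive1_comp qdi oppd.
rewrite mulrN1 => /is_derive_eq; apply.
have hx a : gx (- t) a i = adjoint_row gradx t a 0 i.
  rewrite /gx mxE opprK /Fx chi_mul_in ?(ltW t0t) ?(ltW tt1)//; congr (_ - _).
  by apply: eq_bigr => j _; rewrite /Ax chi_mul_in ?(ltW t0t) ?(ltW tt1).
have hy a : chi_mul t0 t1 (- - t) (gy (- t) a i) =
    chi_mul t0 (t1 - delta) t (adjoint_row grady (t + delta) a 0 i).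
  rewrite /gy mxE opprK chi_mul_in ?(ltW t0t) ?(ltW tt1)//.
  have [le|lt] := leP t (t1 - delta).
    have tt : t0 <= t + delta <= t1 by lra.
    rewrite [RHS]chi_mul_in ?(ltW t0t)// /Fy chi_mul_in//; congr (_ - _).
    by apply: eq_bigr => j _; rewrite /Ay chi_mul_in.
  have tt : ~~ (t0 <= t + delta <= t1) by rewrite negb_and -!ltNge; apply/orP; right; lra.
  rewrite [RHS]chi_mul_out; last by rewrite negb_and -!ltNge lt orbT.
  rewrite /Fy chi_mul_out// mxE subr0 big1// => j _.
  by rewrite /Ay chi_mul_out// mxE mulr0.
rewrite [in LHS]mxE hx hy opprD [in RHS]mxE [in X in _ = _ + X]mxE chi_mul_coord.
rewrite [in X in _ = X + _]mxE.
by rewrite (_ : - (t + delta) = - t - delta) ?opprD.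
Qed.

End Trajectory.

(** * Needle variations *)



Section Perturbation.
Context {R : realType} {n m : nat} (t0 t1 delta gamma : R).
Context (phi : delay_fun R n m 'rV[R]_n).
Context (X : R -> 'rV[R]_n) (w : R -> 'rV[R]_m).
Context (t01 : t0 < t1) (delta_gt0 : 0 < delta) (gamma_gt0 : 0 < gamma).
Context (Xc : continuous X) (wr : regulated w).
Context (phiC : C1_on_tube t0 t1 delta gamma X phi).

Definition needle_control (tau lam : R) (v : 'rV[R]_m) (t : R) : 'rV[R]_m :=
  if t \in `[tau, tau + lam[ then v else w t.

Lemma needle_control_regulated tau lam v : regulated (needle_control tau lam v).
Proof. by apply: regulated_ite_itv => //; exact: regulated_cst. Qed.

Lemma norm_needle_control_le tau lam v (r t : R) :
  `|v| <= r -> `|w t| <= r -> `|needle_control tau lam v t| <= r.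
Proof. by rewrite /needle_control; case: ifP. Qed.

(** The equation is solved for the deviation [xi], which starts from zero. At [xi = 0] its
    right-hand side lives on two intervals of length [lam], so the first iterate is O(lam) and the
    estimate of [delay_ode_solution] passes this on to [xi]. The constant is uniform in [tau], [lam]
    and all [v] with [|v| <= r]. *)
Lemma perturbed_trajectory (rho r : R) : 0 <= rho -> rho < gamma ->
  (forall t, t0 - delta <= t <= t1 -> `|w t| <= r) ->
  exists2 C, 0 <= C & forall (tau lam : R) (v : 'rV[R]_m), t0 <= tau -> 0 <= lam -> `|v| <= r -> C * lam <= rho ->
    exists xi : R -> 'rV[R]_n,
    [/\ continuous xi, forall t, t <= t0 -> xi t = 0,
        forall t, t <= t1 -> `|xi t| <= C * lam
      & exists s : seq R, forall t, t0 < t < t1 -> t \notin s ->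
          is_derive t 1 xi (phi t (X t + xi t) (X (t - delta) + xi (t - delta))
              (needle_control tau lam v t) (needle_control tau lam v (t - delta))
            - along delta X w phi t)].
Proof.
move=> rho0 rg wR; have d0 := delta_gt0.
have pC j := C1_on_tube_coord j phiC.
have /choice[L LP] : forall j, exists L, 0 <= L /\ forall (t : R) (a a' b b' : 'rV[R]_n) (u v : 'rV[R]_m),
    t0 <= t <= t1 -> `|a| <= rho -> `|a'| <= rho -> `|b| <= rho -> `|b'| <= rho -> `|u| <= r -> `|v| <= r ->
    `|coord_fun phi j t (X t + a) (X (t - delta) + b) u v - coord_fun phi j t (X t + a') (X (t - delta) + b') u v|
      <= L * (`|a - a'| + `|b - b'|).
  by move=> j; have [L L0 LP] := tube_lipschitz Xc (pC j) r rg; exists L.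
have /choice[M MP] : forall j, exists M, 0 <= M /\ forall (t : R) (a b : 'rV[R]_n) (u v : 'rV[R]_m),
    t0 <= t <= t1 -> `|a| <= rho -> `|b| <= rho -> `|u| <= r -> `|v| <= r ->
    `|coord_fun phi j t (X t + a) (X (t - delta) + b) u v| <= M.
  move=> j; have [pc _ _ _] := pC j.
  by have [M M0 MP] := tube_bounded Xc r pc rg; exists M.
have [Ls L0 LL] : exists2 Ls, 0 <= Ls & forall j, L j <= Ls.
  exists (\sum_j L j); first by apply: sumr_ge0 => j _; exact: (LP j).1.
  by move=> j; rewrite (bigD1 j)//= lerDl; apply: sumr_ge0 => k _; exact: (LP k).1.
(* Twice the bound, as the right-hand side at [xi = 0] is a difference of two values of [phi]. *)
have [Ms M0 MM] : exists2 Ms, 0 <= Ms & forall j, 2 * M j <= Ms.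
  exists (2 * \sum_j M j).
    by rewrite mulr_ge0//; apply: sumr_ge0 => j _; exact: (MP j).1.
  by move=> j; rewrite ler_pM2l// (bigD1 j)//= lerDl; apply: sumr_ge0 => k _; exact: (MP k).1.
(* This is [2 * D] times the weight at [t1], divided by [lam], with [D = 2 * Ms * lam] coming from
   the two intervals. *)
exists (4 * Ms * expR (4 * (Ls + 1) * (t1 - t0))); first by apply: mulr_ge0; [exact: mulr_ge0|exact: expR_ge0].
move=> tau lam v t0tau lam0 vr Clam.
pose wl := needle_control tau lam v.
have wlr : regulated wl by exact: needle_control_regulated.
have wlR t : t0 - delta <= t <= t1 -> `|wl t| <= r.
  by move=> tt; apply: norm_needle_control_le => //; exact: wR.
(* Truncating to the tube makes the right-hand side globally Lipschitz; it is the
   original one as long as [xi] stays in the tube. *)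
pose cl := @clamp_vec R n rho.
pose g i t (a b : 'rV[R]_n) := coord_fun phi i t (X t + cl a) (X (t - delta) + cl b) (wl t) (wl (t - delta))
  - along delta X w (coord_fun phi i) t.
pose G t a b : 'rV[R]_n := \row_i chi_mul t0 t1 t (g i t a b).
have Xdc := @Xdelay_continuous _ _ delta _ Xc.
have cl0 : cl 0 = 0 by apply: clamp_vec_id; rewrite normr0.
have clr a : `|cl a| <= rho by exact: norm_clamp_vec.
have rng t : t0 <= t <= t1 -> (t0 - delta <= t <= t1) /\ (t0 - delta <= t - delta <= t1) by move=> ?; split; lra.
have Gr (x y : R -> 'rV[R]_n) : continuous x -> continuous y -> regulated (fun t => G t (x t) (y t)).
  move=> xc yc; apply: regulated_row => i; have [pc _ _ _] := pC i.
  have clc (z : R -> 'rV[R]_n) : continuous z -> continuous (fun t => cl (z t)).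
    by move=> zc t; apply: (@continuous_comp _ _ _ z cl); [exact: zc|exact: clamp_vec_continuous].
  have h1 : regulated (fun t => chi_mul t0 t1 t (coord_fun phi i t (X t + cl (x t)) (X (t - delta) + cl (y t)) (wl t) (wl (t - delta)))).
    apply: (cut_regulated (x := fun t => X t + cl (x t)) (y := fun t => X (t - delta) + cl (y t)) (ltW t01) pc).
    - by move=> t; apply: cvgD; [exact: Xc|exact: clc].
    - by move=> t; apply: cvgD; [exact: Xdc|exact: clc].
    - by move=> t _; rewrite addrC addKr (le_lt_trans (clr _)).
    - by move=> t _; rewrite addrC addKr (le_lt_trans (clr _)).
    - exact: wlr.
    - exact: regulated_shift.
  have h2 := along_regulated t01 gamma_gt0 Xc wr pc.
  have := regulatedB h1 h2; congr regulated; apply/funext => t.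
  by rewrite mxE /chi_mul; case: ifP; rewrite ?subr0.
have GL t x y x' y' : `|G t x y - G t x' y'| <= Ls * (`|x - x'| + `|y - y'|).
  have nn : 0 <= `|x - x'| + `|y - y'| by rewrite addr_ge0.
  apply: norm_row_le; first by rewrite mulr_ge0.
  move=> i; rewrite !mxE /chi_mul in_itv/=; case: ifP => [tt|_]; last by rewrite subrr normr0 mulr_ge0.
  have [r1 r2] := rng _ tt.
  rewrite /g opprB addrA subrK (le_trans ((LP i).2 t _ _ _ _ _ _ tt _ _ _ _ (wlR _ r1) (wlR _ r2)))//.
  have q : `|cl x - cl x'| + `|cl y - cl y'| <= `|x - x'| + `|y - y'|.
    by apply: lerD; exact: clamp_vec_lipschitz.
  by apply: ler_pM => //; exact: (LP i).1.
(* Majorant of the right-hand side at [xi = 0]: the needle and its echo through the delayed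
   control. *)
pose N t := needle tau (tau + lam) (fun=> Ms) t + needle (tau + delta) (tau + delta + lam) (fun=> Ms) t.
have n1 := regulated_needle tau (tau + lam) (@regulated_cst R _ Ms).
have n2 := regulated_needle (tau + delta) (tau + delta + lam) (@regulated_cst R _ Ms).
have GN i t : `|G t 0 0 0 i| <= N t.
  have nge c d : 0 <= needle c d (fun=> Ms) t by rewrite /needle; case: ifP.
  have N0 : 0 <= N t by rewrite addr_ge0.
  rewrite mxE; apply: norm_chi_mul_le => // tt.
  have [r1 r2] := rng _ tt.
  rewrite /g cl0 !addr0.
  have z0 : `|0 : 'rV[R]_n| <= rho by rewrite normr0.
  have big : `|coord_fun phi i t (X t) (X (t - delta)) (wl t) (wl (t - delta)) - along delta X w (coord_fun phi i) t| <= Ms.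
    have h1 := (MP i).2 t 0 0 _ _ tt z0 z0 (wlR _ r1) (wlR _ r2).
    have h2 := (MP i).2 t 0 0 _ _ tt z0 z0 (wR _ r1) (wR _ r2).
    rewrite !addr0 in h1 h2; rewrite (le_trans (ler_normB _ _))// (le_trans (lerD h1 h2))//.
    by rewrite (le_trans _ (MM i))// mulr_natl mulr2n.
  have [i1|i1] := boolP (t \in `[tau, tau + lam[).
    by rewrite (le_trans big)// /N {1}/needle i1 lerDl.
  have [i2|i2] := boolP (t \in `[tau + delta, tau + delta + lam[).
    by rewrite (le_trans big)// /N {2}/needle i2 lerDr.
  rewrite /along /wl /needle_control (negbTE i1).
  have -> : (t - delta \in `[tau, tau + lam[) = false.
    apply/negbTE; apply: contra i2; rewrite !in_itv/=; lra.
  by rewrite subrr normr0.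
have D0 : 0 <= 2 * Ms * lam by rewrite !mulr_ge0.
have c0 : continuous (fun _ : R => 0 : 'rV[R]_n) by move=> ?; exact: cvg_cst.
have DP t i : `|primitive t0 (fun r => G r 0 0 0 i) t| <= 2 * Ms * lam.
  have Gi := regulated_coord i (Gr _ _ c0 c0).
  rewrite (le_trans (primitive_le t0 t Gi (regulatedD n1 n2) (GN i)))//.
  rewrite primitiveD//.
  have h1 := @primitive_needle_cst R t0 tau (tau + lam) Ms t t0tau _ M0.
  have h2 := @primitive_needle_cst R t0 (tau + delta) (tau + delta + lam) Ms t _ _ M0.
  have e1 : tau + lam - tau = lam by lra.
  have e2 : tau + delta + lam - (tau + delta) = lam by lra.
  rewrite e1 in h1; rewrite e2 in h2.
  rewrite (_ : 2 * Ms * lam = Ms * lam + Ms * lam); last by ring.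
  by apply: lerD; [apply: h1|apply: h2]; lra.
have [xi [xic xi0 [s xid] xib]] := delay_ode_solution (ltW delta_gt0) L0 D0 Gr GL DP.
have xiC t : t <= t1 -> `|xi t| <= 4 * Ms * expR (4 * (Ls + 1) * (t1 - t0)) * lam.
  move=> tt1; have [tt0|/ltW t0t] := leP t t0.
    rewrite xi0// normr0; apply: mulr_ge0 => //.
    by apply: mulr_ge0; [exact: mulr_ge0|exact: expR_ge0].
  have := xib _ t0t; rewrite subr0 => /le_trans; apply.
  rewrite (_ : 2 * (2 * Ms * lam) = 4 * Ms * lam); last by ring.
  rewrite [leRHS]mulrAC ler_wpM2l ?mulr_ge0// ler_expR ler_wpM2l ?mulr_ge0 ?addr_ge0//.
  by rewrite lerB.
exists xi; split=> //.
exists s => t /andP[t0t tt1] ts.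
have := xid t t0t ts; congr is_derive; apply/rowP => i.
rewrite !mxE chi_mul_in ?(ltW t0t) ?(ltW tt1)// /g /cl !clamp_vec_id//.
  by rewrite (le_trans (xiC _ _))//; lra.
by rewrite (le_trans (xiC _ _))//; lra.
Qed.

End Perturbation.

(** * The increment of the Pontryagin function *)



Lemma primitive_zero_on {R : realType} (a c d : R) (g : R -> R) : regulated g -> a <= c -> c <= d ->
  (forall t, c < t < d -> g t = 0) -> primitive a g d = primitive a g c.
Proof.
move=> gr ac cd g0; apply/eqP; rewrite -subr_eq0; apply/eqP.
have z : continuous (fun _ : R => 0 : R) by move=> ?; exact: cvg_cst.
have := @primitive_eq_on _ a [::] _ (fun=> 0) _ _ gr z ac cd; rewrite subrr; apply.
by move=> t tt _; rewrite g0//; exact: is_derive_cst.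
Qed.

Lemma is_derive_dotp {R : realType} {n : nat} (p x : R -> 'rV[R]_n) (dp dx : 'rV[R]_n) (t : R) :
  is_derive t 1 p dp -> is_derive t 1 x dx ->
  is_derive t 1 (fun r => dotp (p r) (x r)) (dotp dp (x t) + dotp (p t) dx).
Proof.
move=> /is_derive_rowP pd /is_derive_rowP xd.
rewrite (_ : (fun r => _) = \sum_(i < n) (fun r => p r 0 i * x r 0 i)); last first.
  by apply/funext => r; rewrite fct_sumE.
have pxd i : is_derive t 1 (fun r => p r 0 i * x r 0 i) (dp 0 i * x t 0 i + p t 0 i * dx 0 i).
  have ? := pd i; have ? := xd i.
  rewrite (_ : (fun r => _) = (fun r => p r 0 i) * (fun r => x r 0 i))//.
  by apply: is_derive_eq; rewrite addrC /GRing.scale/= [dp 0 i * _]mulrC.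
rewrite /dotp -big_split/=; exact: is_derive_sum.
Qed.

Lemma differentiable_remainder {R : realType} {n : nat} (S : 'rV[R]_n -> R) z (e : R) :
  differentiable S z -> 0 < e ->
  exists2 d, 0 < d & forall a, `|a| <= d -> `|S (z + a) - S z - dotp a (gradient S z)| <= e * `|a|.
Proof.
move=> Sz e0; have /diff_locallyP[_ /eqaddoP/(_ _ e0) h] := Sz.
have /nbhs_ballP[d /= d0 dP] := h.
exists (d / 2); first by rewrite divr_gt0.
move=> a ad; have := dP a; rewrite -ball_normE /= sub0r normrN.
rewrite !fctE /= [a + z]addrC -deriveE// derive_gradient// opprD addrA; apply.
by rewrite (le_lt_trans ad)// ltr_pdivrMr// ltr_pMr// ltr1n.
Qed.

Section Maximum.
Context {R : realType} {n m : nat} (t0 t1 delta gamma : R).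
Context (f : delay_fun R n m R) (phi : delay_fun R n m 'rV[R]_n).
Context (X : R -> 'rV[R]_n) (w : R -> 'rV[R]_m).
Context (t01 : t0 < t1) (delta_gt0 : 0 < delta) (gamma_gt0 : 0 < gamma).
Context (Xc : continuous X) (wr : regulated w).
Context (fC : C1_on_tube t0 t1 delta gamma X f).
Context (phiC : C1_on_tube t0 t1 delta gamma X phi).
Context (p : R -> 'rV[R]_n) (pc : continuous p) (sp : seq R).
Context (pd : forall t, t0 < t < t1 -> t \notin sp ->
    is_derive t 1 p (- adjoint_row delta f phi X w gradx t (p t)
      - chi_mul t0 (t1 - delta) t (adjoint_row delta f phi X w grady (t + delta) (p (t + delta))))).

Let H t x y u v := pontryagin f phi t x y u v (p t).
Let Hx t := adjoint_row delta f phi X w gradx t (p t).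
Let Hy t := adjoint_row delta f phi X w grady t (p t).

Lemma pontryaginE t x y u v :
  H t x y u v = \sum_j p t 0 j * coord_fun phi j t x y u v - f t x y u v.
Proof. by []. Qed.

Lemma chi_pontryagin (x y : R -> 'rV[R]_n) (u v : R -> 'rV[R]_m) :
  (fun t => chi_mul t0 t1 t (H t (x t) (y t) (u t) (v t))) =
  (fun t => \sum_j p t 0 j * chi_mul t0 t1 t (coord_fun phi j t (x t) (y t) (u t) (v t))
     - chi_mul t0 t1 t (f t (x t) (y t) (u t) (v t))).
Proof.
apply/funext => t; rewrite /chi_mul; case: ifP => // _.
by rewrite subr0 big1// => j _; rewrite mulr0.
Qed.

Lemma pontryagin_regulated (x y : R -> 'rV[R]_n) (u v : R -> 'rV[R]_m) :
  continuous x -> continuous y ->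
  (forall t, t0 <= t <= t1 -> `|x t - X t| < gamma) ->
  (forall t, t0 <= t <= t1 -> `|y t - X (t - delta)| < gamma) ->
  regulated u -> regulated v ->
  regulated (fun t => chi_mul t0 t1 t (H t (x t) (y t) (u t) (v t))).
Proof.
move=> xc yc xX yX ur vr; rewrite chi_pontryagin.
have [fc _ _ _] := fC.
apply: regulatedB; last exact: (cut_regulated (ltW t01) fc).
apply: regulated_sum => j; apply: regulatedM.
  by apply: regulated_coord; exact: regulated_continuous.
have [pjc _ _ _] := C1_on_tube_coord j phiC.
exact: (cut_regulated (ltW t01) pjc).
Qed.

Lemma cut_continuous {V : normedModType R} (F : delay_fun R n m V)
    (u v : R -> 'rV[R]_m) t :
  {within tube t0 t1 delta gamma X, continuous (uncurry5 F)} ->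
  t != t0 -> t != t1 -> {for t, continuous u} -> {for t, continuous v} ->
  {for t, continuous (fun t => chi_mul t0 t1 t (F t (X t) (X (t - delta)) (u t) (v t)))}.
Proof.
move=> Fc tn0 tn1 uc vc.
have nearchi : \forall r \near t, (t0 <= r <= t1) = (t0 <= t <= t1).
  near=> r; have r1 : r != t1 by near: r; exact: near_neq.
  rewrite !(leNgt t0) (near (near_ltE tn0) r)// !(le_eqVlt _ t1) (negbTE r1) (negbTE tn1)/=.
  by rewrite (near (near_ltE tn1) r).
have [tt|ntt] := boolP (t0 <= t <= t1); last first.
  rewrite /prop_for /continuous_at; apply: cvg_near_cst; near=> r.
  by rewrite !chi_mul_out ?(near nearchi r).
have := @tube_cvg _ _ _ t0 t1 delta gamma X (ltW t01) _ F Fc X (fun t => X (t - delta)) Xc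
  (Xdelay_continuous Xc) _ _ (nbhs t) _ t u v (u t) (v t) (@cvg_id _ _) uc vc.
rewrite !(clamp_itv_id tt) => h.
rewrite /prop_for /continuous_at chi_mul_in//.
apply: (@cvg_trans _ (F (clamp_itv t0 t1 r) (X (clamp_itv t0 t1 r)) (X (clamp_itv t0 t1 r - delta)) (u r) (v r) @[r --> t])).
  apply: near_eq_cvg; near=> r.
  have rr : t0 <= r <= t1 by rewrite (near nearchi r).
  by rewrite chi_mul_in// clamp_itv_id.
by apply: h => r _; exact: norm_subrr_lt.
Unshelve. all: by end_near. Qed.

Lemma pontryagin_continuous (u v : R -> 'rV[R]_m) t :
  t != t0 -> t != t1 -> {for t, continuous u} -> {for t, continuous v} ->
  {for t, continuous (fun t => chi_mul t0 t1 t (H t (X t) (X (t - delta)) (u t) (v t)))}.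
Proof.
move=> tn0 tn1 uc vc; rewrite chi_pontryagin; have [fc _ _ _] := fC.
apply: continuousB; last exact: cut_continuous.
rewrite (_ : (fun t => _) = \sum_j (fun t => p t 0 j * chi_mul t0 t1 t (coord_fun phi j t (X t) (X (t - delta)) (u t) (v t)))); last first.
  by apply/funext => r; rewrite fct_sumE.
apply: (big_ind (fun g : R -> R => {for t, continuous g})).
- exact: cvg_cst.
- by move=> g h gc hc; exact: continuousD.
move=> j _; apply: continuousM.
  exact: (continuous_comp (@pc t) (@coord_continuous _ _ _ 0 j _)).
have [pjc _ _ _] := C1_on_tube_coord j phiC.
exact: cut_continuous.
Qed.

Lemma adjoint_row_regulated D :
  (forall g, C1_on_tube t0 t1 delta gamma X g -> {within tube t0 t1 delta gamma X, continuous (uncurry5 (D g))}) ->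
  regulated (fun t => chi_mul t0 t1 t (adjoint_row delta f phi X w D t (p t))).
Proof.
move=> Dc; apply: regulated_row => i.
rewrite (_ : (fun t => _) = (fun t => \sum_j p t 0 j * (chi_mul t0 t1 t (along delta X w (D (coord_fun phi j)) t)) 0 i
  - (chi_mul t0 t1 t (along delta X w (D f) t)) 0 i)); last first.
  apply/funext => t; rewrite !chi_mul_coord !mxE; under [in RHS]eq_bigr do rewrite chi_mul_coord.
  by rewrite /chi_mul; case: ifP => // _; rewrite subr0 big1// => j _; rewrite mulr0.
have ar g := along_regulated t01 gamma_gt0 Xc wr g.
apply: regulatedB; last by apply: regulated_coord; apply: ar; exact: Dc.
apply: regulated_sum => j; apply: regulatedM.
  by apply: regulated_coord; exact: regulated_continuous.
by apply: regulated_coord; apply: ar; apply: Dc; exact: C1_on_tube_coord.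
Qed.

Lemma dotp_regulated (x y : R -> 'rV[R]_n) : regulated x -> regulated y ->
  regulated (fun t => dotp (x t) (y t)).
Proof.
by move=> xr yr; apply: regulated_sum => j; apply: regulatedM; exact: regulated_coord.
Qed.

Lemma dotp_chi_mul (a b t : R) (x y : 'rV[R]_n) :
  dotp x (chi_mul a b t y) = chi_mul a b t (dotp x y).
Proof.
by rewrite /chi_mul; case: ifP => // _; rewrite /dotp big1// => i _; rewrite mxE mulr0.
Qed.

Section OneNeedle.
Context (xi : R -> 'rV[R]_n) (wl : R -> 'rV[R]_m) (xis : seq R).
Context (xic : continuous xi) (xi0 : forall t, t <= t0 -> xi t = 0) (wlr : regulated wl).
Context (xig : forall t, t <= t1 -> `|xi t| < gamma).
Context (xid : forall t, t0 < t < t1 -> t \notin xis ->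
  is_derive t 1 xi (phi t (X t + xi t) (X (t - delta) + xi (t - delta)) (wl t) (wl (t - delta))
            - along delta X w phi t)).

Let x t := X t + xi t.
Let y t := X (t - delta) + xi (t - delta).

(** The linear terms use gradients along [w], while the difference is taken with the control [wl].
    This matches the adjoint equation, at the price of a remainder that is small to first order only
    where [wl] agrees with [w] at [t] and [t - delta]. *)
Definition state_remainder t := chi_mul t0 t1 t
  (H t (x t) (y t) (wl t) (wl (t - delta)) - H t (X t) (X (t - delta)) (wl t) (wl (t - delta))
   - dotp (xi t) (Hx t) - dotp (xi (t - delta)) (Hy t)).

Definition control_increment t := chi_mul t0 t1 t
  (H t (X t) (X (t - delta)) (wl t) (wl (t - delta))
   - H t (X t) (X (t - delta)) (w t) (w (t - delta))).

Definition cost_increment t := chi_mul t0 t1 t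
  (f t (x t) (y t) (wl t) (wl (t - delta)) - along delta X w f t).

Lemma xidelay_continuous : continuous (fun t => xi (t - delta)).
Proof. exact: (Xdelay_continuous (delta := delta) xic). Qed.

Lemma x_near t : t0 <= t <= t1 -> `|x t - X t| < gamma.
Proof. by move=> /andP[_ tt]; rewrite /x addrC addKr xig. Qed.

Lemma y_near t : t0 <= t <= t1 -> `|y t - X (t - delta)| < gamma.
Proof. by move=> /andP[_ tt]; rewrite /y addrC addKr xig//; have := delta_gt0; lra. Qed.

Lemma x_continuous : continuous x.
Proof. by move=> t; apply: cvgD; [exact: Xc|exact: xic]. Qed.

Lemma y_continuous : continuous y.
Proof. by move=> t; apply: cvgD; [exact: (Xdelay_continuous Xc)|exact: xidelay_continuous]. Qed.

Lemma state_remainder_regulated : regulated state_remainder.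
Proof.
have X0 t : t0 <= t <= t1 -> `|X t - X t| < gamma by move=> _; exact: norm_subrr_lt.
have Y0 t : t0 <= t <= t1 -> `|X (t - delta) - X (t - delta)| < gamma by move=> _; exact: norm_subrr_lt.
have wldr := regulated_shift (- delta) wlr.
have h1 := pontryagin_regulated x_continuous y_continuous x_near y_near wlr wldr.
have h2 := pontryagin_regulated Xc (Xdelay_continuous Xc) X0 Y0 wlr wldr.
have h3 := dotp_regulated (regulated_continuous xic) (adjoint_row_regulated (@gradx_within R n m t0 t1 delta gamma X)).
have h4 := dotp_regulated (regulated_continuous xidelay_continuous) (adjoint_row_regulated (@grady_within R n m t0 t1 delta gamma X)).
have := regulatedB (regulatedB (regulatedB h1 h2) h3) h4.
by congr regulated; apply/funext => t; rewrite !dotp_chi_mul /state_remainder /chi_mul; case: ifP; rewrite ?subr0.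
Qed.

Lemma control_increment_regulated : regulated control_increment.
Proof.
have X0 t : t0 <= t <= t1 -> `|X t - X t| < gamma by move=> _; exact: norm_subrr_lt.
have Y0 t : t0 <= t <= t1 -> `|X (t - delta) - X (t - delta)| < gamma by move=> _; exact: norm_subrr_lt.
have h2 := pontryagin_regulated Xc (Xdelay_continuous Xc) X0 Y0 wlr (regulated_shift (- delta) wlr).
have h1 := pontryagin_regulated Xc (Xdelay_continuous Xc) X0 Y0 wr (regulated_shift (- delta) wr).
have := regulatedB h2 h1.
by congr regulated; apply/funext => t; rewrite /control_increment /chi_mul; case: ifP; rewrite ?subr0.
Qed.

Lemma cost_increment_regulated : regulated cost_increment.
Proof.
have [fc _ _ _] := fC.
have h1 := cut_regulated (ltW t01) fc x_continuous y_continuous x_near y_near wlr (regulated_shift (- delta) wlr).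
have h2 := along_regulated t01 gamma_gt0 Xc wr fc.
have := regulatedB h1 h2.
by congr regulated; apply/funext => t; rewrite /cost_increment /chi_mul; case: ifP; rewrite ?subr0.
Qed.

(* The delayed term of the adjoint equation is absorbed by the window integral
   of <H_y[s], xi(s - delta)> over s in [t, t + delta]. *)
Lemma increment_identity :
  Rintegral lebesgue_measure `[t0, t1] state_remainder +
  Rintegral lebesgue_measure `[t0, t1] control_increment +
  Rintegral lebesgue_measure `[t0, t1] cost_increment = dotp (p t1) (xi t1).
Proof.
have d0 := delta_gt0.
have sr := state_remainder_regulated; have cr := control_increment_regulated.
have fr := cost_increment_regulated.
pose k t := dotp (xi (t - delta)) (chi_mul t0 t1 t (Hy t)).
have kr : regulated k.
  exact: (dotp_regulated (regulated_continuous xidelay_continuous) (adjoint_row_regulated (@grady_within R n m t0 t1 delta gamma X))).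
have [sk [kc _]] := kr.
pose K := primitive t0 k.
have Kc : continuous K by exact: primitive_continuous.
pose Kd t := K (t + delta).
have Kdc : continuous Kd.
  move=> t; apply: (@continuous_comp _ _ _ (fun t => t + delta) K); last exact: Kc.
  by apply: cvgD; [exact: cvg_id|exact: cvg_cst].
pose px t := dotp (p t) (xi t).
have pxc : continuous px.
  move=> t; rewrite /px (_ : (fun t => _) = \sum_i (fun t => p t 0 i * xi t 0 i)); last first.
    by apply/funext => r; rewrite fct_sumE.
  apply: (big_ind (fun g : R -> R => {for t, continuous g})).
  - exact: cvg_cst.
  - by move=> g h gc hc; exact: continuousD.
  move=> j _; apply: continuousM.
    exact: (continuous_comp (@pc t) (@coord_continuous _ _ _ 0 j _)).
  exact: (continuous_comp (@xic t) (@coord_continuous _ _ _ 0 j _)).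
(* The window term has derivative [k (t + delta) - k t]: the first part cancels the advanced term of
   the adjoint equation, the second supplies the term [- <xi(t - delta), H_y[t]>] of the
   remainder. *)
pose W := px + (Kd - K).
have Wc : continuous W.
  by move=> t; apply: continuousD; [exact: pxc|apply: continuousB; [exact: Kdc|exact: Kc]].
pose G t := state_remainder t + control_increment t + cost_increment t.
have Gr : regulated G by apply: regulatedD => //; exact: regulatedD.
pose s := sp ++ xis ++ sk ++ [seq t - delta | t <- sk].
have Wd t : t0 < t < t1 -> t \notin s -> is_derive t 1 W (G t).
  move=> /andP[t0t tt1]; rewrite !mem_cat !negb_or => /and4P[tsp txi tsk tskd].
  have tt : t0 < t < t1 by rewrite t0t.
  have ttc : t0 <= t <= t1 by rewrite !ltW.
  have h1 : is_derive t 1 px _ := is_derive_dotp (pd tt tsp) (xid tt txi).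
  have h2 : is_derive t 1 K (k t) by apply: primitive_derive => //; exact: kc.
  have h3 : is_derive t 1 Kd (k (t + delta)).
    have h3 : is_derive (t + delta) 1 K (k (t + delta)).
      apply: primitive_derive => //; first by lra.
      apply: kc; apply: contra tskd => tsk'; apply/mapP; exists (t + delta) => //.
      by rewrite addrK.
    have h4 : is_derive t 1 (fun t => t + delta) 1.
      rewrite (_ : (fun t => _) = id + cst delta)//.
      by apply: is_derive_eq; rewrite addr0.
    by have := @is_derive1_comp R K (fun r => r + delta) t _ 1 h3 h4; rewrite mulr1.
  have := is_deriveD h1 (is_deriveB h3 h2).
  rewrite -/W; congr is_derive.
  rewrite /G /state_remainder /control_increment /cost_increment !(chi_mul_in _ ttc).
  rewrite /k addrK dotp_chi_mul (chi_mul_in _ ttc).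
  have -> : chi_mul t0 t1 (t + delta) (dotp (xi t) (Hy (t + delta))) =
      dotp (chi_mul t0 (t1 - delta) t (Hy (t + delta))) (xi t).
    rewrite [RHS]dotpC dotp_chi_mul.
    by apply: chi_mul_shift; exact: ltW.
  rewrite -/(Hx t) -/(Hy _) /H /pontryagin /along -/(x t) -/(y t).
  rewrite dotpBr [dotp (- _ - _) _]dotpC dotpBr.
  rewrite (_ : dotp (xi t) (- Hx t) = - dotp (xi t) (Hx t)); last first.
    by rewrite -[- Hx t]sub0r dotpBr /dotp big1 ?sub0r// => i _; rewrite mxE mulr0.
  rewrite [dotp (xi t) (chi_mul _ _ _ _)]dotpC.
  by lra.
have WE := Rintegral_regulated Gr Wc (ltW t01) Wd.
(* At [t1] the window lies beyond [t1], where [k] is cut off; at [t0] it sees [xi] only at times up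
   to [t0], where [xi] vanishes. *)
have W1 : W t1 = dotp (p t1) (xi t1).
  rewrite /W !fctE /px /Kd /K (@primitive_zero_on _ t0 t1 (t1 + delta) k) ?subrr ?addr0// ?(ltW t01)//; first by lra.
  move=> t /andP[t1t _]; rewrite /k dotp_chi_mul chi_mul_out//.
  by rewrite negb_and -!ltNge t1t orbT.
have W0 : W t0 = 0.
  rewrite /W !fctE /px xi0// /Kd /K (@primitive_zero_on _ t0 t0 (t0 + delta) k) ?subrr ?addr0//.
  - by rewrite /dotp big1// => i _; rewrite mxE mulr0.
  - by lra.
  - move=> t /andP[_ tt]; rewrite /k xi0; last by lra.
    by rewrite /dotp big1// => i _; rewrite mxE mul0r.
rewrite -RintegralD//; [|exact: regulated_integrable|exact: regulated_integrable].
rewrite -RintegralD//; [|apply: regulated_integrable; exact: regulatedD|exact: regulated_integrable].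
by rewrite WE W1 W0 subr0.
Qed.

End OneNeedle.
End Maximum.



(** * Limits of quotients by the needle length, and uniform bounds *)

Lemma difference_quotient_cvg {R : realType} (P : R -> R) (a l : R) (lam : nat -> R) :
  is_derive a 1 P l -> (forall k, 0 < lam k) -> lam k @[k --> \oo] --> 0 ->
  (P (a + lam k) - P a) / lam k @[k --> \oo] --> l.
Proof.
move=> [Pd Pl] lam0 laml.
have lamd : lam k @[k --> \oo] --> (0 : R)^'.
  move=> A A0; have A0' : \forall x \near (0 : R), x != 0 -> A x := A0.
  have h := laml _ A0'; have {h} : \forall k \near \oo, lam k != 0 -> A (lam k) := h.
  by apply: filterS => k; apply; rewrite gt_eqF.
have := cvg_comp _ _ lamd Pd; rewrite -/(derive P a 1) Pl.
apply: cvg_trans; apply: near_eq_cvg; apply: nearW => k /=.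
by rewrite [_ *: 1]mulr1 [lam k + a]addrC mulrC.
Qed.

Section Limits.
Context {R : realType} {n m : nat} (t0 t1 delta gamma : R).
Context (X : R -> 'rV[R]_n) (lam : nat -> R) (C : R).
Context (gamma_gt0 : 0 < gamma).
Context (lam0 : forall k, 0 < lam k) (laml : lam k @[k --> \oo] --> 0) (C0 : 0 <= C).

Lemma near_le_lam (d : R) : 0 < d -> \forall k \near \oo, C * lam k <= d.
Proof.
move=> d0; have : C * lam k @[k --> \oo] --> C * 0 by apply: cvgM => //; exact: cvg_cst.
rewrite mulr0 => /cvgrPdist_le/(_ _ d0); apply: filterS => k.
by rewrite sub0r normrN => /(le_trans (ler_norm _)).
Qed.

Lemma quotient_cvg0 (q : nat -> R) : (forall e, 0 < e -> \forall k \near \oo, `|q k| <= e * (C * lam k)) ->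
  q k / lam k @[k --> \oo] --> 0.
Proof.
move=> qe; apply/cvgrPdist_le => e e0.
have e'0 : 0 < e / (C + 1) by rewrite divr_gt0// ltr_wpDl.
near=> k; rewrite sub0r normrN normrM normfV (gtr0_norm (lam0 k)) ler_pdivrMr//.
have h : `|q k| <= e / (C + 1) * (C * lam k) by near: k; exact: qe.
rewrite (le_trans h)// mulrA ler_wpM2r ?(ltW (lam0 k))// mulrAC ler_pdivrMr ?ltr_wpDl//.
by rewrite ler_wpM2l ?(ltW e0)// lerDl.
Unshelve. all: by end_near. Qed.

Lemma tube_remainder_cvg (g : delay_fun R n m R) t (u v : 'rV[R]_m) (a b : nat -> 'rV[R]_n) :
  C1_on_tube t0 t1 delta gamma X g -> t0 <= t <= t1 ->
  (forall k, `|a k| <= C * lam k) -> (forall k, `|b k| <= C * lam k) ->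
  (g t (X t + a k) (X (t - delta) + b k) u v - g t (X t) (X (t - delta)) u v
   - dotp (a k) (gradx g t (X t) (X (t - delta)) u v)
   - dotp (b k) (grady g t (X t) (X (t - delta)) u v)) / lam k @[k --> \oo] --> 0.
Proof.
move=> gC tt aC bC; apply: quotient_cvg0 => e e0.
have e2 : 0 < e / 2 by rewrite divr_gt0.
have [d d0 dP] := tube_remainder gC u v gamma_gt0 tt e2.
near=> k; have kd : C * lam k <= d by near: k; exact: near_le_lam.
rewrite (le_trans (dP _ _ _ _))//; [exact: le_trans kd|exact: le_trans kd|].
by rewrite -mulrA ler_wpM2l ?(ltW e0)// mulrC ler_pdivrMr// mulr_natr mulr2n lerD.
Unshelve. all: by end_near. Qed.

Lemma differentiable_remainder_cvg (S : 'rV[R]_n -> R) z (a : nat -> 'rV[R]_n) :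
  differentiable S z -> (forall k, `|a k| <= C * lam k) ->
  (S (z + a k) - S z - dotp (a k) (gradient S z)) / lam k @[k --> \oo] --> 0.
Proof.
move=> Sz aC; apply: quotient_cvg0 => e e0.
have [d d0 dP] := differentiable_remainder Sz e0.
near=> k; have kd : C * lam k <= d by near: k; exact: near_le_lam.
by rewrite (le_trans (dP _ _))//; [exact: le_trans kd|rewrite ler_wpM2l ?(ltW e0)].
Unshelve. all: by end_near. Qed.

End Limits.

Section NeedleInequality.
Context {R : realType} {n m : nat} (t0 t1 delta gamma : R).
Context (f : delay_fun R n m R) (phi : delay_fun R n m 'rV[R]_n).
Context (X : R -> 'rV[R]_n) (w : R -> 'rV[R]_m).
Context (t01 : t0 < t1) (delta_gt0 : 0 < delta) (gamma_gt0 : 0 < gamma).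
Context (Xc : continuous X) (wr : regulated w).
Context (fC : C1_on_tube t0 t1 delta gamma X f).
Context (phiC : C1_on_tube t0 t1 delta gamma X phi).
Context (p : R -> 'rV[R]_n) (pc : continuous p).

Let H t x y u v := pontryagin f phi t x y u v (p t).
Let Hx t := adjoint_row delta f phi X w gradx t (p t).
Let Hy t := adjoint_row delta f phi X w grady t (p t).
Let sr xi wl := state_remainder t0 t1 delta f phi X w p xi wl.
Let ci wl := control_increment t0 t1 delta f phi X w p wl.

(** The value [v] acts twice: on the needle as the present control, and one delay later, in
    [gain_delayed], as the delayed control. *)
Definition gain_now v t := chi_mul t0 t1 t
  (H t (X t) (X (t - delta)) v (w (t - delta)) - H t (X t) (X (t - delta)) (w t) (w (t - delta))).

Definition gain_delayed v t := chi_mul t0 t1 t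
  (H t (X t) (X (t - delta)) (w t) v - H t (X t) (X (t - delta)) (w t) (w (t - delta))).

(** The majorant for dominated convergence. Each difference keeps its control arguments fixed and is
    Lipschitz in the state, so the bound O(c) also holds on the needle and its echo. *)
Lemma state_remainder_bound (rho r : R) : rho < gamma ->
  (forall t, t0 - delta <= t <= t1 -> `|w t| <= r) ->
  exists2 M, 0 <= M & forall (xi : R -> 'rV[R]_n) (wl : R -> 'rV[R]_m) (c : R),
    (forall t, t0 - delta <= t <= t1 -> `|wl t| <= r) -> c <= rho ->
    (forall t, t <= t1 -> `|xi t| <= c) -> forall t, `|sr xi wl t| <= M * c.
Proof.
move=> rg wR; have d0 := delta_gt0.
have [Lf Lf0 LfP] := tube_lipschitz Xc fC r rg.
have /choice[L LP] : forall j, exists L, 0 <= L /\ forall (t : R) (a a' b b' : 'rV[R]_n) (u v : 'rV[R]_m),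
    t0 <= t <= t1 -> `|a| <= rho -> `|a'| <= rho -> `|b| <= rho -> `|b'| <= rho -> `|u| <= r -> `|v| <= r ->
    `|coord_fun phi j t (X t + a) (X (t - delta) + b) u v - coord_fun phi j t (X t + a') (X (t - delta) + b') u v|
      <= L * (`|a - a'| + `|b - b'|).
  by move=> j; have [L L0 LP] := tube_lipschitz Xc (C1_on_tube_coord j phiC) r rg; exists L.
have [Pm PmP] := regulated_bounded t0 t1 (regulated_continuous pc).
have [Mx MxP] := regulated_bounded t0 t1 (adjoint_row_regulated t01 gamma_gt0 Xc wr fC phiC pc (@gradx_within R n m t0 t1 delta gamma X)).
have [My MyP] := regulated_bounded t0 t1 (adjoint_row_regulated t01 gamma_gt0 Xc wr fC phiC pc (@grady_within R n m t0 t1 delta gamma X)).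
have M0 : 0 <= (\sum_j `|Pm| * (L j * 2)) + Lf * 2 + n%:R * `|Mx| + n%:R * `|My|.
  by rewrite !addr_ge0 ?mulr_ge0//; apply: sumr_ge0 => j _; rewrite !mulr_ge0//; exact: (LP j).1.
exists ((\sum_j `|Pm| * (L j * 2)) + Lf * 2 + n%:R * `|Mx| + n%:R * `|My|); first exact: M0.
move=> xi wl c wlR crho xic t.
have c0 : 0 <= c by rewrite (le_trans _ (xic t1 _)).
rewrite /sr /state_remainder; apply: norm_chi_mul_le => [|tt]; first exact: mulr_ge0.
move: (tt) => /andP[tt0 tt1].
have x1 := xic t tt1; have x2 : `|xi (t - delta)| <= c by apply: xic; lra.
have w1 : `|wl t| <= r by apply: wlR; lra.
have w2 : `|wl (t - delta)| <= r by apply: wlR; lra.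
have z0 : `|0 : 'rV[R]_n| <= rho by rewrite normr0 (le_trans c0).
have r1 := le_trans x1 crho; have r2 := le_trans x2 crho.
have hx : `|dotp (xi t) (Hx t)| <= n%:R * `|Mx| * c.
  rewrite (le_trans (norm_dotp_le _ _))// -mulrA ler_wpM2l// mulrC ler_pM//.
  by have := MxP _ tt; rewrite chi_mul_in// => /le_trans; apply; exact: ler_norm.
have hy : `|dotp (xi (t - delta)) (Hy t)| <= n%:R * `|My| * c.
  rewrite (le_trans (norm_dotp_le _ _))// -mulrA ler_wpM2l// mulrC ler_pM//.
  by have := MyP _ tt; rewrite chi_mul_in// => /le_trans; apply; exact: ler_norm.
have two (L' : R) : 0 <= L' -> L' * (`|xi t| + `|xi (t - delta)|) <= L' * 2 * c.
  by move=> L'0; rewrite -mulrA ler_wpM2l// mulr_natl mulr2n lerD.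
have hf := LfP t _ _ _ _ _ _ tt r1 z0 r2 z0 w1 w2.
rewrite !addr0 !subr0 in hf; have {}hf := le_trans hf (two _ Lf0).
have hj j : `|p t 0 j * (coord_fun phi j t (X t + xi t) (X (t - delta) + xi (t - delta)) (wl t) (wl (t - delta))
    - coord_fun phi j t (X t) (X (t - delta)) (wl t) (wl (t - delta)))| <= `|Pm| * (L j * 2) * c.
  have := (LP j).2 t _ _ _ _ _ _ tt r1 z0 r2 z0 w1 w2.
  rewrite !addr0 !subr0 => h; rewrite normrM -mulrA ler_pM//.
    by rewrite (le_trans (norm_coord_le _ _))// (le_trans (PmP _ tt))// ler_norm.
  exact: le_trans h (two _ (LP j).1).
rewrite !pontryaginE.
rewrite (_ : _ - _ - _ - _ = \sum_j (p t 0 j * (coord_fun phi j t (X t + xi t) (X (t - delta) + xi (t - delta)) (wl t) (wl (t - delta))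
    - coord_fun phi j t (X t) (X (t - delta)) (wl t) (wl (t - delta)))) -
   (f t (X t + xi t) (X (t - delta) + xi (t - delta)) (wl t) (wl (t - delta)) - f t (X t) (X (t - delta)) (wl t) (wl (t - delta)))
   - dotp (xi t) (Hx t) - dotp (xi (t - delta)) (Hy t)); last first.
  under [in RHS]eq_bigr do rewrite mulrBr; rewrite sumrB.
  by congr (_ - _ - _); ring.
rewrite !mulrDl (le_trans (ler_normB _ _))// lerD//.
rewrite (le_trans (ler_normB _ _))// lerD//.
rewrite (le_trans (ler_normB _ _))// lerD//.
by rewrite (le_trans (ler_norm_sum _ _ _))// mulr_suml ler_sum.
Qed.

Lemma gain_now_regulated v : regulated (gain_now v).
Proof.
have X0 t : t0 <= t <= t1 -> `|X t - X t| < gamma by move=> _; exact: norm_subrr_lt.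
have Y0 t : t0 <= t <= t1 -> `|X (t - delta) - X (t - delta)| < gamma by move=> _; exact: norm_subrr_lt.
have Hr := pontryagin_regulated t01 fC phiC pc Xc (Xdelay_continuous Xc) X0 Y0.
have := regulatedB (Hr _ _ (@regulated_cst R _ v) (regulated_shift (- delta) wr)) (Hr _ _ wr (regulated_shift (- delta) wr)).
by congr regulated; apply/funext => t; rewrite /gain_now /chi_mul; case: ifP; rewrite ?subr0.
Qed.

Lemma gain_delayed_regulated v : regulated (gain_delayed v).
Proof.
have X0 t : t0 <= t <= t1 -> `|X t - X t| < gamma by move=> _; exact: norm_subrr_lt.
have Y0 t : t0 <= t <= t1 -> `|X (t - delta) - X (t - delta)| < gamma by move=> _; exact: norm_subrr_lt.
have Hr := pontryagin_regulated t01 fC phiC pc Xc (Xdelay_continuous Xc) X0 Y0.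
have := regulatedB (Hr _ _ wr (@regulated_cst R _ v)) (Hr _ _ wr (regulated_shift (- delta) wr)).
by congr regulated; apply/funext => t; rewrite /gain_delayed /chi_mul; case: ifP; rewrite ?subr0.
Qed.

Lemma gain_now_continuous v t : t != t0 -> t != t1 -> {for t, continuous w} ->
  {for t - delta, continuous w} -> {for t, continuous (gain_now v)}.
Proof.
move=> tn0 tn1 wc wdc.
have wdc' : {for t, continuous (fun t => w (t - delta))}.
  apply: (@continuous_comp _ _ _ (fun t => t - delta) w); last exact: wdc.
  by apply: cvgB; [exact: cvg_id|exact: cvg_cst].
have vc : {for t, continuous (fun _ : R => v)} by exact: cvg_cst.
have h1 := pontryagin_continuous t01 gamma_gt0 Xc fC phiC pc tn0 tn1 vc wdc'.
have h2 := pontryagin_continuous t01 gamma_gt0 Xc fC phiC pc tn0 tn1 wc wdc'.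
have := continuousB h1 h2; congr continuous_at; apply/funext => r.
by rewrite !fctE /gain_now /chi_mul; case: ifP; rewrite ?subr0.
Qed.

Lemma gain_delayed_continuous v t : t != t0 -> t != t1 -> {for t, continuous w} ->
  {for t - delta, continuous w} -> {for t, continuous (gain_delayed v)}.
Proof.
move=> tn0 tn1 wc wdc.
have wdc' : {for t, continuous (fun t => w (t - delta))}.
  apply: (@continuous_comp _ _ _ (fun t => t - delta) w); last exact: wdc.
  by apply: cvgB; [exact: cvg_id|exact: cvg_cst].
have vc : {for t, continuous (fun _ : R => v)} by exact: cvg_cst.
have h1 := pontryagin_continuous t01 gamma_gt0 Xc fC phiC pc tn0 tn1 wc vc.
have h2 := pontryagin_continuous t01 gamma_gt0 Xc fC phiC pc tn0 tn1 wc wdc'.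
have := continuousB h1 h2; congr continuous_at; apply/funext => r.
by rewrite !fctE /gain_delayed /chi_mul; case: ifP; rewrite ?subr0.
Qed.

(** For [lam <= delta] the needle and its echo are disjoint, so the present and the delayed control
    are never changed together and no mixed term appears. *)
Lemma control_increment_needle tau lam v : 0 <= lam -> lam <= delta ->
  ci (needle_control w tau lam v) = (fun t => needle tau (tau + lam) (gain_now v) t +
     needle (tau + delta) (tau + delta + lam) (gain_delayed v) t).
Proof.
move=> lam0 lamd; apply/funext => t.
have sh : (t - delta \in `[tau, tau + lam[) = (t \in `[tau + delta, tau + delta + lam[).
  by rewrite !in_itv/=; apply/idP/idP; lra.
rewrite /ci /control_increment /needle /needle_control sh.
have [i1|i1] := boolP (t \in `[tau, tau + lam[).
  have -> : (t \in `[tau + delta, tau + delta + lam[) = false.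
    by apply/negbTE; move: i1; rewrite !in_itv/= => /andP[h1 h2]; rewrite negb_and -!ltNge; apply/orP; left; lra.
  by rewrite addr0.
by rewrite add0r; case: ifP => // _; rewrite subrr /chi_mul; case: ifP.
Qed.

Lemma Rintegral_control_increment tau lam v : t0 <= tau -> 0 <= lam -> lam <= delta ->
  Rintegral lebesgue_measure `[t0, t1] (ci (needle_control w tau lam v)) =
  (primitive t0 (gain_now v) (tau + lam) - primitive t0 (gain_now v) tau) +
  (primitive t0 (gain_delayed v) (tau + delta + lam) - primitive t0 (gain_delayed v) (tau + delta)).
Proof.
move=> t0tau lam0 lamd; have d0 := delta_gt0.
have nr := gain_now_regulated v; have dr := gain_delayed_regulated v.
set c := ci _; have cE := control_increment_needle tau v lam0 lamd.
have cr : regulated c.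
  by rewrite /c cE; apply: regulatedD; exact: regulated_needle.
(* The echo may reach beyond [t1]. The increment is cut off there, so integrating up to [T] changes
   nothing and both needles are fully covered. *)
set T := Num.max t1 (tau + delta + lam).
have tT : t1 <= T by rewrite /T le_max lexx.
have tT' : tau + delta + lam <= T by rewrite /T le_max lexx orbT.
rewrite -[LHS]/(primitive t0 c t1) -(primitive_zero_on cr (ltW t01) tT); last first.
  by move=> t /andP[t1t _]; rewrite /c /ci /control_increment chi_mul_out// negb_and -!ltNge t1t orbT.
rewrite /c cE primitiveD; [|exact: regulated_needle|exact: regulated_needle].
by rewrite !primitive_needle//; lra.
Qed.

End NeedleInequality.

(** * Necessary conditions *)



Lemma cvg_sum0 {R : realType} {I : finType} (F : I -> nat -> R) :
  (forall j, F j k @[k --> \oo] --> 0) -> \sum_j F j k @[k --> \oo] --> 0.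
Proof.
move=> F0; rewrite (_ : (fun k => _) = \sum_j F j); last by apply/funext => k; rewrite fct_sumE.
apply: (big_ind (fun g : nat -> R => g k @[k --> \oo] --> 0)) => //.
- exact: cvg_cst.
- by move=> g h g0 h0; rewrite -[X in _ --> X]addr0; exact: cvgD.
Qed.

Section NecessaryCondition.
Context {R : realType} {n m : nat} (t0 t1 delta gamma : R).
Context (f : delay_fun R n m R) (phi : delay_fun R n m 'rV[R]_n).
Context (X : R -> 'rV[R]_n) (w : R -> 'rV[R]_m).
Context (t01 : t0 < t1) (delta_gt0 : 0 < delta) (gamma_gt0 : 0 < gamma).
Context (Xc : continuous X) (wr : regulated w).
Context (fC : C1_on_tube t0 t1 delta gamma X f).
Context (phiC : C1_on_tube t0 t1 delta gamma X phi).
Context (p : R -> 'rV[R]_n) (pc : continuous p) (sp : seq R).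
Context (pd : forall t, t0 < t < t1 -> t \notin sp ->
    is_derive t 1 p (- adjoint_row delta f phi X w gradx t (p t)
      - chi_mul t0 (t1 - delta) t (adjoint_row delta f phi X w grady (t + delta) (p (t + delta))))).

Lemma dotp_adjoint_row D t (a : 'rV[R]_n) :
  dotp a (adjoint_row delta f phi X w D t (p t)) =
  \sum_j p t 0 j * dotp a (along delta X w (D (coord_fun phi j)) t) - dotp a (along delta X w (D f) t).
Proof.
rewrite /dotp; under eq_bigr do rewrite mxE mulrBr mulr_sumr.
rewrite sumrB; congr (_ - _); rewrite exchange_big/=; apply: eq_bigr => j _.
by rewrite mulr_sumr; apply: eq_bigr => i _; rewrite mulrCA.
Qed.

Lemma needle_control_off (tau lam : R) v (t : R) : 0 < lam -> t != tau -> lam < `|t - tau| ->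
  needle_control w tau lam v t = w t.
Proof.
move=> lam0 ttau lamt; rewrite /needle_control in_itv/=.
case: ifP => // /andP[h1 h2]; move: lamt.
by rewrite ger0_norm ?subr_ge0// => ?; exfalso; lra.
Qed.

(** For fixed [t] other than [tau] and [tau + delta], a short needle misses both [t] and
    [t - delta]. The control is then [w], and the remainder is a combination of Taylor remainders of
    [f] and the coordinates of [phi]. *)
Lemma state_remainder_cvg (tau C : R) (v : 'rV[R]_m) (lam : nat -> R) (xi : nat -> R -> 'rV[R]_n) t :
  (forall k, 0 < lam k) -> lam k @[k --> \oo] --> 0 -> 0 <= C ->
  (forall k t, t <= t1 -> `|xi k t| <= C * lam k) ->
  t0 <= t <= t1 -> t \notin [:: tau; tau + delta] ->
  state_remainder t0 t1 delta f phi X w p (xi k) (needle_control w tau (lam k) v) t * (lam k)^-1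
    @[k --> \oo] --> 0.
Proof.
move=> lam0 laml C0 xiC tt; rewrite !inE negb_or => /andP[ttau ttaud].
have d0 := delta_gt0; move: (tt) => /andP[tt0 tt1].
have xi1 k : `|xi k t| <= C * lam k by exact: xiC.
have xi2 k : `|xi k (t - delta)| <= C * lam k by apply: xiC; lra.
pose q g k := (g t (X t + xi k t) (X (t - delta) + xi k (t - delta)) (w t) (w (t - delta)) - along delta X w g t
   - dotp (xi k t) (along delta X w (gradx g) t)
   - dotp (xi k (t - delta)) (along delta X w (grady g) t)) / lam k.
have q0 g : C1_on_tube t0 t1 delta gamma X g -> q g k @[k --> \oo] --> 0.
  by move=> gC; exact: (tube_remainder_cvg gamma_gt0 lam0 laml C0 _ _ gC tt xi1 xi2).
have qH : \sum_j p t 0 j * q (coord_fun phi j) k - q f k @[k --> \oo] --> 0.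
  rewrite -[X in _ --> X](subrr 0); apply: cvgB; last exact: q0.
  apply: cvg_sum0 => j; rewrite -[X in _ --> X](mulr0 (p t 0 j)).
  by apply: cvgM; [exact: cvg_cst|apply: q0; exact: C1_on_tube_coord].
apply: cvg_trans qH; apply: near_eq_cvg.
have ndist (x : R) : x != tau -> \forall k \near \oo, lam k < `|x - tau|.
  move=> xtau; have x0 : 0 < `|x - tau| by rewrite normr_gt0 subr_eq0.
  have /cvgrPdist_lt/(_ _ x0) := laml; apply: filterS => k.
  by rewrite sub0r normrN gtr0_norm.
have tdtau : t - delta != tau by rewrite subr_eq.
near=> k.
have w1 : needle_control w tau (lam k) v t = w t.
  by apply: needle_control_off => //; near: k; exact: ndist.
have w2 : needle_control w tau (lam k) v (t - delta) = w (t - delta).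
  by apply: needle_control_off => //; near: k; exact: ndist.
rewrite /state_remainder w1 w2 chi_mul_in// !dotp_adjoint_row !pontryaginE.
under eq_bigr do rewrite mulrA; rewrite -mulr_suml -mulrBl; congr (_ * _).
under eq_bigr do rewrite !mulrBr; rewrite !sumrB /along.
by ring.
Unshelve. all: by end_near. Qed.

(** Optimality enters as a nonnegative cost increment for all short needles with small deviation,
    which separates the asymptotics from admissibility. Avoiding [t1] and the jumps of [w] makes
    both gains continuous where they are evaluated. *)
Lemma needle_inequality (S : 'rV[R]_n -> R) (tau eps : R) (v : 'rV[R]_m) :
  differentiable S (X t1) -> p t1 = - gradient S (X t1) ->
  t0 < tau -> tau != t1 -> tau + delta != t1 -> {for tau, continuous w} ->
  {for tau - delta, continuous w} -> {for tau + delta, continuous w} ->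
  0 < eps ->
  (forall lam xi, 0 < lam -> lam <= eps -> continuous xi -> (forall t, t <= t0 -> xi t = 0) ->
    (forall t, t <= t1 -> `|xi t| <= eps) ->
    (exists s : seq R, forall t, t0 < t < t1 -> t \notin s ->
       is_derive t 1 xi (phi t (X t + xi t) (X (t - delta) + xi (t - delta))
              (needle_control w tau lam v t) (needle_control w tau lam v (t - delta))
            - along delta X w phi t)) ->
    0 <= Rintegral lebesgue_measure `[t0, t1]
           (cost_increment t0 t1 delta f X w xi (needle_control w tau lam v))
         + (S (X t1 + xi t1) - S (X t1))) ->
  gain_now t0 t1 delta f phi X w p v tau + gain_delayed t0 t1 delta f phi X w p v (tau + delta) <= 0.
Proof.
move=> Sd pt1 t0tau taut1 taudt1 wtau wtaum wtaup eps0 opt; have d0 := delta_gt0.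
have [r0 r00 wR0] := w_bounded wr (t0 - delta) t1.
pose r := Num.max r0 `|v|.
have wR t : t0 - delta <= t <= t1 -> `|w t| <= r by move=> /wR0 h; rewrite /r le_max h.
have vr : `|v| <= r by rewrite /r le_max lexx orbT.
pose rho := gamma / 2.
have rho0 : 0 < rho by rewrite divr_gt0.
have rhog : rho < gamma by rewrite ltr_pdivrMr// ltr_pMr// ltr1n.
have [C C0 CP] := perturbed_trajectory t01 delta_gt0 gamma_gt0 Xc wr phiC (ltW rho0) rhog wR.
have C1 : 0 < C + 1 by rewrite ltr_wpDl.
(* Ensures [lam <= eps], [lam <= delta] for disjoint needles, and [C * lam] below both [rho] and
   [eps]; [C + 1] avoids dividing by zero. *)
pose Lam := Num.min (Num.min eps delta) (Num.min rho eps / (C + 1)).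
have Lam0 : 0 < Lam by rewrite !lt_min eps0 d0 divr_gt0// lt_min rho0.
pose lam k := Lam * harmonic k.
have h0 k : 0 < @harmonic R k by rewrite invr_gt0.
have h1 k : @harmonic R k <= 1 by rewrite invf_le1// ler1n.
have lam0 k : 0 < lam k by rewrite mulr_gt0.
have lamL k : lam k <= Lam by rewrite ler_piMr// ltW.
have laml : lam k @[k --> \oo] --> 0.
  by rewrite -[X in _ --> X](mulr0 Lam); apply: cvgM; [exact: cvg_cst|exact: cvg_harmonic].
have lame k : lam k <= eps by rewrite (le_trans (lamL k))// !ge_min lexx.
have lamd k : lam k <= delta by rewrite (le_trans (lamL k))// !ge_min lexx orbT.
have Clam k : C * lam k <= Num.min rho eps.
  have e0 : 0 < Num.min rho eps by rewrite lt_min rho0.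
  have h : lam k <= Num.min rho eps / (C + 1) by rewrite (le_trans (lamL k))// ge_min lexx orbT.
  rewrite (le_trans (ler_wpM2l C0 h))// mulrA ler_pdivrMr// mulrC.
  by rewrite ler_wpM2l ?(ltW e0)// lerDl.
have Clamr k : C * lam k <= rho by rewrite (le_trans (Clam k))// ge_min lexx.
have Clame k : C * lam k <= eps by rewrite (le_trans (Clam k))// ge_min lexx orbT.
have /choice[xi xiP] := fun k => CP tau (lam k) v (ltW t0tau) (ltW (lam0 k)) vr (Clamr k).
pose wl k := needle_control w tau (lam k) v.
have wlr k : regulated (wl k) by exact: needle_control_regulated.
pose sr k := state_remainder t0 t1 delta f phi X w p (xi k) (wl k).
pose ci k := control_increment t0 t1 delta f phi X w p (wl k).
pose fi k := cost_increment t0 t1 delta f X w (xi k) (wl k).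
have xiC k t : t <= t1 -> `|xi k t| <= C * lam k by move=> tt; have [_ _ + _] := xiP k; apply.
have xig k t : t <= t1 -> `|xi k t| < gamma.
  by move=> tt; rewrite (le_lt_trans (xiC k t tt))// (le_lt_trans (Clamr k)).
have srr k : regulated (sr k).
  by have [xc _ _ _] := xiP k; exact: (state_remainder_regulated t01 delta_gt0 gamma_gt0 Xc wr fC phiC pc xc (wlr k) (xig k)).
have ident k : Rintegral lebesgue_measure `[t0, t1] (sr k) + Rintegral lebesgue_measure `[t0, t1] (ci k)
    + Rintegral lebesgue_measure `[t0, t1] (fi k) = dotp (p t1) (xi k t1).
  have [xc x0 _ [s xd]] := xiP k.
  exact: (increment_identity t01 delta_gt0 gamma_gt0 Xc wr fC phiC pc pd xc x0 (wlr k) (xig k) xd).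
pose Sr k := S (X t1 + xi k t1) - S (X t1) - dotp (xi k t1) (gradient S (X t1)).
(* By the transversality condition the boundary term [<p(t1), xi(t1)>] cancels the linear part of
   the increment of [S], leaving its Taylor remainder [Sr]. *)
have le k : Rintegral lebesgue_measure `[t0, t1] (ci k) / lam k <=
    Sr k / lam k - Rintegral lebesgue_measure `[t0, t1] (sr k) / lam k.
  rewrite -mulrBl ler_pM2r ?invr_gt0//.
  have [xc x0 _ xd] := xiP k.
  have xe t : t <= t1 -> `|xi k t| <= eps by move=> tt; exact: le_trans (xiC k t tt) (Clame k).
  have := opt (lam k) (xi k) (lam0 k) (lame k) xc x0 xe xd.
  rewrite -/(wl k) -/(fi k); have := ident k.
  rewrite pt1 dotpC (_ : dotp _ (- _) = - dotp (xi k t1) (gradient S (X t1))); last first.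
    by rewrite -[- gradient _ _]sub0r dotpBr /dotp big1 ?sub0r// => i _; rewrite mxE mulr0.
  by rewrite /Sr; lra.
have limS : Sr k / lam k @[k --> \oo] --> 0.
  by apply: (differentiable_remainder_cvg lam0 laml C0 Sd) => k; exact: xiC.
have limR : Rintegral lebesgue_measure `[t0, t1] (sr k) / lam k @[k --> \oo] --> 0.
  have [M M0 MP] := state_remainder_bound t01 delta_gt0 gamma_gt0 Xc wr fC phiC pc rhog wR.
  have -> : (fun k => Rintegral lebesgue_measure `[t0, t1] (sr k) / lam k) =
      (fun k => Rintegral lebesgue_measure `[t0, t1] (fun t => sr k t * (lam k)^-1)).
    by apply/funext => k; rewrite RintegralZr//; exact: regulated_integrable.
  apply: (@Rintegral_cvg0 _ [:: tau; tau + delta] _ t0 t1 (M * C)).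
  - by move=> k; apply: regulatedM => //; exact: regulated_cst.
  - move=> k t tt; rewrite normrM normfV (gtr0_norm (lam0 k)) ler_pdivrMr// -mulrA.
    apply: MP => //; last exact: xiC.
    by move=> t' tt'; apply: norm_needle_control_le => //; exact: wR.
  - by move=> t tt ts; exact: (state_remainder_cvg v lam0 laml C0 xiC tt ts).
have nr := gain_now_regulated t01 gamma_gt0 Xc wr fC phiC pc v.
have dr := gain_delayed_regulated t01 gamma_gt0 Xc wr fC phiC pc v.
(* The integral is a sum of two increments of primitives, so the quotients tend to the integrands at
   the continuity points [tau] and [tau + delta]. *)
have limC : Rintegral lebesgue_measure `[t0, t1] (ci k) / lam k @[k --> \oo] -->
    gain_now t0 t1 delta f phi X w p v tau + gain_delayed t0 t1 delta f phi X w p v (tau + delta).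
  have nd : is_derive tau 1 (primitive t0 (gain_now t0 t1 delta f phi X w p v)) (gain_now t0 t1 delta f phi X w p v tau).
    have taut0 : tau != t0 by rewrite gt_eqF.
    apply: (primitive_derive nr t0tau).
    exact: (gain_now_continuous t01 gamma_gt0 Xc fC phiC pc taut0 taut1 wtau wtaum).
  have dd : is_derive (tau + delta) 1 (primitive t0 (gain_delayed t0 t1 delta f phi X w p v))
      (gain_delayed t0 t1 delta f phi X w p v (tau + delta)).
    have t0taud : t0 < tau + delta by lra.
    have taudt0 : tau + delta != t0 by rewrite gt_eqF.
    have wtaudd : {for tau + delta - delta, continuous w} by rewrite addrK; exact: wtau.
    apply: (primitive_derive dr t0taud).
    exact: (gain_delayed_continuous t01 gamma_gt0 Xc fC phiC pc taudt0 taudt1 wtaup wtaudd).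
  apply: cvg_trans (cvgD (difference_quotient_cvg nd lam0 laml) (difference_quotient_cvg dd lam0 laml)).
  apply: near_eq_cvg; apply: nearW => k; rewrite !fctE.
  rewrite -mulrDl; congr (_ / _); apply: esym.
  exact: (Rintegral_control_increment t01 delta_gt0 gamma_gt0 Xc wr fC phiC pc v (ltW t0tau) (ltW (lam0 k)) (lamd k)).
rewrite -(subrr (0 : R)); apply: (ler_cvg_to limC (cvgB limS limR)).
exact: nearW.
Qed.

End NecessaryCondition.



(** * Admissibility and cost of the perturbed pair *)

Section Admissible.
Context {R : realType} {n m : nat} (t0 t1 delta gamma : R).
Context (x0 : 'rV[R]_n) (U : set 'rV[R]_m) (u0 : 'rV[R]_m).
Context (f : delay_fun R n m R) (phi : delay_fun R n m 'rV[R]_n) (S : 'rV[R]_n -> R).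
Context (xs X : R -> 'rV[R]_n) (us w : R -> 'rV[R]_m) (sx : seq R).
Context (t01 : t0 < t1) (delta_gt0 : 0 < delta) (gamma_gt0 : 0 < gamma).
Context (Xc : continuous X) (wr : regulated w) (wrc : right_continuous w).
Context (wl1 : w r @[r --> side false t1] --> w t1).
Context (fC : C1_on_tube t0 t1 delta gamma X f).
Context (phiC : C1_on_tube t0 t1 delta gamma X phi).
Context (Xxs : forall t, t0 - delta <= t <= t1 -> X t = xs t).
Context (wus : forall t, t0 - delta <= t <= t1 -> w t = us t).
Context (Xx0 : forall t, t0 - delta <= t <= t0 -> X t = x0).
Context (wu0 : forall t, t0 - delta <= t < t0 -> w t = u0).
Context (wU : forall t, t0 <= t <= t1 -> U (w t)).
Context (Xd : forall t, t0 < t < t1 -> t \notin sx -> is_derive t 1 X (along delta X w phi t)).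

Lemma regulated_piecewise_continuous (u : R -> 'rV[R]_m) : regulated u -> right_continuous u ->
  u r @[r --> side false t1] --> u t1 -> piecewise_continuous t0 t1 u.
Proof.
move=> [s [us' ul]] urc ul1; exists [seq t <- s | t0 < t < t1].
apply: (pc_off_sides t01).
- by move=> t; rewrite mem_filter in_itv/= => /andP[].
- by move=> t _; exact: urc.
- by move=> t /andP[t0t tt1]; exact: ul.
- move=> t /andP[t0t tt1]; rewrite mem_filter negb_and t0t/= => ts.
  have [lt|ge] := ltP t t1; last by have -> : t = t1 by apply/eqP; rewrite eq_le tt1 ge.
  move: ts; rewrite lt/= => ts.
  by apply: cvg_trans (us' t ts); apply: cvg_app; exact: (@side_nbhs _ false t).
Qed.

(** The perturbed velocity, clamped in time, is regulated and right-continuous. Only its value at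
    [t1] has to be corrected to obtain the derivative required by [piecewise_C1]. *)
Lemma perturbed_admissible (tau lam : R) (v : 'rV[R]_m) (xi : R -> 'rV[R]_n) (xis : seq R) :
  U v -> t0 < tau -> 0 < lam -> tau + lam < t1 ->
  continuous xi -> (forall t, t <= t0 -> xi t = 0) -> (forall t, t <= t1 -> `|xi t| < gamma) ->
  (forall t, t0 < t < t1 -> t \notin xis ->
     is_derive t 1 xi (phi t (X t + xi t) (X (t - delta) + xi (t - delta))
       (needle_control w tau lam v t) (needle_control w tau lam v (t - delta)) - along delta X w phi t)) ->
  admissible t0 t1 delta x0 U u0 phi (fun t => X t + xi t) (needle_control w tau lam v).
Proof.
move=> Uv t0tau lam0 taut1 xic xi0 xig xid; have d0 := delta_gt0.
set wl := needle_control w tau lam v.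
have wlr : regulated wl by exact: needle_control_regulated.
have wlrc : right_continuous wl.
  by apply: right_continuous_ite_co => //; exact: right_continuous_cst.
(* The needle ends before [t1], so near [t1] the control is the reference one. *)
have wll1 : wl r @[r --> side false t1] --> wl t1.
  have wE t : tau + lam <= t -> wl t = w t.
    by move=> tt; rewrite /wl /needle_control in_itv/= [t < _]ltNge tt andbF.
  rewrite wE ?ltW//; apply: cvg_trans wl1; apply: near_eq_cvg.
  near=> r; rewrite wE//; near: r; exact: nbhs_left_ge.
split.
- have [pc _ _ _] := phiC.
  pose x t := X t + xi t; pose y t := X (t - delta) + xi (t - delta).
  have xc : continuous x by move=> t; apply: cvgD; [exact: Xc|exact: xic].
  have yc : continuous y := Xdelay_continuous xc.
  have xn t : t0 <= t <= t1 -> `|x t - X t| < gamma.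
    by move=> /andP[_ tt]; rewrite /x addrC addKr xig.
  have yn t : t0 <= t <= t1 -> `|y t - X (t - delta)| < gamma.
    by move=> /andP[_ tt]; rewrite /y addrC addKr xig//; lra.
  pose h t := phi (clamp_itv t0 t1 t) (x (clamp_itv t0 t1 t)) (y (clamp_itv t0 t1 t)) (wl t) (wl (t - delta)).
  have hr : regulated h.
    exact: (tube_regulated (ltW t01) pc xc yc xn yn wlr (regulated_shift (- delta) wlr)).
  have hrc t : h r @[r --> side true t] --> h t.
    apply: (tube_cvg (ltW t01) pc xc yc xn yn).
    - exact: side_nbhs.
    - exact: wlrc.
    - exact: (@right_continuous_shift _ _ wl (- delta) wlrc t).
  have hE t : t0 <= t <= t1 -> h t = phi t (x t) (y t) (wl t) (wl (t - delta)).
    by move=> tt; rewrite /h clamp_itv_id.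
  have [s [hs hl]] := hr.
  have hs' t : t \notin s ++ xis ++ sx -> {for t, continuous h}.
    by rewrite mem_cat negb_or => /andP[ts _]; exact: hs.
  (* At [t1] the velocity may jump through [wl (t - delta)], and [g] takes the left limit. On [[t0,
     t1[] right-continuity of [h] gives [g = h], as the dynamics demands. *)
  have [g [[s' [s'E g_pc]] gh _]] := regulated_repair t01 hs' hl.
  have gE t : t0 <= t < t1 -> g t = phi t (x t) (y t) (wl t) (wl (t - delta)).
    by move=> /andP[h1 h2]; rewrite gh ?h1// hE// h1 ltW.
  exists g; split; last first.
    by move=> t; rewrite in_itv/= => tt; exact: gE.
  split; first exact: continuous_subspaceT.
  exists s'; split => // t; rewrite in_itv/= => tt; rewrite s'E tt/=.
  rewrite !mem_cat !negb_or => /and3P[ts txi tsx].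
  have := is_deriveD (Xd tt tsx) (xid t tt txi).
  rewrite [X in is_derive _ _ _ X]addrC subrK.
  by rewrite gE//; case/andP: tt => h1 h2; rewrite h2 ltW.
- exact: regulated_piecewise_continuous.
- move=> t; rewrite in_itv/= => tt; rewrite /wl /needle_control.
  by case: ifP => // _; exact: wU.
- move=> t; rewrite in_itv/= => tt; rewrite Xx0// xi0 ?addr0//.
  by case/andP: tt.
- move=> t; rewrite in_itv/= => tt; rewrite /wl /needle_control in_itv/=.
  by rewrite leNgt (lt_trans _ t0tau) ?wu0//; case/andP: tt.
Unshelve. all: by end_near. Qed.

(** The reference cost is given by [xs] and [us], the increment by [X] and [w]; they agree at all
    times that the integrand reads. Cut off, both integrands are regulated, so linearity of the
    integral applies. *)
Lemma cost_difference (xi : R -> 'rV[R]_n) (wl : R -> 'rV[R]_m) :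
  continuous xi -> (forall t, t <= t1 -> `|xi t| < gamma) -> regulated wl ->
  cost t0 t1 delta f S (fun t => X t + xi t) wl - cost t0 t1 delta f S xs us =
  Rintegral lebesgue_measure `[t0, t1] (cost_increment t0 t1 delta f X w xi wl)
    + (S (X t1 + xi t1) - S (X t1)).
Proof.
move=> xic xig wlr; have d0 := delta_gt0.
have [fc _ _ _] := fC.
have xc := x_continuous Xc xic.
have yc := y_continuous (delta := delta) Xc xic.
have xn := @x_near _ _ t0 t1 gamma X xi xig.
have yn := @y_near _ _ t0 t1 delta gamma X delta_gt0 xi xig.
have r1 := cut_regulated (ltW t01) fc xc yc xn yn wlr (regulated_shift (- delta) wlr).
have r2 := along_regulated t01 gamma_gt0 Xc wr fc.
have E1 : Rintegral lebesgue_measure `[t0, t1] (fun t => f t (X t + xi t) (X (t - delta) + xi (t - delta)) (wl t) (wl (t - delta))) =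
  Rintegral lebesgue_measure `[t0, t1] (fun t => chi_mul t0 t1 t (f t (X t + xi t) (X (t - delta) + xi (t - delta)) (wl t) (wl (t - delta)))).
  by apply: eq_Rintegral => t; rewrite inE/= in_itv/= => tt; rewrite chi_mul_in.
have E2 : Rintegral lebesgue_measure `[t0, t1] (fun t => f t (xs t) (xs (t - delta)) (us t) (us (t - delta))) =
  Rintegral lebesgue_measure `[t0, t1] (fun t => chi_mul t0 t1 t (along delta X w f t)).
  apply: eq_Rintegral => t; rewrite inE/= in_itv/= => tt; rewrite chi_mul_in//.
  by case/andP: tt => h1 h2; rewrite /along !Xxs ?wus//; lra.
have Et1 : X t1 = xs t1 by apply: Xxs; have := t01; lra.
rewrite /cost E1 E2 -Et1.
rewrite opprD addrACA -RintegralB//; [|exact: regulated_integrable|exact: regulated_integrable].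
congr (_ + _); apply: eq_Rintegral => t _.
by rewrite /cost_increment /chi_mul; case: ifP; rewrite ?subr0.
Qed.

End Admissible.

Theorem theorem4p1 (R : realType) (n m : nat) (t0 t1 delta : R)
    (x0 : 'rV[R]_n) (U : set 'rV[R]_m) (u0 : 'rV[R]_m)
    (f : delay_fun R n m R) (phi : delay_fun R n m 'rV[R]_n)
    (S : 'rV[R]_n -> R) (xs : R -> 'rV[R]_n) (us : R -> 'rV[R]_m)
    (t0_lt_t1 : t0 < t1) (delta_gt0 : 0 < delta) (u0_in_U : U u0)
    (S_C1 : continuously_differentiable S)
    (xsus_adm : admissible t0 t1 delta x0 U u0 phi xs us)
    (xsus_lip : lip_pair t0 t1 delta f phi xs us)
    (xsus_min : strong_local_min t0 t1 delta x0 U u0 f phi S xs us) :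
  exists p dp : R -> 'rV[R]_n,
    [/\ piecewise_C1 t0 t1 p dp,
        {ae @lebesgue_measure R, forall t, t \in `[t0, t1] ->
          dp t = - Hx_along delta f phi xs us p t
                 - chi_mul t0 (t1 - delta) t
                     (Hy_along delta f phi xs us p (t + delta))},
        p t1 = - gradient S (xs t1)
      & {ae @lebesgue_measure R, forall t, t \in `[t0, t1] ->
          is_max_over U
            (fun u => H_along delta f phi xs p t u (us (t - delta))
               + chi_mul t0 (t1 - delta) t
                   (H_along delta f phi xs p (t + delta) (us (t + delta)) u))
            (H_along delta f phi xs p t (us t) (us (t - delta))
               + chi_mul t0 (t1 - delta) t
                   (H_along delta f phi xs p (t + delta) (us (t + delta))
                      (us t)))}].
Proof.
have d0 := delta_gt0; have t01 := t0_lt_t1.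
have [[dx [[xsc [sx [dxpc xsd]]] dxE]] us_pc usU xsx0 usu0] := xsus_adm.
have [gamma [gamma0 fC0 phiC0]] := xsus_lip.
have [_ [eps eps0 min]] := xsus_min.
(* Clamping yields a function continuous on the line. It still agrees with [xs] on
   [[t0 - delta, t0]], because the history is the constant [x0 = xs t0]. *)
pose X t := xs (clamp_itv t0 t1 t).
have Xc : continuous X.
  move=> t; have := @clamp_itv_continuous _ t0 t1 t; move=> cc.
  have ct : `[t0, t1]%classic (clamp_itv t0 t1 t) by rewrite /= in_itv/= clamp_itv_in// ltW.
  have /subspace_continuousP/(_ _ ct) := xsc.
  move=> h; have cw : clamp_itv t0 t1 r @[r --> t] --> within `[t0, t1] (nbhs (clamp_itv t0 t1 t)).
    move=> B /= AB.
    have h2 : \forall r \near t, `[t0, t1]%classic (clamp_itv t0 t1 r) -> B (clamp_itv t0 t1 r) := cc _ AB.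
    by apply: filterS h2 => r; apply; rewrite /= in_itv/= clamp_itv_in// ltW.
  exact: (cvg_comp _ _ cw h).
have Xxs t : t0 - delta <= t <= t1 -> X t = xs t.
  move=> /andP[h1 h2]; rewrite /X; have [h|h] := leP t0 t; first by rewrite clamp_itv_id// h h2.
  rewrite /clamp_itv (min_idPr h2) (max_idPl (ltW h)).
  by rewrite !xsx0// in_itv/=; [rewrite h1 ltW|lra].
have Xx0 t : t0 - delta <= t <= t0 -> X t = x0.
  by move=> tt; rewrite Xxs ?xsx0//; lra.
have fC : C1_on_tube t0 t1 delta gamma X f.
  by apply: (C1_on_tube_eq (ltW delta_gt0) _ fC0) => t tt; rewrite Xxs.
have phiC : C1_on_tube t0 t1 delta gamma X phi.
  by apply: (C1_on_tube_eq (ltW delta_gt0) _ phiC0) => t tt; rewrite Xxs.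
have [w [wr wrc wl1 wus0 wu0']] := pc_extend u0 t01 us_pc.
have wus t : t0 - delta <= t <= t1 -> w t = us t.
  move=> /andP[h1 h2]; have [h|h] := leP t0 t; first by rewrite wus0// h h2.
  by rewrite wu0' ?usu0// in_itv/= h1 h.
have wu0 t : t0 - delta <= t < t0 -> w t = u0 by move=> /andP[_ h]; exact: wu0'.
have wU t : t0 <= t <= t1 -> U (w t) by move=> tt; rewrite wus0//; apply: usU; rewrite in_itv.
have rng t : t0 <= t <= t1 -> [/\ X t = xs t, X (t - delta) = xs (t - delta), w t = us t & w (t - delta) = us (t - delta)].
  by move=> /andP[h1 h2]; split; [apply: Xxs|apply: Xxs|apply: wus|apply: wus]; lra.
have ttW t : t0 < t < t1 -> t0 <= t <= t1 by move=> /andP[h1 h2]; rewrite !ltW.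
have Xd t : t0 < t < t1 -> t \notin sx -> is_derive t 1 X (along delta X w phi t).
  move=> tt ts; have [h1 h2] := andP tt.
  have [E1 E2 E3 E4] := rng t (ttW t tt).
  have -> : along delta X w phi t = dx t.
    by rewrite /along E1 E2 E3 E4 dxE// in_itv/= h2 ltW.
  apply: (near_eq_is_derive _ (xsd t _ ts)); last by rewrite in_itv.
  near=> r; rewrite Xxs//; apply/andP; split.
    apply: ltW; apply: (@lt_trans _ _ t0); first by lra.
    by near: r; exact: lt_nbhsr.
  by apply: ltW; near: r; exact: lt_nbhsl.
have [p [pc pt1 [sp pd]]] := adjoint_solution t01 delta_gt0 gamma0 Xc wr fC phiC (- gradient S (X t1)).
have Xt1 : X t1 = xs t1 by apply: Xxs; lra.
pose hx t := chi_mul t0 t1 t (adjoint_row delta f phi X w gradx t (p t)).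
pose hy t := chi_mul t0 t1 t (adjoint_row delta f phi X w grady t (p t)).
(* The right-hand side of the adjoint equation, with arbitrary values at its jumps; its repaired
   version [dp] has the one-sided continuity of a derivative in [piecewise_C1]. *)
pose h t := - hx t - hy (t + delta).
have hr : regulated h.
  apply: regulatedB.
    apply: regulatedN.
    exact: (adjoint_row_regulated t01 gamma0 Xc wr fC phiC pc (@gradx_within R n m t0 t1 delta gamma X)).
  apply: regulated_shift.
  exact: (adjoint_row_regulated t01 gamma0 Xc wr fC phiC pc (@grady_within R n m t0 t1 delta gamma X)).
have [s [hs hl]] := hr.
have hs' t : t \notin s ++ sp -> {for t, continuous h}.
  by rewrite mem_cat negb_or => /andP[ts _]; exact: hs.
have [dp [[s' [s'E dp_pc]] _ dph]] := regulated_repair t01 hs' hl.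
have chiE (V : zmodType) t (z : V) : t0 <= t <= t1 ->
    chi_mul t0 t1 (t + delta) z = chi_mul t0 (t1 - delta) t z.
  by move=> /andP[h1 _]; apply: chi_mul_shift => //; exact: ltW.
have inT t : t0 <= t <= t1 -> tube t0 t1 delta gamma X (t, X t, X (t - delta), w t, w (t - delta)).
  by move=> tt; split; rewrite ?in_itv//= subrr normr0.
have HxE t : t0 <= t <= t1 -> adjoint_row delta f phi X w gradx t (p t) = Hx_along delta f phi xs us p t.
  move=> tt; have [E1 E2 E3 E4] := rng t tt.
  have [_ fd _ _] := fC; have [_ phid _ _] := phiC.
  have [fdx _] := fd _ _ _ _ _ (inT t tt); have [pdx _] := phid _ _ _ _ _ (inT t tt).
  rewrite /Hx_along -E1 -E2 -E3 -E4.
  have := gradient_dotp_sub (p t) pdx fdx; rewrite /pontryagin => ->.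
  by [].
have HyE t : t0 <= t <= t1 -> adjoint_row delta f phi X w grady t (p t) = Hy_along delta f phi xs us p t.
  move=> tt; have [E1 E2 E3 E4] := rng t tt.
  have [_ fd _ _] := fC; have [_ phid _ _] := phiC.
  have [_ fdy] := fd _ _ _ _ _ (inT t tt); have [_ pdy] := phid _ _ _ _ _ (inT t tt).
  rewrite /Hy_along -E1 -E2 -E3 -E4.
  have := gradient_dotp_sub (p t) pdy fdy; rewrite /pontryagin => ->.
  by [].
have hE t : t0 <= t <= t1 -> h t = - Hx_along delta f phi xs us p t
    - chi_mul t0 (t1 - delta) t (Hy_along delta f phi xs us p (t + delta)).
  move=> tt; rewrite /h /hx chi_mul_in// HxE//; congr (_ - _).
  have [le|lt] := leP t (t1 - delta).
    rewrite /hy HyE ?chiE//; have [h1 h2] := andP tt; lra.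
  rewrite /hy !chi_mul_out// negb_and -!ltNge; apply/orP; right; lra.
exists p, dp; split.
- split; first exact: continuous_subspaceT.
  exists s'; split => // t; rewrite in_itv/= => tt; rewrite s'E tt/= => ts.
  have [h1 h2] := andP tt.
  have := pd t tt; move: (ts); rewrite mem_cat negb_or => /andP[_ tsp] /(_ tsp).
  rewrite dph//; last by rewrite h2 ltW.
  by rewrite /h /hx (chi_mul_in _ (ttW t tt)) /hy chiE// ttW.
(* At [t1] the value of [dp] is a left limit, which the formula may miss when [us (t - delta)] jumps
   there. *)
- apply: (@ae_off _ (t1 :: s ++ sp)) => t; rewrite inE negb_or => /andP[tt1 ts].
  rewrite in_itv/= => tt; rewrite -hE// dph//.
  by have [h1 h2] := andP tt; rewrite h1 lt_neqAle tt1.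
- by rewrite pt1 Xt1.
have [sw [wcont _]] := wr.
(* The shifted lists make [w] continuous at [tau] and at [tau - delta] and [tau + delta]; excluding
   [t1 - delta] keeps [tau + delta] away from the cut-off at [t1]. The list does not depend on [v],
   so one null set serves all of [U]. *)
apply: (@ae_off _ ([:: t0; t1; t1 - delta] ++ sw ++ [seq t + delta | t <- sw] ++ [seq t - delta | t <- sw])) => tau + /[!in_itv]/= tt.
rewrite !mem_cat !inE !negb_or => /and4P[/and3P[taut0 taut1 taut1d] tauw tauwp tauwm].
have [h1 h2] := andP tt.
have t0tau : t0 < tau by rewrite lt_neqAle eq_sym taut0.
have tautt1 : tau < t1 by rewrite lt_neqAle taut1.
have [E1 E2 E3 E4] := rng tau tt.
split; first by exists (us tau) => //; rewrite -E3; exact: wU.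
move=> v Uv.
have wtau : {for tau, continuous w} by exact: wcont.
have wtaum : {for tau - delta, continuous w}.
  by apply: wcont; apply: contra tauwp => i; apply/mapP; exists (tau - delta) => //; rewrite subrK.
have wtaup : {for tau + delta, continuous w}.
  by apply: wcont; apply: contra tauwm => i; apply/mapP; exists (tau + delta) => //; rewrite addrK.
have taudt1 : tau + delta != t1 by apply: contra taut1d => /eqP <-; rewrite addrK.
have [Sd _] := S_C1.
(* The three terms keep the deviation strictly below [eps] in the supremum norm, the trajectory in
   the tube, and the end of the needle before [t1]. *)
pose eps' := Num.min (Num.min (eps / 2) (gamma / 2)) ((t1 - tau) / 2).
have eps'0 : 0 < eps' by rewrite !lt_min !divr_gt0// subr_gt0.
have gain := @needle_inequality _ _ _ t0 t1 delta gamma f phi X w t01 delta_gt0 gamma0 Xc wr fC phiC p pc sp pd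
  S tau eps' v (Sd _) pt1 t0tau taut1 taudt1 wtau wtaum wtaup eps'0.
have {}gain : gain_now t0 t1 delta f phi X w p v tau + gain_delayed t0 t1 delta f phi X w p v (tau + delta) <= 0.
  apply: gain => lam xi lam0 lame xic xi0 xie [xis xid].
  have e1 : eps' <= eps / 2 by rewrite /eps' !ge_min lexx.
  have e2 : eps' <= gamma / 2 by rewrite /eps' !ge_min lexx orbT.
  have e3 : eps' <= (t1 - tau) / 2 by rewrite /eps' ge_min lexx orbT.
  have xig t : t <= t1 -> `|xi t| < gamma.
    by move=> /xie /le_lt_trans; apply; have := gamma0; lra.
  have taulam : tau + lam < t1 by lra.
  have adm := perturbed_admissible t01 delta_gt0 Xc wr wrc wl1 phiC Xx0 wu0 wU Xd
    Uv t0tau lam0 taulam xic xi0 xig xid.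
  have wlr := needle_control_regulated wr tau lam v.
  rewrite -(cost_difference S t01 delta_gt0 gamma0 Xc wr fC Xxs wus xic xig wlr) subr_ge0.
  apply: min adm _; apply: (@le_lt_trans _ _ (eps / 2)); last by lra.
  apply: ge_sup; first by exists `|(X t0 + xi t0) - xs t0|, t0 => //=; rewrite in_itv/= lexx ltW.
  move=> _ [t /= + <-]; rewrite in_itv/= => tt'; have [k1 k2] := andP tt'.
  rewrite /= Xxs; last by lra.
  by rewrite [xs t + _]addrC addrK (le_trans (xie t k2)).
(* The gain one delay later is the second term of the maximum condition; it disappears when
   [tau + delta] exceeds [t1]. *)
move: gain; rewrite /gain_now /gain_delayed chi_mul_in// chiE// addrK.
have [le|lt] := leP tau (t1 - delta).
  have ttd : t0 <= tau + delta <= t1 by lra.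
  have [F1 F2 F3 F4] := rng _ ttd.
  rewrite !chi_mul_in ?h1// /H_along addrK -E1 -E2 -E3 -E4 -F1 -F3.
  by lra.
rewrite !chi_mul_out ?negb_and -?ltNge ?lt ?orbT// !addr0 subr_le0.
by rewrite /H_along -E1 -E2 -E3 -E4.
Unshelve. all: by end_near. Qed.
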